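(* Let $k$ be an algebraically closed field of characteristic $2$, let $q_0$ be a power of $2$, and let $q=2q_0^2$. Let $\tilde{\mathcal{S}}$ be the smooth model of the curve in $\mathbb{P}^3$ over $k$ defined (in affine coordinates $x,y,z$) by $$y^q+y=x^{q_0}(x^q+x) \quad\text{and}\quad x^q+x=z^{q-2q_0+1}.$$ Let $C_{q-2q_0+1} \subset \mathrm{Aut}(\tilde{\mathcal{S}})$ be the cyclic group $$C_{q-2q_0+1}=\left\{(x,y,z)\mapsto(x,y,\zeta z)\ \middle|\ \zeta\in k,\ \zeta^{q-2q_0+1}=1\right\},$$ and let $H$ be a subgroup of $C_{q-2q_0+1}$. Then there exists a birational embedding $\psi:\tilde{\mathcal{S}}/H\to\mathbb{P}^2$ of degree $q^2+1$ with two (different) inner Galois points for $\psi(\tilde{\mathcal{S}}/H)$.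
   Context: A birational embedding $\psi: \mathcal{D} \to \mathbb{P}^2$ of a smooth projective curve $\mathcal{D}$ is a morphism that is birational onto its image; its degree is the degree of the plane curve $\psi(\mathcal{D})$. For a plane curve $C \subset \mathbb{P}^2$, a point $P \in \mathbb{P}^2$ is a Galois point for $C$ if the function field extension $k(C)/\pi_P^*k(\mathbb{P}^1)$ induced by the projection $\pi_P: C \dashrightarrow \mathbb{P}^1$ from $P$ is Galois. A Galois point $P$ is called inner if $P$ is a smooth point of $C$ (in particular $P \in C$). $\tilde{\mathcal{S}}/H$ denotes the quotient curve. *)

(* Defs.v *)
From HB Require Import structures.
From mathcomp Require Import all_boot all_order all_algebra all_field.
From mathcomp Require Import boolp.
From mathcomp Require Import mpoly.

Set Implicit Arguments.
Unset Strict Implicit.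
Unset Printing Implicit Defensive.

Import GRing.Theory.
Local Open Scope ring_scope.

(* Conventions. A smooth projective curve over an algebraically closed field k
   is given by its function field: a field E with an embedding iota : k -> E.
   Its points are the valuation rings of E/k, its automorphisms are the
   k-automorphisms of E, and its quotient by a group H of automorphisms is the
   curve with function field E^H. Points of the projective plane are nonzero
   row vectors up to scaling; a subset of the plane is a predicate on row
   vectors, of which only the values at nonzero vectors matter. *)

(* Algebraic, normal and separable. *)
Definition galois_ext (F L : fieldType) (phi : {rmorphism F -> L}) : Prop :=
  (forall a : L, algebraicOver phi a) /\
  (forall p : {poly F}, irreducible_poly p ->
     (exists a, root (map_poly phi p) a) ->
     separable_poly p /\
     exists s : seq L, map_poly phi p %= \prod_(b <- s) ('X - b%:P)).

Definition mpoly_eval (k L : fieldType) (lam : {rmorphism k -> L}) (n : nat)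
    (p : {mpoly k[n]}) (v : 'rV[L]_n) : L :=
  mmap lam (fun i => v 0 i) p.

Definition vanishes_at (k : fieldType) (n : nat) (p : {mpoly k[n]})
    (v : 'rV[k]_n) : Prop :=
  p.@[fun i => v 0 i] = 0.

(* L is the field of fractions of k[X_1..X_n]/I(V), with xi the image of
   (X_1, .., X_n), for V a subset of the affine space k^n. *)
Definition affine_function_field (k L : fieldType) (lam : {rmorphism k -> L})
    (n : nat) (V : 'rV[k]_n -> Prop) (xi : 'rV[L]_n) : Prop :=
  (forall p : {mpoly k[n]},
     mpoly_eval lam p xi = 0 <-> (forall v, V v -> vanishes_at p v)) /\
  (forall a : L, exists p r : {mpoly k[n]},
     mpoly_eval lam r xi != 0 /\
     a = mpoly_eval lam p xi / mpoly_eval lam r xi).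

(* L is the field of fractions P/R of forms of equal degree in the homogeneous
   coordinate ring k[X_0, X_1, X_2]/I(C), embedded in L by
   P/R |-> P(xi)/R(xi); in particular xi is determined up to scaling. *)
Definition plane_function_field (k L : fieldType) (lam : {rmorphism k -> L})
    (C : 'rV[k]_3 -> Prop) (xi : 'rV[L]_3) : Prop :=
  (forall (d : nat) (p : {mpoly k[3]}), p \is d.-homog ->
     mpoly_eval lam p xi = 0 <->
     (forall v, v != 0 -> C v -> vanishes_at p v)) /\
  (forall a : L, exists (d : nat) (p r : {mpoly k[3]}),
     [/\ p \is d.-homog, r \is d.-homog, mpoly_eval lam r xi != 0 &
         a = mpoly_eval lam p xi / mpoly_eval lam r xi]).

Definition irreducible_mpoly (k : fieldType) (n : nat) (F : {mpoly k[n]}) :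
    Prop :=
  F \isn't a GRing.unit /\
  (forall G1 G2 : {mpoly k[n]}, F = G1 * G2 ->
     (G1 \is a GRing.unit) || (G2 \is a GRing.unit)).

Definition plane_curve_equation (k : fieldType) (C : 'rV[k]_3 -> Prop)
    (d : nat) (F : {mpoly k[3]}) : Prop :=
  [/\ F \is d.-homog, irreducible_mpoly F &
      forall v, v != 0 -> C v <-> vanishes_at F v].

Definition plane_curve_of_degree (k : fieldType) (d : nat)
    (C : 'rV[k]_3 -> Prop) : Prop :=
  exists F, plane_curve_equation C d F.

Definition smooth_point (k : fieldType) (C : 'rV[k]_3 -> Prop)
    (P : 'rV[k]_3) : Prop :=
  exists (d : nat) (F : {mpoly k[3]}),
    [/\ plane_curve_equation C d F, vanishes_at F P &
        exists i, ~ vanishes_at (F^`M(i)) P].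

(* The columns of M are two independent linear forms with common zero P, so
   that v |-> v *m M is the projection from P, and phi is the induced map
   k(P^1) = k(t) -> k(C), sending t to the ratio of these forms on C. *)
Definition galois_point (k : fieldType) (C : 'rV[k]_3 -> Prop)
    (P : 'rV[k]_3) : Prop :=
  exists (L : fieldType) (lam : {rmorphism k -> L}) (xi : 'rV[L]_3)
         (M : 'M[k]_(3, 2)) (phi : {rmorphism {fraction {poly k}} -> L}),
  [/\ plane_function_field lam C xi,
      \rank M = 2%N /\ P *m M = 0,
      forall c : k, phi (FracField.tofrac c%:P) = lam c,
      phi (FracField.tofrac 'X)
        = (xi *m map_mx lam M) 0 0 / (xi *m map_mx lam M) 0 1 &
      galois_ext phi].

Definition inner_galois_point (k : fieldType) (C : 'rV[k]_3 -> Prop)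
    (P : 'rV[k]_3) : Prop :=
  [/\ P != 0, smooth_point C P & galois_point C P].

Definition same_point (k : fieldType) (P Q : 'rV[k]_3) : Prop :=
  exists2 c : k, c != 0 & Q = c *: P.

Definition curve_point (k E : fieldType) (iota : {rmorphism k -> E})
    (O : {pred E}) : Prop :=
  [/\ subring_closed O,
      forall c : k, iota c \in O,
      exists a, a \notin O &
      forall a, (a \in O) || (a^-1 \in O)].

Definition max_ideal (E : fieldType) (O : {pred E}) : {pred E} :=
  fun a => (a \in O) && ((a == 0) || (a^-1 \notin O)).

(* The value at the point O of the morphism (f_0 : f_1 : f_2) to the plane:
   after scaling by some g, the f_i are regular at O without common zero. *)
Definition morphism_value (k E : fieldType) (iota : {rmorphism k -> E})
    (f : 'rV[E]_3) (O : {pred E}) (v : 'rV[k]_3) : Prop :=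
  v != 0 /\
  exists g : E, g != 0 /\
    forall i, g * f 0 i \in O /\ g * f 0 i - iota (v 0 i) \in max_ideal O.

Definition morphism_image (k E : fieldType) (iota : {rmorphism k -> E})
    (f : 'rV[E]_3) : 'rV[k]_3 -> Prop :=
  fun v => exists O, curve_point iota O /\ morphism_value iota f O v.

(* A morphism from a smooth curve to the plane is given by a nonzero triple f
   of rational functions; it is birational onto its image C when f identifies
   k(C) with the function field of the curve. *)
Definition birational_embedding (k E : fieldType) (iota : {rmorphism k -> E})
    (f : 'rV[E]_3) : Prop :=
  f != 0 /\ plane_function_field iota (morphism_image iota f) f.

Section Automorphisms.
Variables (k K : fieldType) (iota : {rmorphism k -> K}).

Record curve_aut : Type := CurveAut {
  aut_fun :> {rmorphism K -> K};
  aut_inv : K -> K;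
  aut_funK : cancel aut_fun aut_inv;
  aut_invK : cancel aut_inv aut_fun;
  aut_const : forall c : k, aut_fun (iota c) = iota c }.

Lemma curve_aut_eq (s t : curve_aut) : s =1 t -> s = t.
Proof.
case: s t => [f f' fK f'K fc] [g g' gK g'K gc] /= fg.
have efg : f = g.
  case: f g fg {fK f'K fc gK g'K gc} => [f [[mf] [nf]]] [g [[mg] [ng]]] /= fg.
  have e : f = g by apply/funext.
  case: _ / e in mg ng fg *.
  by rewrite (Prop_irrelevance mf mg) (Prop_irrelevance nf ng).
case: _ / efg in gK g'K gc fg *.
have e' : f' = g' by apply/funext => a; apply: (can_inj fK); rewrite f'K g'K.
case: _ / e' in gK g'K *.
by rewrite (Prop_irrelevance fK gK) (Prop_irrelevance f'K g'K)
  (Prop_irrelevance fc gc).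
Qed.

Definition curve_aut_one : curve_aut :=
  @CurveAut idfun id (fun=> erefl) (fun=> erefl) (fun=> erefl).

Fact curve_aut_mul_const (s t : curve_aut) c :
  (aut_fun s \o aut_fun t) (iota c) = iota c.
Proof. by rewrite /= !aut_const. Qed.

Definition curve_aut_mul (s t : curve_aut) : curve_aut :=
  @CurveAut (aut_fun s \o aut_fun t) (aut_inv t \o aut_inv s)
    (can_comp (@aut_funK s) (@aut_funK t))
    (can_comp (@aut_invK t) (@aut_invK s))
    (curve_aut_mul_const s t).

Section Inverse.
Variable s : curve_aut.
HB.instance Definition _ := GRing.isZmodMorphism.Build K K (aut_inv s)
  (can2_zmod_morphism (@aut_funK s) (@aut_invK s)).
HB.instance Definition _ := GRing.isMonoidMorphism.Build K K (aut_inv s)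
  (can2_monoid_morphism (@aut_funK s) (@aut_invK s)).

Fact aut_inv_const c : aut_inv s (iota c) = iota c.
Proof. by apply: (can_inj (@aut_funK s)); rewrite aut_invK aut_const. Qed.

Definition curve_aut_inv : curve_aut :=
  @CurveAut (aut_inv s) (aut_fun s) (@aut_invK s) (@aut_funK s) aut_inv_const.
End Inverse.

HB.instance Definition _ := gen_eqMixin curve_aut.
HB.instance Definition _ := gen_choiceMixin curve_aut.

Fact curve_aut_mulA : associative curve_aut_mul.
Proof. by move=> s t u; exact: curve_aut_eq. Qed.
Fact curve_aut_mul1 : left_id curve_aut_one curve_aut_mul.
Proof. by move=> s; exact: curve_aut_eq. Qed.
Fact curve_aut_1mul : right_id curve_aut_one curve_aut_mul.
Proof. by move=> s; exact: curve_aut_eq. Qed.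
Fact curve_aut_mulV : left_inverse curve_aut_one curve_aut_inv curve_aut_mul.
Proof. by move=> s; apply: curve_aut_eq => a /=; rewrite aut_funK. Qed.
Fact curve_aut_Vmul : right_inverse curve_aut_one curve_aut_inv curve_aut_mul.
Proof. by move=> s; apply: curve_aut_eq => a /=; rewrite aut_invK. Qed.

HB.instance Definition _ := isGroup.Build curve_aut
  curve_aut_mulA curve_aut_mul1 curve_aut_1mul curve_aut_mulV curve_aut_Vmul.

Variable H : {pred curve_aut}.

Definition fixed_pred : {pred K} :=
  fun a => `[< forall s : curve_aut, s \in H -> s a = a >].

Fact fixed_pred_divring : divring_closed fixed_pred.
Proof.
split; first by apply/asboolP => s _; rewrite rmorph1.
- move=> a b /asboolP ha /asboolP hb; apply/asboolP => s sH.
  by rewrite rmorphB ha ?hb.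
- move=> a b /asboolP ha /asboolP hb; apply/asboolP => s sH.
  by rewrite rmorphM fmorphV ha ?hb.
Qed.

HB.instance Definition _ := GRing.isDivringClosed.Build K fixed_pred
  fixed_pred_divring.

Record fixed_field : Type := FixedField {
  fixed_val : K; fixed_valP : fixed_val \in fixed_pred }.

HB.instance Definition _ := [isSub for fixed_val].
HB.instance Definition _ := [Choice of fixed_field by <:].
HB.instance Definition _ := [SubChoice_isSubIntegralDomain of fixed_field by <:].
HB.instance Definition _ := [SubIntegralDomain_isSubField of fixed_field by <:].

Fact const_fixed (c : k) : iota c \in fixed_pred.
Proof. by apply/asboolP => s _; exact: aut_const. Qed.

Definition fixed_const (c : k) : fixed_field := FixedField (const_fixed c).

Fact fixed_const_zmod : zmod_morphism fixed_const.
Proof. by move=> a b; apply: val_inj; rewrite /= rmorphB. Qed.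
Fact fixed_const_monoid : monoid_morphism fixed_const.
Proof.
by split=> [|a b]; apply: val_inj; rewrite /= ?rmorph1 ?rmorphM.
Qed.

HB.instance Definition _ := GRing.isZmodMorphism.Build k fixed_field
  fixed_const fixed_const_zmod.
HB.instance Definition _ := GRing.isMonoidMorphism.Build k fixed_field
  fixed_const fixed_const_monoid.

End Automorphisms.

Definition skabelund_curve (k : fieldType) (q0 q : nat) (v : 'rV[k]_3) : Prop :=
  let x := v 0 0 in let y := v 0 1 in let z := v 0 2 in
  y ^+ q + y = x ^+ q0 * (x ^+ q + x) /\
  x ^+ q + x = z ^+ (q - 2 * q0 + 1).

(* The automorphisms (x, y, z) |-> (x, y, zeta z) with zeta^m = 1, where
   xi = (x, y, z). *)
Definition root_of_unity_auts (k K : fieldType) (iota : {rmorphism k -> K})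
    (xi : 'rV[K]_3) (m : nat) : {pred curve_aut iota} :=
  fun s => `[< exists zeta : k, zeta ^+ m = 1 /\
    [/\ s (xi 0 0) = xi 0 0, s (xi 0 1) = xi 0 1 &
        s (xi 0 2) = iota zeta * xi 0 2] >].

(* Main.v *)
Require Import Defs.
From HB Require Import structures.
From mathcomp Require Import all_boot all_order all_algebra all_field.
From mathcomp Require Import perm boolp mpoly.
From mathcomp Require classical_sets fraction generic_quotient.
From mathcomp Require Import ring zify.

(** Put m = q - 2 q0 + 1, t = x^q + x, u = x^(2 q0 + 1) + y^(2 q0) and
    w = x u + y^2, let h be the order of H, W = w^h and Z = z^h. The function
    field of the quotient is k(x, y, Z), with t = Z^(m/h). The embedding is
    (1 : W : Z).

    The reason is geometric. The q^2 + 1 rational points of the Suzuki curve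
    have one point each above them. One of them, P, is the common pole of x, y
    and z; let Q be the point (0, 0, 0). The function W has divisor
    (q^2 + 1) (Q - P), and Z has all the points but P as simple zeros and P as
    a pole of order q^2. So (1 : W : Z) has degree q^2 + 1. The translations
    x -> x + a, y -> y + a^q0 x + b, with a, b in F_q, form a group of order q^2
    whose fixed field is k(Z), which is the projection from the image (0 : 1 : 0)
    of P. An involution of the Suzuki group swaps P and Q and maps (1 : W : Z) to
    (W : 1 : Z), so the projection from the image (1 : 0 : 0) of Q is Galois
    too.

    The proof replaces divisors by algebra. A polynomial of degrees < q in x
    and in y cannot vanish on the curve (reduced_vanishing), so that the two
    equations generate the ideal of the curve, and any solution of them in any
    commutative k-algebra is a specialization of (x, y, z) (specialization).
    This gives the translations (translation_aut), the involution (curve_eq_involution,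
    plane_symmetry) and the evaluation at the rational points. An element
    fixed by the translations is rational in Z (fixed_in_kz): a polynomial of
    degree < q that takes the same value at q points is constant.

    The product f(T) of the T - g(W), over the translations g, therefore has
    coefficients in k[Z]. Its roots are distinct, since w vanishes at no
    F_q-rational point but the origin (suz_w_eq0), so f is the minimal polynomial
    of W (ev2_eq0). At a place with Z infinite the formula
      w^(q^2) = w + y^(2 q0) (t + t^q) + x t^(q + 2 q0) + t^(q + 2 q0 + 1)
    shows that W^(q^2) / Z^(q^2 + 1) is congruent to 1 (W_leading), since
    m (q + 2 q0 + 1) = q^2 + 1; this bounds the degrees of the coefficients of f
    (orbit_eq_degrees): f has total degree q^2 + 1, through the constant term only.
    The homogenization of f is irreducible (plane_form_irreducible) and its
    zeros are the values of (1 : W : Z) (image_plane_form): a zero is a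
    specialization of (W, Z), and Chevalley's theorem yields a place which
    takes this value (place_of_specialization). Lagrange interpolation over the
    translations shows that W and Z generate the function field
    (plane_generation), and the two Galois points are the ones above. *)

Set Implicit Arguments.
Unset Strict Implicit.
Unset Printing Implicit Defensive.

Import GRing.Theory.
Local Open Scope ring_scope.

(** * Places with a prescribed specialization *)

Section Chevalley.
Variable E : fieldType.

(** The objects of Chevalley's extension theorem: a subring of E with a proper
    ideal. *)
Record subring_ideal := SubringIdeal {
  si_ring : E -> Prop;
  si_ideal : E -> Prop;
  si_ring1 : si_ring 1;
  si_ringB : forall a b, si_ring a -> si_ring b -> si_ring (a - b);
  si_ringM : forall a b, si_ring a -> si_ring b -> si_ring (a * b);
  si_ideal_sub : forall a, si_ideal a -> si_ring a;
  si_ideal0 : si_ideal 0;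
  si_idealD : forall a b, si_ideal a -> si_ideal b -> si_ideal (a + b);
  si_idealM : forall a b, si_ring a -> si_ideal b -> si_ideal (a * b);
  si_ideal_proper : ~ si_ideal 1 }.

Section Closure.
Variable p : subring_ideal.

Lemma si_ring0 : si_ring p 0.
Proof. exact/si_ideal_sub/si_ideal0. Qed.
Lemma si_ringN a : si_ring p a -> si_ring p (- a).
Proof. by rewrite -sub0r; apply: si_ringB; exact: si_ring0. Qed.
Lemma si_ringD a b : si_ring p a -> si_ring p b -> si_ring p (a + b).
Proof. by move=> pa /si_ringN pb; rewrite -[b]opprK; exact: si_ringB. Qed.
End Closure.

Definition si_le (p p' : subring_ideal) : bool :=
  `[< (forall a, si_ring p a -> si_ring p' a) /\ (forall a, si_ideal p a -> si_ideal p' a) >].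

Lemma si_le_refl p : si_le p p.
Proof. exact/asboolP. Qed.

Lemma si_le_trans p1 p2 p3 : si_le p1 p2 -> si_le p2 p3 -> si_le p1 p3.
Proof.
by move=> /asboolP[h1 h2] /asboolP[h3 h4]; apply/asboolP; split=> a; auto.
Qed.

Lemma si_chain_bound (F : subring_ideal -> Prop) :
  (forall p p', F p -> F p' -> si_le p p' \/ si_le p' p) ->
  (exists p, F p) -> exists p, forall p', F p' -> si_le p' p.
Proof.
move=> tot [p0 Fp0].
have pair (P Q : subring_ideal -> Prop) :
    (forall p p', si_le p p' -> P p -> P p') ->
    (forall p p', si_le p p' -> Q p -> Q p') ->
    (exists2 p, F p & P p) -> (exists2 p, F p & Q p) ->
    exists2 p, F p & P p /\ Q p.
  move=> mP mQ [p Fp Pp] [q Fq Qq].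
  by have [le|le] := tot _ _ Fp Fq; [exists q|exists p]; eauto.
have mB a p p' : si_le p p' -> si_ring p a -> si_ring p' a by move=> /asboolP[h _]; exact: h.
have mI a p p' : si_le p p' -> si_ideal p a -> si_ideal p' a by move=> /asboolP[_]; exact.
pose B a := exists2 p, F p & si_ring p a.
pose I a := exists2 p, F p & si_ideal p a.
have B1 : B 1 by exists p0 => //; exact: si_ring1.
have BB a b : B a -> B b -> B (a - b).
  move=> Ba Bb; have [p Fp [pa pb]] := pair _ _ (mB a) (mB b) Ba Bb.
  by exists p => //; exact: si_ringB.
have BM a b : B a -> B b -> B (a * b).
  move=> Ba Bb; have [p Fp [pa pb]] := pair _ _ (mB a) (mB b) Ba Bb.
  by exists p => //; exact: si_ringM.
have IB a : I a -> B a by case=> p Fp pa; exists p => //; exact: si_ideal_sub.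
have I0 : I 0 by exists p0 => //; exact: si_ideal0.
have ID a b : I a -> I b -> I (a + b).
  move=> Ba Bb; have [p Fp [pa pb]] := pair _ _ (mI a) (mI b) Ba Bb.
  by exists p => //; exact: si_idealD.
have IM a b : B a -> I b -> I (a * b).
  move=> Ba Bb; have [p Fp [pa pb]] := pair _ _ (mB a) (mI b) Ba Bb.
  by exists p => //; exact: si_idealM.
have I1 : ~ I 1 by case=> p _; exact: si_ideal_proper.
exists (SubringIdeal B1 BB BM IB I0 ID IM I1) => p Fp; apply/asboolP; split=> a pa.
  by exists p.
by exists p.
Qed.

(** If 1 is a combination with coefficients in the ideal both of powers of a
    and of powers of 1/a, then the longer of the two relations can be
    shortened with the other one, down to a constant relation. *)
Lemma si_ideal_relations_absurd (p : subring_ideal) (n m : nat) (a : E)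
    (P Q : {poly E}) : a != 0 ->
  (forall i, si_ideal p P`_i) -> (forall i, si_ideal p Q`_i) ->
  (size P <= n.+1)%N -> (size Q <= m.+1)%N -> P.[a] = 1 -> Q.[a^-1] = 1 ->
  False.
Proof.
move: {2}(n + m)%N (leqnn (n + m)) => N.
elim: N n m a P Q => [|N IHN] n m a P Q leN a0 IP IQ sP sQ Pa Qa.
  have /eqP : (n + m)%N == 0%N by rewrite -leqn0.
  move/eqP; rewrite addn_eq0 => /andP[/eqP n0 _]; move: sP; rewrite n0.
  move=> /size1_polyC eP; move: Pa; rewrite eP hornerC => P0.
  by apply: (@si_ideal_proper p); rewrite -P0.
wlog le_mn : n m a P Q leN a0 IP IQ sP sQ Pa Qa / (m <= n)%N.
  move=> wl; have [le|/ltnW le] := leqP m n; first exact: (wl n m a P Q).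
  by apply: (wl m n a^-1 Q P) => //; rewrite ?invr_eq0 ?invrK // addnC.
have [n0|n_gt0] := posnP n.
  move: sP; rewrite n0 => /size1_polyC eP; move: Pa; rewrite eP hornerC => P0.
  by apply: (@si_ideal_proper p); rewrite -P0.
pose c i := Q`_0 *+ (i == 0%N) + (1 - Q`_0) * P`_i + P`_n * Q`_(n - i).
have In i : si_ideal p (c i).
  apply: si_idealD; last by apply: si_idealM => //; exact: si_ideal_sub.
  apply: si_idealD; first by case: eqP => _; rewrite ?mulr1n ?mulr0n //; exact: si_ideal0.
  by apply: si_idealM => //; apply: si_ringB; [exact: si_ring1|exact: si_ideal_sub].
apply: (IHN n.-1 m a (\poly_(i < n) c i) Q) => //.
- by rewrite -ltnS (leq_trans _ leN) // -(ltn_predK n_gt0) //= addSn.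
- by move=> i; rewrite coef_poly; case: ifP => // _; exact: si_ideal0.
- by rewrite (ltn_predK n_gt0) size_poly.
have eP : \sum_(i < n) P`_i * a ^+ i = 1 - P`_n * a ^+ n.
  by rewrite -Pa (horner_coef_wide _ sP) big_ord_recr /= addrK.
have eQ : \sum_(i < n) Q`_(n - i) * a ^+ i = a ^+ n * (1 - Q`_0).
  have sQ' : (size Q <= n.+1)%N by rewrite (leq_trans sQ).
  have := congr1 (fun z => a ^+ n * (z - Q`_0)) Qa.
  rewrite (horner_coef_wide _ sQ') big_ord_recl /= expr0 mulr1 addrC addKr => <-.
  rewrite mulr_sumr (reindex_inj rev_ord_inj) /=; apply: eq_bigr => i _.
  rewrite subKn // mulrCA; congr (_ * _).
  by rewrite exprVn expfB_cond // (negbTE a0) ltn_ord.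
rewrite horner_poly; under eq_bigr do rewrite /c !mulrDl -!mulrA.
rewrite !big_split /= -!mulr_sumr eP eQ.
have -> : \sum_(i < n) Q`_0 *+ (i == 0 :> nat) * a ^+ i = Q`_0.
  rewrite -(prednK n_gt0) big_ord_recl /= mulr1n expr0 mulr1 big1 ?addr0 // => i _.
  by rewrite mulr0n mul0r.
by ring.
Qed.

(** If a does not belong to the ring of a maximal pair, adjoining a makes the
    ideal improper, which is a relation of 1 with powers of a; the same for 1/a
    contradicts the previous lemma. *)
Lemma si_maximal_valuation (p : subring_ideal) :
  (forall p', si_le p p' -> si_le p' p) -> forall a, si_ring p a \/ si_ring p a^-1.
Proof.
move=> maxp.
have sumB n (f : 'I_n -> E) : (forall i, si_ring p (f i)) -> si_ring p (\sum_i f i).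
  by move=> h; apply: big_ind => //; [exact: si_ring0|exact: si_ringD].
have sumI n (f : 'I_n -> E) : (forall i, si_ideal p (f i)) -> si_ideal p (\sum_i f i).
  by move=> h; apply: big_ind => //; [exact: si_ideal0|exact: si_idealD].
have ext a : si_ring p a \/
    exists2 P : {poly E}, (forall i, si_ideal p P`_i) & P.[a] = 1.
  have [rel|norel] := pselect (exists2 P : {poly E},
    (forall i, si_ideal p P`_i) & P.[a] = 1); [by right|left].
  pose B b := exists2 P : {poly E}, (forall i, si_ring p P`_i) & P.[a] = b.
  pose I b := exists2 P : {poly E}, (forall i, si_ideal p P`_i) & P.[a] = b.
  have B1 : B 1.
    exists 1%:P; last by rewrite hornerC.
    by move=> i; rewrite coefC; case: eqP => _; [exact: si_ring1|exact: si_ring0].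
  have BB b c : B b -> B c -> B (b - c).
    move=> [P hP <-] [Q hQ <-]; exists (P - Q); last by rewrite hornerD hornerN.
    by move=> i; rewrite coefB; exact: si_ringB.
  have BM b c : B b -> B c -> B (b * c).
    move=> [P hP <-] [Q hQ <-]; exists (P * Q); last by rewrite hornerM.
    by move=> i; rewrite coefM; apply: sumB => j; exact: si_ringM.
  have IB b : I b -> B b by case=> P hP <-; exists P => // i; exact: si_ideal_sub.
  have I0 : I 0 by exists 0; [move=> i; rewrite coef0; exact: si_ideal0|rewrite horner0].
  have ID b c : I b -> I c -> I (b + c).
    move=> [P hP <-] [Q hQ <-]; exists (P + Q); last by rewrite hornerD.
    by move=> i; rewrite coefD; exact: si_idealD.
  have IM b c : B b -> I c -> I (b * c).
    move=> [P hP <-] [Q hQ <-]; exists (P * Q); last by rewrite hornerM.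
    by move=> i; rewrite coefM; apply: sumI => j; exact: si_idealM.
  have [|+ _] := asboolP _ (maxp (SubringIdeal B1 BB BM IB I0 ID IM norel) _).
    apply/asboolP; split=> b pb; exists b%:P; rewrite ?hornerC // => i.
      by rewrite coefC; case: eqP => _ //; exact: si_ring0.
    by rewrite coefC; case: eqP => _ //; exact: si_ideal0.
  apply; exists 'X; last by rewrite hornerX.
  by move=> i; rewrite coefX; case: eqP => _; [exact: si_ring1|exact: si_ring0].
move=> a; have [->|a0] := eqVneq a 0; first by left; exact: si_ring0.
have [|[P IP Pa]] := ext a; first by left.
have [|[Q IQ Qa]] := ext a^-1; first by right.
by case: (si_ideal_relations_absurd (n := size P) (m := size Q) a0 IP IQ _ _ Pa Qa).
Qed.

End Chevalley.

Lemma in_max_ideal (E : fieldType) (O : {pred E}) a :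
  (a \in max_ideal O) = (a \in O) && ((a == 0) || (a^-1 \notin O)).
Proof. by []. Qed.

(** Every nontrivial specialization of the generic point al of a variety to a rational
    point ch is taken by some place: a maximal pair above the image of al with
    the image of the kernel of ch. *)
Lemma place_of_specialization (k E : fieldType) (iota : {rmorphism k -> E})
    (A : comNzRingType) (cst : k -> A) (al : {rmorphism A -> E})
    (ch : {rmorphism A -> k}) :
  (forall c, al (cst c) = iota c) -> (forall c, ch (cst c) = c) ->
  (forall a, al a = 0 -> ch a = 0) ->
  (exists a, al a != iota (ch a)) ->
  exists O : {pred E}, curve_point iota O /\
    forall a, al a \in O /\ al a - iota (ch a) \in max_ideal O.
Proof.
move=> alC chC ker [a0 a0N].
pose B b := exists a, al a = b.
pose I b := exists2 a, ch a = 0 & al a = b.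
have B1 : B 1 by exists 1; rewrite rmorph1.
have BB b c : B b -> B c -> B (b - c).
  by move=> [a <-] [a' <-]; exists (a - a'); rewrite rmorphB.
have BM b c : B b -> B c -> B (b * c).
  by move=> [a <-] [a' <-]; exists (a * a'); rewrite rmorphM.
have IB b : I b -> B b by case=> a _ <-; exists a.
have I0 : I 0 by exists 0; rewrite rmorph0.
have ID b c : I b -> I c -> I (b + c).
  by move=> [a h <-] [a' h' <-]; exists (a + a'); rewrite rmorphD ?h ?h' ?addr0.
have IM b c : B b -> I c -> I (b * c).
  by move=> [a <-] [a' h' <-]; exists (a * a'); rewrite rmorphM ?h' ?mulr0.
have I1 : ~ I 1.
  case=> a ha a1; have := ker (a - 1); rewrite !rmorphB !rmorph1 a1 ha subrr.
  by move=> /(_ erefl)/eqP; rewrite sub0r oppr_eq0 oner_eq0.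
pose p0 := SubringIdeal B1 BB BM IB I0 ID IM I1.
pose T := {p | si_le p0 p}.
pose R (s t : T) := si_le (sval s) (sval t).
have [|||[p p0p] maxp] := @classical_sets.ZL_preorder T (exist _ p0 (si_le_refl p0)) R.
- by move=> t; exact: si_le_refl.
- by move=> r s t; exact: si_le_trans.
- move=> F totF; have [neF|eF] := pselect (exists t, F t); last first.
    by exists (exist _ p0 (si_le_refl p0)) => t Ft; case: eF; exists t.
  have [] := @si_chain_bound E (fun p => exists2 t, F t & sval t = p).
  - by move=> _ _ [s Fs <-] [t Ft <-]; exact: totF.
  - by case: neF => t Ft; exists (sval t); exists t.
  move=> p hp; have [t Ft] := neF.
  have p0p : si_le p0 p by apply: si_le_trans (proj2_sig t) _; apply: hp; exists t.
  by exists (exist _ p p0p) => s Fs; apply: hp; exists s.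
have {}maxp p' : si_le p p' -> si_le p' p.
  by move=> pp'; exact: (maxp (exist _ p' (si_le_trans p0p pp')) pp').
have [p0B p0I] := asboolP _ p0p.
have nonunit b : si_ideal p b -> b \in max_ideal (fun a => `[< si_ring p a >]).
  move=> pb; rewrite in_max_ideal; apply/andP; split.
    by apply/asboolP; exact: si_ideal_sub.
  have [//|b0] := eqVneq b 0; rewrite /=; apply/asboolP => pbV.
  by apply: (@si_ideal_proper _ p); rewrite -(mulVf b0); exact: si_idealM.
have srI a : si_ideal p (al a - iota (ch a)).
  apply: p0I; exists (a - cst (ch a)); first by rewrite rmorphB /= chC subrr.
  by rewrite rmorphB /= alC.
exists (fun a => `[< si_ring p a >]); split; last first.
  move=> a; split; last exact: nonunit.
  by apply/asboolP; apply: p0B; exists a.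
split.
- split; first by apply/asboolP; exact: si_ring1.
  + by move=> a b /asboolP pa /asboolP pb; apply/asboolP; exact: si_ringB.
  + by move=> a b /asboolP pa /asboolP pb; apply/asboolP; exact: si_ringM.
- by move=> c; apply/asboolP; apply: p0B; exists (cst c).
- exists (al a0 - iota (ch a0))^-1.
  have := nonunit _ (srI a0); rewrite in_max_ideal => /andP[_].
  by rewrite subr_eq0 (negbTE a0N).
- move=> a; have [pa|pa] := si_maximal_valuation maxp a.
    by apply/orP; left; apply/asboolP.
  by apply/orP; right; apply/asboolP.
Qed.

(** * Arithmetic in the valuation ring of a place *)

Section ValuationRing.
Variables (k E : fieldType) (iota : {rmorphism k -> E}) (O : {pred E}).
Hypothesis hO : curve_point iota O.
Local Notation m := (max_ideal O).

Let O1 : 1 \in O. Proof. by case: hO => -[]. Qed.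
Let OB a b : a \in O -> b \in O -> a - b \in O.
Proof. by case: hO => -[_ h _] _ _ _; exact: h. Qed.
Lemma place_mul a b : a \in O -> b \in O -> a * b \in O.
Proof. by case: hO => -[_ _ h] _ _ _; exact: h. Qed.
Let O0 : 0 \in O. Proof. by rewrite -(subrr 1) OB. Qed.
Let ON a : a \in O -> - a \in O. Proof. by rewrite -sub0r; exact: OB. Qed.
Lemma place_add a b : a \in O -> b \in O -> a + b \in O.
Proof. by move=> Oa Ob; rewrite -[b]opprK OB // ON. Qed.
Lemma place_const c : iota c \in O. Proof. by case: hO. Qed.
Lemma place_exp a n : a \in O -> a ^+ n \in O.
Proof. by move=> Oa; elim: n => // n IH; rewrite exprS place_mul. Qed.

Lemma max_idealW a : a \in m -> a \in O.
Proof. by rewrite in_max_ideal => /andP[]. Qed.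
Lemma max_ideal0 : 0 \in m.
Proof. by rewrite in_max_ideal O0 eqxx. Qed.
Lemma max_ideal_mul a b : a \in O -> b \in m -> a * b \in m.
Proof.
move=> Oa; rewrite !in_max_ideal => /andP[Ob /orP hb].
have [->|a0] := eqVneq a 0; first by rewrite mul0r O0 eqxx.
have [->|b0] := eqVneq b 0; first by rewrite mulr0 O0 eqxx.
case: hb => [|hb]; first by rewrite (negbTE b0).
rewrite place_mul //= mulf_eq0 (negbTE a0) (negbTE b0) /=.
apply: contra hb => h; have := place_mul Oa h.
by rewrite invfM mulrA divff // mul1r.
Qed.
Lemma max_ideal_mulr a b : a \in m -> b \in O -> a * b \in m.
Proof. by move=> ma Ob; rewrite mulrC max_ideal_mul. Qed.
Lemma max_ideal1 : 1 \notin m.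
Proof. by rewrite in_max_ideal O1 oner_eq0 invr1 O1. Qed.

(** One of a/b and b/a lies in the ring, so a sum of two elements is a
    multiple of one of them. *)
Lemma max_ideal_add a b : a \in m -> b \in m -> a + b \in m.
Proof.
wlog Oab : a b / a / b \in O.
  move=> wl ma mb; case: hO => _ _ _ /(_ (a / b)) /orP[h|h]; first exact: wl.
  by rewrite addrC wl // -invf_div.
move=> ma mb; have [b0|b0] := eqVneq b 0; first by rewrite b0 addr0.
have -> : a + b = (a / b + 1) * b by rewrite mulrDl mul1r divfK.
by apply: max_ideal_mul => //; rewrite place_add.
Qed.
Lemma max_ideal_opp a : a \in m -> - a \in m.
Proof. by move=> ma; rewrite -mulN1r max_ideal_mul // ON. Qed.
Lemma max_ideal_sub a b : a \in m -> b \in m -> a - b \in m.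
Proof. by move=> ma mb; rewrite max_ideal_add ?max_ideal_opp. Qed.
Lemma max_ideal_exp a n : (0 < n)%N -> a \in m -> a ^+ n \in m.
Proof.
by case: n => // n _ ma; rewrite exprS max_ideal_mulr // place_exp // max_idealW.
Qed.

Lemma notin_place_inv a : a \notin O -> a^-1 \in m.
Proof.
move=> Oa; rewrite in_max_ideal invrK Oa orbT andbT.
by case: hO => _ _ _ /(_ a); rewrite (negbTE Oa).
Qed.
Lemma place_root a n : (0 < n)%N -> a ^+ n \in O -> a \in O.
Proof.
move=> n0; case Oa : (a \in O) => // Oan.
have ma := max_ideal_exp n0 (notin_place_inv (negbT Oa)).
have a0 : a != 0 by apply/eqP => a0; rewrite a0 O0 in Oa.
have := max_ideal_mulr ma Oan; rewrite exprVn mulVf ?expf_neq0 //.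
by rewrite (negbTE max_ideal1).
Qed.
Lemma max_ideal_root a n : (0 < n)%N -> a ^+ n \in m -> a \in m.
Proof.
move=> n0 man; have Oa := place_root n0 (max_idealW man).
rewrite in_max_ideal Oa /=; have [//|a0] := eqVneq a 0; apply/negP => OaV.
have := max_ideal_mulr man (place_exp n OaV).
by rewrite exprVn divff ?expf_neq0 // (negbTE max_ideal1).
Qed.
Lemma max_ideal_const c : iota c \in m -> c = 0.
Proof.
move=> mc; apply/eqP; apply: contraT => c0.
have := max_ideal_mulr mc (place_const c^-1).
by rewrite -rmorphM divff // rmorph1 (negbTE max_ideal1).
Qed.
Lemma unit_residue a c : c != 0 -> a - iota c \in m -> a != 0 /\ a^-1 \in O.
Proof.
move=> c0 mac.
have Oa : a \in O by rewrite -(subrK (iota c) a) place_add ?place_const ?max_idealW.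
have man : a \notin m.
  apply/negP => ma; have := max_ideal_sub ma mac; rewrite subKr.
  by move=> /max_ideal_const/eqP; rewrite (negbTE c0).
have a0 : a != 0 by apply: contraNneq man => ->; exact: max_ideal0.
by split=> //; move: man; rewrite in_max_ideal Oa (negbTE a0) /= negbK.
Qed.
End ValuationRing.

(** * Fields of quotients *)

Section Quotients.
Variables (A : comNzRingType) (F : fieldType) (al : {rmorphism A -> F}).

Definition is_quotient (a : F) : Prop := exists p r, al r != 0 /\ a = al p / al r.

Lemma is_quotient_value p : is_quotient (al p).
Proof. by exists p, 1; rewrite rmorph1 divr1 oner_neq0. Qed.

Lemma is_quotient1 : is_quotient 1.
Proof. by rewrite -(rmorph1 al); exact: is_quotient_value. Qed.

Lemma is_quotientD a b : is_quotient a -> is_quotient b -> is_quotient (a + b).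
Proof.
move=> [p [r [r0 ->]]] [p' [r' [r0' ->]]]; exists (p * r' + p' * r), (r * r').
by rewrite rmorphD !rmorphM mulf_neq0 // addf_div.
Qed.

Lemma is_quotientM a b : is_quotient a -> is_quotient b -> is_quotient (a * b).
Proof.
move=> [p [r [r0 ->]]] [p' [r' [r0' ->]]]; exists (p * p'), (r * r').
by rewrite !rmorphM mulf_neq0 // mulf_div.
Qed.

Lemma is_quotientV a : is_quotient a -> is_quotient a^-1.
Proof.
move=> [p [r [r0 ->]]]; have [->|p0] := eqVneq (al p) 0.
  by rewrite mul0r invr0; exists 0, 1; rewrite rmorph0 rmorph1 mul0r oner_neq0.
by exists r, p; rewrite invf_div.
Qed.

Lemma is_quotientX a i : is_quotient a -> is_quotient (a ^+ i).
Proof.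
move=> ha; elim: i => [|i IH]; first exact: is_quotient1.
by rewrite exprS; exact: is_quotientM.
Qed.

Lemma is_quotient_sum (I : finType) (f : I -> F) :
  (forall i, is_quotient (f i)) -> is_quotient (\sum_i f i).
Proof.
move=> hf; apply: (big_ind is_quotient) => //; last exact: is_quotientD.
by rewrite -(rmorph0 al); exact: is_quotient_value.
Qed.
End Quotients.

(** The image of al p / al r can only be be p / be r, and the equality of the
    kernels makes this independent of the choice of p and r. *)
Lemma fraction_extension (A : comNzRingType) (F F' : fieldType)
    (al : {rmorphism A -> F}) (be : {rmorphism A -> F'}) :
  (forall a, is_quotient al a) ->
  (forall p, al p = 0 <-> be p = 0) ->
  exists s : {rmorphism F -> F'}, forall p, s (al p) = be p.
Proof.
move=> gen ker.
have ker0 p : (al p == 0) = (be p == 0).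
  by apply/eqP/eqP => /ker.
have eqf p r p' r' : al r != 0 -> al r' != 0 ->
    al p / al r = al p' / al r' -> be p / be r = be p' / be r'.
  move=> r0 r0' /eqP; rewrite eqr_div // -!rmorphM -subr_eq0 -rmorphB ker0.
  by rewrite rmorphB !rmorphM subr_eq0 -eqr_div -?ker0 // => /eqP.
have /choice[pr hpr] a : exists pr : A * A, al pr.2 != 0 /\ a = al pr.1 / al pr.2.
  by have [p [r h]] := gen a; exists (p, r).
pose s a := be (pr a).1 / be (pr a).2.
have sE p r : al r != 0 -> s (al p / al r) = be p / be r.
  by move=> r0; have [h1 h2] := hpr (al p / al r); apply: eqf.
have s_zmod : zmod_morphism s.
  move=> a b; have [p [r [r0 ->]]] := gen a; have [p' [r' [r0' ->]]] := gen b.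
  rewrite -mulNr addf_div // -!rmorphM -rmorphN -rmorphM -rmorphD !sE //; last first.
    by rewrite rmorphM mulf_neq0.
  by rewrite -mulNr addf_div -?ker0 // rmorphD !rmorphM rmorphN.
have s_monoid : monoid_morphism s.
  split.
    have := sE 1 1; rewrite !rmorph1 !divr1; apply; exact: oner_neq0.
  move=> a b; have [p [r [r0 ->]]] := gen a; have [p' [r' [r0' ->]]] := gen b.
  rewrite mulf_div -!rmorphM !sE // ?mulf_div ?rmorphM //.
  by rewrite mulf_neq0.
pose sz := GRing.isZmodMorphism.Build F F' s s_zmod.
pose sm := GRing.isMonoidMorphism.Build F F' s s_monoid.
pose S : {rmorphism F -> F'} := HB.pack s sz sm.
exists S => p; have := sE p 1; rewrite !rmorph1 !divr1; apply; exact: oner_neq0.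
Qed.

(** * The coordinate ring of the curve *)

Definition pev (R S : comNzRingType) (g : {rmorphism R -> S}) (u : S)
    (p : {poly R}) : S := (map_poly g p).[u].

Section PevMorphism.
Variables (R S : comNzRingType) (g : {rmorphism R -> S}) (u : S).

Fact pev_zmod : zmod_morphism (pev g u).
Proof. by move=> p p'; rewrite /pev rmorphB hornerD hornerN. Qed.
Fact pev_monoid : monoid_morphism (pev g u).
Proof.
by split=> [|p p']; rewrite /pev ?rmorph1 ?hornerC // rmorphM hornerM.
Qed.
HB.instance Definition _ := GRing.isZmodMorphism.Build {poly R} S (pev g u) pev_zmod.
HB.instance Definition _ :=
  GRing.isMonoidMorphism.Build {poly R} S (pev g u) pev_monoid.
End PevMorphism.

Section PolynomialEvaluation.
Variables (R S : comNzRingType) (g : {rmorphism R -> S}) (u : S).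

Lemma pevE (p : {poly R}) : pev g u p = (map_poly g p).[u].
Proof. by []. Qed.

Lemma pevC c : pev g u c%:P = g c.
Proof. by rewrite pevE map_polyC hornerC. Qed.

Lemma pevX : pev g u 'X = u.
Proof. by rewrite pevE map_polyX hornerX. Qed.

Lemma pev_coef n (p : {poly R}) : (size p <= n)%N ->
  pev g u p = \sum_(i < n) g p`_i * u ^+ i.
Proof.
move=> le; rewrite pevE (horner_coef_wide _ (leq_trans (size_poly _ _) le)).
by apply: eq_bigr => i _; rewrite coef_map.
Qed.

Lemma rmorph_pev (S' : comNzRingType) (h : {rmorphism S -> S'})
    (g' : {rmorphism R -> S'}) (p : {poly R}) :
  (forall c, h (g c) = g' c) -> h (pev g u p) = pev g' (h u) p.
Proof.
move=> eg; rewrite !pevE -horner_map -map_poly_comp; congr horner.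
exact: eq_map_poly.
Qed.

Lemma pev_map_id (f : R -> R) (p : {poly R}) :
  f 0 = 0 -> (forall c, g (f c) = g c) -> pev g u (map_poly f p) = pev g u p.
Proof.
move=> f0 gf; rewrite (pev_coef (size_poly _ _)) (pev_coef (leqnn (size p))).
by apply: eq_bigr => i _; rewrite coef_map_id0 // gf.
Qed.
End PolynomialEvaluation.

(** Polynomials in three variables Y, X, Z, from the outermost to the
    innermost. *)
Notation poly3 k := {poly {poly {poly k}}}.

Definition ev3 (k : fieldType) (S : comNzRingType) (lam : {rmorphism k -> S})
    (x y z : S) (P : poly3 k) : S := pev (pev (pev lam z) x) y P.

Section EvMorphism.
Variables (k : fieldType) (S : comNzRingType) (lam : {rmorphism k -> S}).
Variables (x y z : S).
Fact ev3_zmod : zmod_morphism (ev3 lam x y z).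
Proof. by move=> P Q; rewrite /ev3 rmorphB. Qed.
Fact ev3_monoid : monoid_morphism (ev3 lam x y z).
Proof. by split=> [|P Q]; rewrite /ev3 ?rmorph1 ?rmorphM. Qed.
HB.instance Definition _ :=
  GRing.isZmodMorphism.Build (poly3 k) S (ev3 lam x y z) ev3_zmod.
HB.instance Definition _ :=
  GRing.isMonoidMorphism.Build (poly3 k) S (ev3 lam x y z) ev3_monoid.
End EvMorphism.

Definition cZ (k : fieldType) (c : {poly k}) : poly3 k := c%:P%:P.
Definition vY (k : fieldType) : poly3 k := 'X.
Definition vX (k : fieldType) : poly3 k := 'X%:P.
Definition vZ (k : fieldType) : poly3 k := 'X%:P%:P.
Definition cst3 (k : fieldType) (c : k) : poly3 k := cZ c%:P.
HB.instance Definition _ (k : fieldType) :=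
  GRing.RMorphism.copy (@cst3 k) (polyC \o (polyC \o polyC)).

Section Ev.
Variables (k : fieldType) (S : comNzRingType) (lam : {rmorphism k -> S}).
Variables (x y z : S).
Local Notation evL := (ev3 lam x y z).

Lemma ev3_cZ c : evL (cZ c) = pev lam z c.
Proof. by rewrite /ev3 /cZ pevC /= pevC. Qed.
Lemma ev3B (P Q : poly3 k) : evL (P - Q) = evL P - evL Q.
Proof. by rewrite /ev3 rmorphB. Qed.
Lemma ev3M (P Q : poly3 k) : evL (P * Q) = evL P * evL Q.
Proof. by rewrite /ev3 rmorphM. Qed.
Lemma ev3Y : evL (vY k) = y. Proof. by rewrite /ev3 /vY pevX. Qed.
Lemma ev3X : evL (vX k) = x. Proof. by rewrite /ev3 /vX pevC /= pevX. Qed.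
Lemma ev3Z : evL (vZ k) = z. Proof. by rewrite /ev3 /vZ pevC /= pevC /= pevX. Qed.
Lemma ev3_cst c : evL (cst3 c) = lam c.
Proof. by rewrite ev3_cZ pevC. Qed.

Lemma rmorph_ev3 (S' : comNzRingType) (h : {rmorphism S -> S'})
    (lam' : {rmorphism k -> S'}) P : (forall c, h (lam c) = lam' c) ->
  h (evL P) = ev3 lam' (h x) (h y) (h z) P.
Proof.
move=> el; apply: rmorph_pev => c2; apply: rmorph_pev => c1.
by apply: rmorph_pev.
Qed.
End Ev.

(** The polynomial X^q + X - c is separable: its derivative is 1. *)
Lemma roots_additive_poly (k : closedFieldType) (q : nat) (c : k) :
  (1 < q)%N -> q%:R = 0 :> k ->
  exists s : seq k, [/\ uniq s, size s = q & forall a, a \in s -> a ^+ q + a = c].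
Proof.
move=> q1 qk; pose p : {poly k} := 'X^q + ('X - c%:P).
have szp : size p = q.+1 by rewrite size_polyDl ?size_polyXn ?size_XsubC.
have [s ps] := closed_field_poly_normal p.
have lp : lead_coef p = 1.
  by rewrite lead_coefDl ?lead_coefXn ?size_polyXn ?size_XsubC.
rewrite lp scale1r in ps; exists s; split.
- rewrite -(separable_prod_XsubC s) -ps unlock derivD derivXn derivXsubC.
  by rewrite -mulr_natl -polyC_natr qk mul0r add0r coprimep1.
- by move: szp; rewrite ps size_prod_XsubC => -[].
move=> a sa; have : root p a by rewrite ps root_prod_XsubC.
by rewrite /root /p hornerD hornerXn hornerXsubC addrA subr_eq0 => /eqP.
Qed.

Section CurveRing.
Variables (k : closedFieldType) (q0 q n : nat).
Hypotheses (q_gt1 : (1 < q)%N) (qk : q%:R = 0 :> k).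

Definition curve_eq (S : comNzRingType) (x y z : S) : Prop :=
  y ^+ q + y = x ^+ q0 * (x ^+ q + x) /\ x ^+ q + x = z ^+ n.

(** Normal form modulo the two equations, whose leading terms are Y^q and X^q. *)
Definition reduced (P : poly3 k) : Prop :=
  (size P <= q)%N /\ forall j, (size (P`_j)%R <= q)%N.

Lemma additive_poly_rmod (R : comNzRingType) (c : R) (P : {poly R}) :
  exists Q P' : {poly R},
    P = Q * ('X^q + 'X - c%:P) + P' /\ (size P' <= q)%N.
Proof.
set M := 'X^q + 'X - c%:P.
have sz : size M = q.+1.
  by rewrite /M -addrA size_polyDl ?size_polyXn // size_XsubC.
have mM : M \is monic.
  by rewrite monicE /M -addrA lead_coefDl ?lead_coefXn ?size_polyXn ?size_XsubC.
exists (Pdiv.Ring.rdivp P M), (Pdiv.Ring.rmodp P M); split.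
  exact: Pdiv.RingMonic.rdivp_eq.
by rewrite -ltnS -sz Pdiv.Ring.ltn_rmodp monic_neq0.
Qed.

Lemma pev_additive_poly (R S : comNzRingType) (g : {rmorphism R -> S}) u c :
  u ^+ q + u = g c -> pev g u ('X^q + 'X - c%:P) = 0.
Proof. by rewrite rmorphB rmorphD rmorphXn /= pevX pevC => ->; rewrite subrr. Qed.

Lemma reduce_curve_eq (P : poly3 k) : exists2 P', reduced P' &
  forall (S : comNzRingType) (lam : {rmorphism k -> S}) (x y z : S),
    curve_eq x y z -> ev3 lam x y z P = ev3 lam x y z P'.
Proof.
have [Q [P1 [eP sP1]]] := additive_poly_rmod ('X^q0 * ('X^n)%:P) P.
pose MX : {poly {poly k}} := 'X^q + 'X - ('X^n)%:P.
have /choice[r hr] (c : {poly {poly k}}) : exists r : {poly {poly k}},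
    (exists Q1, c = Q1 * MX + r) /\ (size r <= q)%N.
  by have [Q1 [r [h1 h2]]] := additive_poly_rmod 'X^n c; exists r; split; first exists Q1.
pose r' c := if c == 0 then 0 else r c.
have r'0 : r' 0 = 0 by rewrite /r' eqxx.
exists (map_poly r' P1).
  split; first exact: leq_trans (size_poly _ _) sP1.
  move=> j; rewrite coef_map_id0 // /r'; case: eqP => _; rewrite ?size_poly0 //.
  by have [] := hr P1`_j.
move=> S lam x y z [Ey Ex].
rewrite /ev3 pev_map_id //; last first.
  move=> c; rewrite /r'; case: eqP => [->//|_].
  have [[Q1 ec] _] := hr c; rewrite [in RHS]ec rmorphD rmorphM /= /MX.
  by rewrite pev_additive_poly ?mulr0 ?add0r // rmorphXn /= pevX.
rewrite {1}eP rmorphD rmorphM /= pev_additive_poly ?mulr0 ?add0r //.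
by rewrite rmorphM rmorphXn /= pevX pevC rmorphXn /= pevX -Ex.
Qed.

(** Over each z0 there are q choices of x0, and over each of them q choices
    of y0: too many zeros for a nonzero polynomial of smaller degrees. *)
Lemma reduced_vanishing (P : poly3 k) : reduced P ->
  (forall x0 y0 z0 : k, curve_eq x0 y0 z0 -> ev3 idfun x0 y0 z0 P = 0) -> P = 0.
Proof.
move=> [sP sPj] van; apply/polyP => j; rewrite coef0; apply/polyP => i.
rewrite coef0; apply/eqP; apply: contraT => /closed_nonrootP[z0].
case/negP; rewrite /root.
pose g : {rmorphism {poly k} -> k} := pev idfun z0.
have -> : (P`_j`_i).[z0] = g P`_j`_i by rewrite /g /= pevE map_poly_id.
have [sx [usx szx hsx]] := roots_additive_poly (z0 ^+ n) q_gt1 qk.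
have zero (p : {poly k}) s : uniq s -> size s = q -> (size p <= q)%N ->
    (forall a, a \in s -> p.[a] = 0) -> p = 0.
  move=> us ss sp h; apply/eqP; apply: contraLR sp => p0; rewrite -ltnNge -ss.
  by apply: max_poly_roots => //; apply/allP => a /h pa; rewrite /root pa.
suff h0 : map_poly g P`_j = 0 by rewrite -coef_map h0 coef0.
apply: (zero _ sx) => // [|x0 x0s].
  by apply: leq_trans (size_poly _ _) _.
rewrite -pevE.
have [sy [usy szy hsy]] := roots_additive_poly (x0 ^+ q0 * (x0 ^+ q + x0)) q_gt1 qk.
suff h0 : map_poly (pev g x0) P = 0 by rewrite -coef_map h0 coef0.
apply: (zero _ sy) => // [|y0 y0s].
  by apply: leq_trans (size_poly _ _) _.
by rewrite -pevE; apply: van; split; [exact: hsy|exact: hsx].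
Qed.

(** The ideal of the curve is generated by the two equations. *)
Lemma curve_vanishing (P : poly3 k) :
  (forall x0 y0 z0 : k, curve_eq x0 y0 z0 -> ev3 idfun x0 y0 z0 P = 0) ->
  forall (S : comNzRingType) (lam : {rmorphism k -> S}) (x y z : S),
    curve_eq x y z -> ev3 lam x y z P = 0.
Proof.
have [P' rP' eP] := reduce_curve_eq P.
move=> van S lam x y z xyz; rewrite (eP S) // (reduced_vanishing rP') ?rmorph0 //.
by move=> x0 y0 z0 h; rewrite -(eP _ idfun) // van.
Qed.

(** The function field of the curve with these equations, together with its
    coordinate functions. *)
Definition curve_field (L : fieldType) (lam : {rmorphism k -> L}) (x y z : L) :=
  [/\ curve_eq x y z,
      forall P, ev3 lam x y z P = 0 ->
        forall x0 y0 z0 : k, curve_eq x0 y0 z0 -> ev3 idfun x0 y0 z0 P = 0 &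
      forall a, exists P r, ev3 lam x y z r != 0 /\
        a = ev3 lam x y z P / ev3 lam x y z r].

Section CurveField.
Variables (L : fieldType) (lam : {rmorphism k -> L}) (x y z : L).
Hypothesis hL : curve_field lam x y z.

Lemma curve_field_reduced P : reduced P -> ev3 lam x y z P = 0 -> P = 0.
Proof.
by case: hL => _ spec _ rP /spec; exact: reduced_vanishing.
Qed.

(** The coordinate functions are a generic solution of the equations of the
    curve; automorphisms and evaluations all come from here. *)
Lemma specialization P : ev3 lam x y z P = 0 ->
  forall (S : comNzRingType) (lam' : {rmorphism k -> S}) (x' y' z' : S),
    curve_eq x' y' z' -> ev3 lam' x' y' z' P = 0.
Proof. by case: hL => _ spec _ /spec; exact: curve_vanishing. Qed.

Lemma pev_z_inj c : pev lam z c = 0 -> c = 0.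
Proof.
move=> c0; suff : cZ c = 0 by move/polyC_inj/polyC_inj.
apply: curve_field_reduced; last by rewrite ev3_cZ.
split; first by rewrite (leq_trans (size_polyC_leq1 _)) // ltnW.
move=> j; rewrite coefC; case: eqP => _; last by rewrite size_poly0.
by rewrite (leq_trans (size_polyC_leq1 _)) // ltnW.
Qed.
End CurveField.
End CurveRing.

(** * The translations of the curve *)

Lemma frobenius2 (S : comNzRingType) (j : nat) (u v : S) :
  2%N \in [pchar S] -> (u + v) ^+ (2 ^ j) = u ^+ (2 ^ j) + v ^+ (2 ^ j).
Proof.
move=> S2; elim: j => [|j IH]; first by rewrite !expr1.
by rewrite expnSr !exprM IH sqrrD mulr2n addrr_pchar2 // addr0.
Qed.

Section Suzuki.
Variables (k : closedFieldType) (e q0 q n : nat).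
Hypotheses (hk : 2%N \in [pchar k]) (hq0 : q0 = (2 ^ e)%N) (hq : q = (2 * q0 ^ 2)%N).
Local Notation curve_eq := (curve_eq q0 q n).

Lemma suzuki_qE : q = (2 ^ (e.*2).+1)%N.
Proof. by rewrite hq hq0 -expnM expnS muln2. Qed.

Lemma suzuki_2q0E : (2 * q0)%N = (2 ^ e.+1)%N.
Proof. by rewrite hq0 expnS. Qed.

Lemma suzuki_q_gt1 : (1 < q)%N.
Proof. by rewrite suzuki_qE -[1%N](expn0 2) ltn_exp2l. Qed.

Lemma suzuki_qk : q%:R = 0 :> k.
Proof. by rewrite hq natrM (pcharf0 hk) mul0r. Qed.

Section Frobenius.
Variables (S : comNzRingType) (S2 : 2%N \in [pchar S]).
Implicit Types u v : S.
Lemma frob_q0 u v : (u + v) ^+ q0 = u ^+ q0 + v ^+ q0.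
Proof. by rewrite hq0 frobenius2. Qed.
Lemma frob_2q0 u v : (u + v) ^+ (2 * q0) = u ^+ (2 * q0) + v ^+ (2 * q0).
Proof. by rewrite suzuki_2q0E frobenius2. Qed.
Lemma frob_q u v : (u + v) ^+ q = u ^+ q + v ^+ q.
Proof. by rewrite suzuki_qE frobenius2. Qed.
Lemma frob_q2 u v : (u + v) ^+ (q ^ 2) = u ^+ (q ^ 2) + v ^+ (q ^ 2).
Proof. by rewrite suzuki_qE -expnM frobenius2. Qed.
End Frobenius.

Lemma rmorph_char2 (S : comNzRingType) (lam : {rmorphism k -> S}) :
  2%N \in [pchar S].
Proof. exact: rmorph_pchar hk. Qed.

Definition Fq_seq : seq k :=
  sval (cid (roots_additive_poly 0 suzuki_q_gt1 suzuki_qk)).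

Lemma Fq_uniq : uniq Fq_seq.
Proof. by rewrite /Fq_seq; case: cid => s []. Qed.
Lemma Fq_size : size Fq_seq = q.
Proof. by rewrite /Fq_seq; case: cid => s []. Qed.

Lemma mem_Fq a : (a \in Fq_seq) = (a ^+ q == a).
Proof.
have add0 (b : k) : (b ^+ q + b == 0) = (b ^+ q == b).
  by rewrite -[RHS]subr_eq0 oppr_pchar2.
have roots b : b \in Fq_seq -> b ^+ q + b = 0.
  by rewrite /Fq_seq; case: cid => s [_ _ h] /h.
apply/idP/idP => [/roots/eqP|ha]; first by rewrite add0.
apply: contraT => aN; pose p : {poly k} := 'X^q + ('X - 0%:P).
have szp : size p = q.+1.
  by rewrite size_polyDl ?size_polyXn ?size_XsubC // ltnS suzuki_q_gt1.
have : (size (a :: Fq_seq) < size p)%N.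
  apply: max_poly_roots; first by rewrite -size_poly_gt0 szp.
    apply/allP => b; rewrite inE => /predU1P[->|/roots b0]; rewrite /root /p hornerD hornerXn hornerXsubC.
      by rewrite ?subr0 add0.
    by rewrite ?subr0 b0.
  by rewrite /= aN Fq_uniq.
by rewrite szp /= Fq_size ltnn.
Qed.

Definition Fq := seq_sub Fq_seq.
Definition to_Fq a (ha : a ^+ q = a) : Fq :=
  @SeqSub _ Fq_seq a (etrans (mem_Fq a) (introT eqP ha)).

Lemma FqP (a : Fq) : val a ^+ q = val a.
Proof. by apply/eqP; rewrite -mem_Fq; exact: valP. Qed.

Lemma card_Fq : #|{: Fq}| = q.
Proof. by rewrite card_seq_sub ?Fq_uniq // Fq_size. Qed.

(** The Sylow 2-subgroup of the Suzuki group that fixes the point at infinity;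
    its elements (a, b) act by x -> x + a, y -> y + a^q0 x + b. *)
Definition trans_group := (Fq * Fq)%type.

Lemma card_trans_group : #|{: trans_group}| = (q ^ 2)%N.
Proof. by rewrite card_prod card_Fq mulnn. Qed.

Definition tra (g : trans_group) : k := val g.1.
Definition trb (g : trans_group) : k := val g.2.
Lemma traP g : tra g ^+ q = tra g. Proof. exact: FqP. Qed.
Lemma trbP g : trb g ^+ q = trb g. Proof. exact: FqP. Qed.

Lemma trans_group_inj g g' : tra g = tra g' -> trb g = trb g' -> g = g'.
Proof. by case: g g' => [a b] [a' b']; rewrite /tra /trb /= => /val_inj -> /val_inj ->. Qed.

Lemma trans_group_ex a b : a ^+ q = a -> b ^+ q = b -> exists g, tra g = a /\ trb g = b.
Proof. by move=> ha hb; exists (to_Fq ha, to_Fq hb). Qed.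

Lemma q_fixed_add (a b : k) : a ^+ q = a -> b ^+ q = b -> (a + b) ^+ q = a + b.
Proof. by move=> ha hb; rewrite frob_q // ha hb. Qed.
Lemma q_fixed_mul (a b : k) : a ^+ q = a -> b ^+ q = b -> (a * b) ^+ q = a * b.
Proof. by move=> ha hb; rewrite exprMn ha hb. Qed.
Lemma q_fixed_exp j (a : k) : a ^+ q = a -> (a ^+ j) ^+ q = a ^+ j.
Proof. by move=> ha; rewrite exprAC ha. Qed.
Lemma q_fixed0 : (0 : k) ^+ q = 0.
Proof. by rewrite expr0n; case: q suzuki_q_gt1. Qed.

Lemma exp_q0_2q0 (S : comNzRingType) (u : S) : (u ^+ q0) ^+ (2 * q0) = u ^+ q.
Proof. by rewrite -exprM hq mulnCA mulnn. Qed.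
Lemma exp_2q0_q0 (S : comNzRingType) (u : S) : (u ^+ (2 * q0)) ^+ q0 = u ^+ q.
Proof. by rewrite exprAC exp_q0_2q0. Qed.

Definition tr_x (S : comNzRingType) (lam : {rmorphism k -> S}) (a : k) (x : S) :=
  x + lam a.
Definition tr_y (S : comNzRingType) (lam : {rmorphism k -> S}) (a b : k) (x y : S) :=
  y + lam a ^+ q0 * x + lam b.

Lemma rmorph_tr (S S' : comNzRingType) (h : {rmorphism S -> S'})
    (lam : {rmorphism k -> S}) (lam' : {rmorphism k -> S'}) a b x y :
  (forall c, h (lam c) = lam' c) ->
  h (tr_x lam a x) = tr_x lam' a (h x) /\
  h (tr_y lam a b x y) = tr_y lam' a b (h x) (h y).
Proof.
by move=> hl; rewrite /tr_x /tr_y !rmorphD rmorphM rmorphXn !hl.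
Qed.

Lemma curve_eq_tr (S : comNzRingType) (lam : {rmorphism k -> S}) (a b : k) x y z :
  a ^+ q = a -> b ^+ q = b -> curve_eq x y z ->
  curve_eq (tr_x lam a x) (tr_y lam a b x y) z.
Proof.
move=> ha hb [Ey Ex]; have S2 := rmorph_char2 lam.
have Ex' : (x + lam a) ^+ q + (x + lam a) = x ^+ q + x.
  by rewrite frob_q // -[lam a ^+ q]rmorphXn ha addrACA addrr_pchar2 // addr0.
split; rewrite /tr_x /tr_y Ex' //.
rewrite !frob_q // exprMn -exprM mulnC exprM -[lam a ^+ q]rmorphXn ha.
rewrite -[lam b ^+ q]rmorphXn hb addrACA addrr_pchar2 // addr0 addrACA Ey.
by rewrite frob_q0 //; ring.
Qed.

Definition cst3r : {rmorphism k -> poly3 k} := @cst3 k.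
Definition shift_x a : poly3 k := @tr_x (poly3 k) cst3r a (vX k).
Definition shift_y a b : poly3 k := @tr_y (poly3 k) cst3r a b (vX k) (vY k).
Definition shift a b (P : poly3 k) : poly3 k :=
  @ev3 k (poly3 k) cst3r (shift_x a) (shift_y a b) (vZ k) P.
HB.instance Definition _ a b := GRing.RMorphism.copy (shift a b)
  (@ev3 k (poly3 k) cst3r (shift_x a) (shift_y a b) (vZ k)).

Lemma ev3_shift_xy (S : comNzRingType) (lam' : {rmorphism k -> S}) x' y' z' a b :
  ev3 lam' x' y' z' (shift_x a) = tr_x lam' a x' /\
  ev3 lam' x' y' z' (shift_y a b) = tr_y lam' a b x' y'.
Proof.
have [ex ey] := @rmorph_tr (poly3 k) S (ev3 lam' x' y' z') cst3r lam' a b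
  (vX k) (vY k) (ev3_cst lam' x' y' z').
split.
  exact: etrans ex (congr1 (tr_x lam' a) (ev3X lam' x' y' z')).
exact: etrans ey (congr2 (tr_y lam' a b) (ev3X lam' x' y' z') (ev3Y lam' x' y' z')).
Qed.

Section Translations.
Variables (L : fieldType) (lam : {rmorphism k -> L}) (x y z : L).
Hypothesis hL : curve_field q0 q n lam x y z.
Local Notation evL := (ev3 lam x y z).
Let L2 : 2%N \in [pchar L] := rmorph_char2 lam.

Lemma ev3_shift (S : comNzRingType) (lam' : {rmorphism k -> S}) x' y' z' a b P :
  ev3 lam' x' y' z' (shift a b P)
    = ev3 lam' (tr_x lam' a x') (tr_y lam' a b x' y') z' P.
Proof.
have es := @rmorph_ev3 k (poly3 k) cst3r (shift_x a) (shift_y a b) (vZ k) S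
  (ev3 lam' x' y' z') lam' P (ev3_cst lam' x' y' z').
apply: etrans es _.
have [ex ey] := ev3_shift_xy lam' x' y' z' a b.
exact: (f_equal3 (fun a b c => ev3 lam' a b c P) ex ey (ev3Z lam' x' y' z')).
Qed.

(** The translated triple solves the equations too, hence is a specialization
    of (x, y, z); so is conversely (x, y, z) of the translated triple, by the
    inverse translation. *)
Lemma translation_aut a b : a ^+ q = a -> b ^+ q = b ->
  exists s : {rmorphism L -> L},
    forall P, s (evL P) = evL (shift a b P).
Proof.
move=> ha hb; have [xyz spec gen] := hL.
have xyz' := curve_eq_tr lam ha hb xyz.
apply: (fraction_extension (be := ev3 lam x y z \o shift a b)) => //= P.
rewrite ev3_shift; split=> [P0|].
  exact: (specialization suzuki_q_gt1 suzuki_qk hL P0).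
rewrite -ev3_shift => P0.
pose b' := a ^+ q0 * a + b.
have hb' : b' ^+ q = b'.
  by rewrite q_fixed_add // q_fixed_mul // q_fixed_exp.
have := specialization suzuki_q_gt1 suzuki_qk hL P0 lam (curve_eq_tr lam ha hb' xyz).
rewrite ev3_shift.
have -> : tr_x lam a (tr_x lam a x) = x by rewrite /tr_x -addrA addrr_pchar2 // addr0.
have -> // : tr_y lam a b (tr_x lam a x) (tr_y lam a b' x y) = y.
rewrite /tr_y /tr_x /b' rmorphD rmorphM rmorphXn.
transitivity (y + (lam a ^+ q0 * x + lam a ^+ q0 * x)
  + (lam a ^+ q0 * lam a + lam a ^+ q0 * lam a) + (lam b + lam b)); first by ring.
by rewrite !addrr_pchar2 // !addr0.
Qed.

Lemma translation_auts : exists s : trans_group -> {rmorphism L -> L},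
  forall g P, s g (evL P) = evL (shift (tra g) (trb g) P).
Proof.
have /choice[s hs] g := translation_aut (traP g) (trbP g).
by exists s.
Qed.

Definition trans : trans_group -> {rmorphism L -> L} := sval (cid translation_auts).

Lemma trans_ev g P : trans g (evL P) = evL (shift (tra g) (trb g) P).
Proof. exact: (proj2_sig (cid translation_auts)). Qed.

Lemma trans_lam g c : trans g (lam c) = lam c.
Proof. by rewrite -(ev3_cst lam x y z) trans_ev ev3_shift ev3_cst ev3_cst. Qed.
Lemma trans_x g : trans g x = x + lam (tra g).
Proof. by rewrite -{1}(ev3X lam x y z) trans_ev ev3_shift ev3X. Qed.
Lemma trans_y g : trans g y = y + lam (tra g) ^+ q0 * x + lam (trb g).
Proof. by rewrite -{1}(ev3Y lam x y z) trans_ev ev3_shift ev3Y. Qed.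
Lemma trans_z g : trans g z = z.
Proof. by rewrite -{1}(ev3Z lam x y z) trans_ev ev3_shift ev3Z. Qed.
Lemma trans_pev g c : trans g (pev lam z c) = pev lam z c.
Proof. by rewrite (rmorph_pev z c (trans_lam g)) trans_z. Qed.

Lemma rmorph_curve_ext (s t : {rmorphism L -> L}) :
  (forall c, s (lam c) = t (lam c)) -> s x = t x -> s y = t y -> s z = t z ->
  s =1 t.
Proof.
move=> ec ex ey ez v; have [_ _ gen] := hL; have [P [r [_ ->]]] := gen v.
have est Q : s (evL Q) = t (evL Q).
  rewrite (rmorph_ev3 x y z Q (lam' := s \o lam)) //.
  by rewrite (rmorph_ev3 x y z Q (h := t) (lam' := s \o lam)) ?ex ?ey ?ez // => c; rewrite /= ec.
by rewrite !rmorphM !fmorphV !est.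
Qed.

Lemma trans_inj g g' : trans g =1 trans g' -> g = g'.
Proof.
move=> h; have ea : tra g = tra g'.
  have hx := etrans (esym (trans_x g)) (etrans (h x) (trans_x g')).
  by move/addrI: hx; move/fmorph_inj.
apply: trans_group_inj => //.
have hy := etrans (esym (trans_y g)) (etrans (h y) (trans_y g')).
by rewrite ea in hy; move/addrI: hy; move/fmorph_inj.
Qed.

Lemma trans_comp g g' : exists g'', forall v, trans g (trans g' v) = trans g'' v.
Proof.
have [g'' [ea eb]] := @trans_group_ex (tra g + tra g')
  (trb g + trb g' + tra g' ^+ q0 * tra g)
  (q_fixed_add (traP g) (traP g'))
  (q_fixed_add (q_fixed_add (trbP g) (trbP g'))
    (q_fixed_mul (q_fixed_exp q0 (traP g')) (traP g))).
exists g'' => v; apply: (@rmorph_curve_ext (trans g \o trans g') (trans g'')) => [c|||].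
- by rewrite /= !trans_lam.
- by rewrite /= !trans_x rmorphD trans_x trans_lam ea rmorphD addrA.
- rewrite /= !trans_y !rmorphD rmorphM rmorphXn !trans_lam trans_y trans_x /= ea eb.
  by rewrite !rmorphD frob_q0 // rmorphM rmorphXn; ring.
- by rewrite /= !trans_z.
Qed.

Lemma trans_mul_ex : exists m : trans_group -> trans_group -> trans_group,
  forall g g' v, trans g (trans g' v) = trans (m g g') v.
Proof.
have /choice[m hm] g : exists mg : trans_group -> trans_group, forall g' v,
    trans g (trans g' v) = trans (mg g') v.
  by have /choice[mg hmg] := trans_comp g; exists mg.
by exists m.
Qed.

Definition trans_mul : trans_group -> trans_group -> trans_group := sval (cid trans_mul_ex).
Lemma trans_mulE g g' v : trans g (trans g' v) = trans (trans_mul g g') v.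
Proof. exact: (proj2_sig (cid trans_mul_ex)). Qed.

Lemma trans_mul_inj g : injective (trans_mul g).
Proof.
move=> g1 g2 h; apply: trans_inj => v.
by apply: (fmorph_inj (trans g)); rewrite !trans_mulE h.
Qed.

Definition trans_one : trans_group := (to_Fq q_fixed0, to_Fq q_fixed0).
Lemma trans_oneE v : trans trans_one v = v.
Proof.
apply: (@rmorph_curve_ext (trans trans_one) idfun) => [c|||] /=; rewrite ?trans_lam ?trans_z //.
  by rewrite trans_x /trans_one /tra /= rmorph0 addr0.
rewrite trans_y /trans_one /tra /trb /= rmorph0 expr0n hq0 expn_eq0 /= mul0r addr0.
by rewrite addr0.
Qed.

Lemma const_of_translates (p : {poly L}) (u : L) : (size p <= q)%N ->
  (forall a : Fq, p.[u + lam (val a)] = p.[u]) -> p.[u] = p.[0].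
Proof.
move=> sp h; suff : p - p.[u]%:P == 0.
  by rewrite subr_eq0 => /eqP ep; rewrite {2}ep hornerC.
have sz : (size (p - p.[u]%:P)%R <= q)%N.
  rewrite (leq_trans (size_polyD _ _)) // geq_max sp size_polyN.
  by rewrite (leq_trans (size_polyC_leq1 _)) // ltnW // suzuki_q_gt1.
apply: contraLR sz => p0; rewrite -ltnNge.
have := max_poly_roots (rs := [seq u + lam (val a) | a : Fq]) p0.
rewrite size_map -cardE card_Fq; apply.
  apply/allP => _ /mapP[a _ ->]; rewrite /root hornerD hornerN hornerC h.
  by rewrite subrr.
rewrite map_inj_uniq ?enum_uniq // => a a' /addrI /(fmorph_inj lam).
exact: val_inj.
Qed.

(** In reduced form an invariant function is, over k(x, z), a polynomial in y
    of degree < q with equal values at the q elements y + b, hence constant;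
    then the same holds for x. *)
Lemma fixed_ev3 P : (forall g, trans g (evL P) = evL P) ->
  exists c, evL P = pev lam z c.
Proof.
have [P' [sP sPj] eP] := reduce_curve_eq q0 n suzuki_q_gt1 P.
have [xyz _ _] := hL; rewrite (eP _ lam x y z xyz) => {eP P} fP.
have e1 : evL P' = pev (pev lam z) x P'`_0.
  rewrite /ev3 pevE (const_of_translates (u := y)).
  - by rewrite horner_coef0 coef_map.
  - by apply: leq_trans (size_poly _ _) _.
  move=> b; have [g [ea eb]] := trans_group_ex q_fixed0 (FqP b).
  have := fP g; rewrite trans_ev ev3_shift /tr_x /tr_y ea eb !rmorph0 addr0.
  rewrite expr0n hq0 expn_eq0 /= mul0r addr0 /ev3 !pevE => ->.
  by [].
rewrite e1 in fP *; exists P'`_0`_0.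
rewrite pevE (const_of_translates (u := x)).
- by rewrite horner_coef0 coef_map.
- by apply: leq_trans (size_poly _ _) _.
move=> a; have [g [ea eb]] := trans_group_ex (FqP a) q_fixed0.
have := fP g; rewrite [X in X = _](rmorph_pev x P'`_0 (trans_pev g)) trans_x ea.
by rewrite !pevE => ->.
Qed.

(** The denominator is replaced by its norm under the translations. *)
Lemma denominator_in_z v : exists P c, c != 0 /\ v = evL P / pev lam z c.
Proof.
have [_ _ gen] := hL; have [P [r [r0 ->]]] := gen v.
pose N g := shift (tra g) (trb g) r.
have sN g g' : trans g (evL (N g')) = evL (N (trans_mul g g')).
  exact: etrans (congr1 (trans g) (esym (trans_ev g' r)))
    (etrans (trans_mulE g g' (evL r)) (trans_ev _ r)).
have [c ec] : exists c, evL (\prod_g N g) = pev lam z c.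
  apply: fixed_ev3 => g; rewrite [evL _]rmorph_prod [LHS]rmorph_prod /=.
  rewrite [RHS](reindex_inj (@trans_mul_inj g)) /=; apply: eq_bigr => g' _.
  exact: sN.
have N0 g : evL (N g) != 0 by rewrite /N -trans_ev fmorph_eq0.
have c0 : c != 0.
  apply: contraTneq (erefl true) => c0; move/eqP: ec.
  rewrite c0 rmorph0 rmorph_prod /= => /prodf_eq0[g _].
  by rewrite (negbTE (N0 g)).
exists (P * \prod_(g | g != trans_one) N g), c; split=> //.
have N1 : evL (N trans_one) = evL r by rewrite /N -trans_ev trans_oneE.
set M := \prod_(g | _) _.
have eN : evL (\prod_g N g) = evL r * evL M by rewrite -N1 -ev3M /M (bigD1 trans_one).
rewrite -ec eN ev3M -mulf_div divff ?mulr1 //.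
by rewrite [evL _]rmorph_prod; apply/prodf_neq0 => g _; exact: N0.
Qed.

Lemma fixed_in_kz v : (forall g, trans g v = v) ->
  exists c d, d != 0 /\ v = pev lam z c / pev lam z d.
Proof.
move=> fv; have [P [d [d0 ev_]]] := denominator_in_z v.
have d0' : pev lam z d != 0.
  by apply: contraNneq d0 => /(pev_z_inj suzuki_q_gt1 suzuki_qk hL) ->.
have eP : evL P = v * pev lam z d by rewrite ev_ divfK.
have [c ec] : exists c, evL P = pev lam z c.
  by apply: fixed_ev3 => g; rewrite eP rmorphM /= fv trans_pev.
by exists c, d; rewrite -ec.
Qed.

End Translations.
End Suzuki.

(** * The functions u and w *)

(** Halving a + b: the way to prove polynomial identities in characteristic 2
    by ring arithmetic over the integers. *)
Lemma char2_eq (S : comNzRingType) (a b c : S) :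
  2%N \in [pchar S] -> a + b = c + c -> a = b.
Proof.
by move=> S2; rewrite addrr_pchar2 // => /eqP; rewrite addr_eq0 oppr_pchar2 // => /eqP.
Qed.

Section SuzukiFunctions.
Variables (q0 : nat).

(** Together with 1, x and y, these functions of Hansen and Stichtenoth embed
    the Suzuki curve in P^4. With t = x^q + x, they satisfy u^q + u = x^(2 q0) t
    and w^q + w = y^(2 q0) t. *)
Definition suz_u (S : comNzRingType) (x y : S) := x ^+ (2 * q0) * x + y ^+ (2 * q0).
Definition suz_w (S : comNzRingType) (x y : S) := x * suz_u x y + y ^+ 2.

Lemma rmorph_suz_w (S S' : comNzRingType) (h : {rmorphism S -> S'}) x y :
  h (suz_w x y) = suz_w (h x) (h y).
Proof. by rewrite /suz_w /suz_u !(rmorphD, rmorphM, rmorphXn). Qed.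

Section Identities.
Variables (e q : nat) (hq0 : q0 = (2 ^ e)%N) (hq : q = (2 * q0 ^ 2)%N).
Variables (S : comNzRingType) (S2 : 2%N \in [pchar S]) (x y t : S).
Hypotheses (hx : x ^+ q = x + t) (hy : y ^+ q = y + x ^+ q0 * t).
Local Notation u := (suz_u x y).
Local Notation w := (suz_w x y).
Let p := x ^+ q0.
Let r2 := y ^+ (2 * q0).
Let frq0 := frob_q0 hq0 S2.
Let fr2q0 := frob_2q0 hq0 S2.
Let frq := frob_q hq0 hq S2.

Let xp2 : x ^+ (2 * q0) = p ^+ 2.
Proof. by rewrite /p mulnC exprM. Qed.
Let uE : u = p ^+ 2 * x + r2. Proof. by rewrite /suz_u xp2. Qed.
Let wE : w = x * (p ^+ 2 * x + r2) + y ^+ 2. Proof. by rewrite /suz_w uE. Qed.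

Lemma y2q0_frob : (y ^+ (2 * q0)) ^+ q = y ^+ (2 * q0) + (x + t) * t ^+ (2 * q0).
Proof. by rewrite exprAC hy fr2q0 exprMn (exp_q0_2q0 hq) hx. Qed.

Lemma suz_u_frob : u ^+ q = u + x ^+ (2 * q0) * t.
Proof.
rewrite {1}/suz_u frq exprMn y2q0_frob exprAC hx fr2q0 uE xp2 -/r2.
set T := t ^+ _.
apply: (char2_eq (c := p ^+ 2 * x + p ^+ 2 * t + T * x + T * t + r2)) => //.
by ring.
Qed.

Lemma suz_w_frob : w ^+ q = w + y ^+ (2 * q0) * t.
Proof.
rewrite {1}/suz_w frq exprMn suz_u_frob hx [(y ^+ 2) ^+ q]exprAC hy uE wE xp2 -/p -/r2.
apply: (char2_eq (c := p ^+ 2 * x ^+ 2 + r2 * x + p ^+ 2 * t * x + r2 * t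
  + p ^+ 2 * t ^+ 2 + y ^+ 2 + p * t * y)) => //.
by ring.
Qed.

(** The last term is the leading one at the place at infinity. *)
Lemma suz_w_frob2 :
  w ^+ (q ^ 2) = w + y ^+ (2 * q0) * (t + t ^+ q) + x * t ^+ (2 * q0) * t ^+ q
    + t * t ^+ (2 * q0) * t ^+ q.
Proof.
rewrite -mulnn exprM suz_w_frob frq suz_w_frob exprMn y2q0_frob.
by ring.
Qed.

Lemma suz_u_q0 : u ^+ q0 = p * x + y.
Proof.
rewrite /suz_u frq0 exprMn !(exp_2q0_q0 hq) hx hy -/p.
by apply: (char2_eq (c := p * x + p * t + y)) => //; ring.
Qed.

Lemma suz_w_q0 : w ^+ q0 = u + p * y.
Proof.
rewrite /suz_w frq0 exprMn suz_u_q0 -exprM -/p -/r2 uE.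
by apply: (char2_eq (c := p ^+ 2 * x + p * y + r2)) => //; ring.
Qed.

Lemma suz_u_2q0 : u ^+ (2 * q0) = w + x * r2.
Proof.
rewrite mulnC exprM suz_u_q0 wE.
by apply: (char2_eq (c := p ^+ 2 * x ^+ 2 + p * x * y + y ^+ 2 + r2 * x)) => //; ring.
Qed.

Lemma suz_w_2q0 : w ^+ (2 * q0) = p ^+ 2 * w + u * r2.
Proof.
rewrite mulnC exprM suz_w_q0 wE uE.
by apply: (char2_eq (c := p ^+ 4 * x ^+ 2 + p ^+ 2 * r2 * x + p ^+ 2 * r2 * x
  + p ^+ 3 * x * y + r2 ^+ 2 + p * r2 * y + p ^+ 2 * y ^+ 2)) => //; ring.
Qed.

(** The next three identities say, once divided by powers of w, that x, y and
    t = x^q + x may be replaced by u/w, y/w and t/w^(q - 2 q0 + 1) in the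
    equations of the curve, and that this substitution maps u to x/w. *)
Lemma swap_eq_x : u ^+ q * w + u * w ^+ q = w ^+ (2 * q0) * t.
Proof.
rewrite suz_u_frob suz_w_frob suz_w_2q0 xp2 -/r2 uE wE.
by apply: (char2_eq (c := p ^+ 4 * x ^+ 3 + p ^+ 2 * r2 * x ^+ 2
  + p ^+ 2 * r2 * x ^+ 2 + p ^+ 2 * x * y ^+ 2 + r2 ^+ 2 * x + r2 * y ^+ 2
  + p ^+ 4 * t * x ^+ 2 + p ^+ 2 * r2 * t * x + p ^+ 2 * r2 * t * x
  + p ^+ 2 * t * y ^+ 2 + r2 ^+ 2 * t)) => //; ring.
Qed.

Lemma swap_eq_y : y ^+ q * w + y * w ^+ q = u ^+ q0 * w ^+ q0 * t.
Proof.
rewrite hy suz_w_frob suz_u_q0 suz_w_q0 -/p -/r2 uE wE.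
by apply: (char2_eq (c := p ^+ 2 * x ^+ 2 * y + r2 * x * y + y ^+ 3
  + p ^+ 3 * t * x ^+ 2 + p * r2 * t * x + p * t * y ^+ 2 + r2 * t * y
  + p ^+ 2 * t * x * y)) => //; ring.
Qed.

Lemma swap_suz_u : u ^+ (2 * q0) * u + r2 * w = x * w ^+ (2 * q0).
Proof.
rewrite suz_u_2q0 suz_w_2q0 uE wE.
by apply: (char2_eq (c := p ^+ 4 * x ^+ 3 + p ^+ 2 * r2 * x ^+ 2
  + p ^+ 2 * r2 * x ^+ 2 + p ^+ 2 * r2 * x ^+ 2 + r2 ^+ 2 * x + r2 ^+ 2 * x
  + p ^+ 2 * x * y ^+ 2 + r2 * y ^+ 2)) => //; ring.
Qed.

End Identities.
End SuzukiFunctions.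

Section SuzukiNumbers.
Variables (e q0 q : nat) (hq0 : q0 = (2 ^ e)%N) (hq : q = (2 * q0 ^ 2)%N).

Lemma q0_gt0 : (0 < q0)%N. Proof. by rewrite hq0 expn_gt0. Qed.

Lemma leq_2q0_q : (2 * q0 <= q)%N.
Proof. by rewrite hq leq_mul2l /= -mulnn leq_pmulr // q0_gt0. Qed.

Lemma suzuki_factorization :
  ((q - 2 * q0 + 1) * (q + 2 * q0 + 1))%N = (q ^ 2 + 1)%N.
Proof.
have le := leq_2q0_q; have := hq; move: le; clear; nia.
Qed.
End SuzukiNumbers.

Section InvolutionAndOrigin.
Variables (e q0 q : nat) (hq0 : q0 = (2 ^ e)%N) (hq : q = (2 * q0 ^ 2)%N).
Variables (F : fieldType) (F2 : 2%N \in [pchar F]).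

(** For t = 0 the identity for w^q0 reads u = a^q0 b, so that
    w = a u + b^2 = b (a^q0 a + b); in both cases u vanishes, and then a. *)
Lemma suz_w_eq0 (a b : F) : a ^+ q = a -> b ^+ q = b -> suz_w q0 a b = 0 ->
  a = 0 /\ b = 0.
Proof.
move=> ha hb w0.
have ha' : a ^+ q = a + 0 by rewrite addr0.
have hb' : b ^+ q = b + a ^+ q0 * 0 by rewrite mulr0 addr0.
have q0n0 : (q0 != 0)%N by rewrite -lt0n (q0_gt0 hq0).
have u0 : suz_u q0 a b = a ^+ q0 * b.
  have := suz_w_q0 hq0 hq F2 ha' hb'; rewrite w0 expr0n (negbTE q0n0) => /esym/eqP.
  by rewrite addr_eq0 oppr_pchar2 // => /eqP.
have a0_of : suz_u q0 a 0 = 0 -> a = 0.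
  rewrite /suz_u expr0n muln_eq0 (negbTE q0n0) addr0 => /eqP.
  by rewrite mulf_eq0 expf_eq0 => /orP[/andP[_]|] /eqP.
have [b0|b0] := eqVneq b 0.
  by split=> //; apply: a0_of; move: u0; rewrite b0 mulr0.
move: w0; rewrite /suz_w u0 expr2 mulrA -mulrDl => /eqP.
rewrite mulf_eq0 (negbTE b0) orbF addr_eq0 oppr_pchar2 // => /eqP eb.
move: u0; rewrite {1}/suz_u -eb exprMn (exp_q0_2q0 hq) ha addrr_pchar2 // => /esym/eqP.
have aE : a * a ^+ q0 = 0 -> a = 0.
  by move/eqP; rewrite mulf_eq0 expf_eq0 => /orP[|/andP[_]] /eqP.
rewrite mulf_eq0 expf_eq0 => /orP[/andP[_ /eqP a0]|/eqP /aE a0].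
  by split=> //; rewrite a0 mul0r.
by split=> //; rewrite a0 mul0r.
Qed.

Variables (n h : nat) (hm : (n * h)%N = (q - 2 * q0 + 1)%N).

(** The involution of the Suzuki group that swaps the two points at which
    the projections are centred. *)
Lemma curve_eq_involution (x y z : F) : curve_eq q0 q n x y z ->
  suz_w q0 x y != 0 ->
  let w := suz_w q0 x y in
  curve_eq q0 q n (suz_u q0 x y / w) (y / w) (z / w ^+ h) /\
  suz_w q0 (suz_u q0 x y / w) (y / w) = w^-1.
Proof.
move=> [Ey Ex] w0 w; set t := x ^+ q + x in Ey Ex.
have hx : x ^+ q = x + t by rewrite /t addrCA addrr_pchar2 // addr0.
have hy : y ^+ q = y + x ^+ q0 * t by rewrite -Ey addrCA addrr_pchar2 // addr0.
have eqx := swap_eq_x hq0 hq F2 hx hy.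
have eqy := swap_eq_y hq0 hq F2 hx hy.
have equ := swap_suz_u hq0 hq F2 hx hy.
rewrite -/w in eqx eqy equ; set u := suz_u q0 x y in eqx eqy equ *.
have wX i : w ^+ i != 0 by rewrite expf_neq0.
have wq : w ^+ (q - 2 * q0 + 1) * w ^+ (2 * q0) = w ^+ q * w.
  by rewrite -exprD -exprSr; congr (_ ^+ _); have := leq_2q0_q hq0 hq; lia.
have ztE : (z / w ^+ h) ^+ n = t / w ^+ (q - 2 * q0 + 1).
  by rewrite expr_div_n -Ex -exprM mulnC hm.
have Ex' : (u / w) ^+ q + u / w = t / w ^+ (q - 2 * q0 + 1).
  rewrite expr_div_n addf_div //; apply/eqP.
  by rewrite eqr_div ?mulf_neq0 // eqx -wq; apply/eqP; ring.
split; first split; rewrite ?ztE //.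
  rewrite Ex' !expr_div_n addf_div // mulf_div; apply/eqP.
  rewrite eqr_div ?mulf_neq0 // eqy -wq.
  rewrite [w ^+ (2 * q0)](_ : _ = w ^+ q0 * w ^+ q0); last first.
    by rewrite -exprD addnn mul2n.
  by apply/eqP; ring.
have uE : suz_u q0 (u / w) (y / w) = x / w.
  rewrite /suz_u !expr_div_n mulf_div [X in _ + X](_ : _ = (y ^+ (2 * q0) * w) / (w ^+ (2 * q0) * w)).
    by rewrite -mulrDl equ invfM mulrA mulfK.
  by rewrite -mulf_div divff ?mulr1.
rewrite /suz_w uE expr_div_n mulf_div -expr2 -mulrDl [u * x]mulrC -[x * u + _]/w.
by rewrite expr2 invfM mulrA divff ?mul1r.
Qed.
End InvolutionAndOrigin.

(** * The minimal polynomial of W over k(Z) *)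

Section PevTwo.
Variables (k : fieldType) (S : comNzRingType) (lam : {rmorphism k -> S}) (W Z : S).

(** Polynomials in two variables W (outer) and Z (inner). *)
Definition ev2 (p : {poly {poly k}}) : S := pev (pev lam Z) W p.
Fact ev2_zmod : zmod_morphism ev2.
Proof. by move=> p p'; rewrite /ev2 rmorphB. Qed.
Fact ev2_monoid : monoid_morphism ev2.
Proof. by split=> [|p p']; rewrite /ev2 ?rmorph1 ?rmorphM. Qed.
HB.instance Definition _ :=
  GRing.isZmodMorphism.Build {poly {poly k}} S ev2 ev2_zmod.
HB.instance Definition _ :=
  GRing.isMonoidMorphism.Build {poly {poly k}} S ev2 ev2_monoid.
End PevTwo.

Section SeparableProducts.
Variables (L : fieldType) (I : finType).

Lemma root_prod_index (r : I -> L) i : (\prod_j ('X - (r j)%:P)).[r i] = 0.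
Proof.
by apply/eqP; rewrite horner_prod prodf_seq_eq0; apply/hasP; exists i;
  rewrite ?mem_index_enum //= hornerXsubC subrr.
Qed.

Lemma size_prod_index (r : I -> L) : size (\prod_j ('X - (r j)%:P)) = #|I|.+1.
Proof. by rewrite size_prod_XsubC /index_enum -enumT -cardE. Qed.

Lemma poly_small_roots (r : I -> L) (p : {poly L}) : injective r ->
  (size p <= #|I|)%N -> (forall i, p.[r i] = 0) -> p = 0.
Proof.
move=> ri sp pr; apply/eqP; apply: contraLR sp => p0; rewrite -ltnNge.
have := max_poly_roots (rs := [seq r i | i : I]) p0.
rewrite size_map -cardE; apply; last by rewrite map_inj_uniq ?enum_uniq.
by apply/allP => _ /mapP[i _ ->]; rewrite /root pr.
Qed.
End SeparableProducts.

Section Orbit.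
Variables (k : closedFieldType) (e q0 q n h : nat).
Hypotheses (hk : 2%N \in [pchar k]) (hq0 : q0 = (2 ^ e)%N) (hq : q = (2 * q0 ^ 2)%N).
Hypothesis hm : (n * h)%N = (q - 2 * q0 + 1)%N.
Variables (L : fieldType) (lam : {rmorphism k -> L}) (x y z : L).
Hypothesis hL : curve_field q0 q n lam x y z.
Local Notation evL := (ev3 lam x y z).
Local Notation trans_group := (trans_group hk hq0 hq).
Local Notation trans := (@trans k e q0 q n hk hq0 hq L lam x y z hL).

Let L2 : 2%N \in [pchar L] := rmorph_char2 hk lam.
Let q1 : (1 < q)%N := suzuki_q_gt1 hq0 hq.
Let qk : q%:R = 0 :> k := suzuki_qk hk hq.

Lemma h_gt0 : (0 < h)%N.
Proof. by move: hm; case: h => //; rewrite muln0 addn1. Qed.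
Lemma n_gt0 : (0 < n)%N.
Proof. by move: hm; case: n => //; rewrite addn1. Qed.

Definition W_fun : L := suz_w q0 x y ^+ h.

Definition conj3 (g : trans_group) : poly3 k :=
  @suz_w q0 (poly3 k) (shift_x (tra g)) (shift_y q0 (tra g) (trb g)) ^+ h.

Lemma ev3_conj3 (S : comNzRingType) (lam' : {rmorphism k -> S}) x' y' z' (g : trans_group) :
  ev3 lam' x' y' z' (conj3 g) =
  suz_w q0 (tr_x lam' (tra g) x') (tr_y q0 lam' (tra g) (trb g) x' y') ^+ h.
Proof.
have [ex ey] := ev3_shift_xy q0 lam' x' y' z' (tra g) (trb g).
have eX := rmorphXn (ev3 lam' x' y' z')
  h (@suz_w q0 (poly3 k) (shift_x (tra g)) (shift_y q0 (tra g) (trb g))).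
apply: etrans eX _; congr (_ ^+ _).
have eW := @rmorph_suz_w q0 (poly3 k) S (ev3 lam' x' y' z') (shift_x (tra g))
  (shift_y q0 (tra g) (trb g)).
exact: etrans eW (congr2 (@suz_w q0 S) ex ey).
Qed.

Lemma trans_W g : trans g W_fun = evL (conj3 g).
Proof.
have e1 := rmorphXn (trans g) h (suz_w q0 x y).
have e2 := etrans (rmorph_suz_w q0 (trans g) x y)
  (congr2 (@suz_w q0 L) (trans_x hL g) (trans_y hL g)).
exact: etrans e1 (etrans (congr1 (fun v => v ^+ h) e2) (esym (ev3_conj3 _ _ _ _ _))).
Qed.

Lemma curve_eq_origin : curve_eq q0 q n (0 : k) 0 0.
Proof.
have q0n : (q0 == 0)%N = false by rewrite hq0 expn_eq0.
have qn : (q == 0)%N = false by case: q q1.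
have nn : (n == 0)%N = false by case: n n_gt0.
by split; rewrite ?addr0 !expr0n ?q0n ?qn ?nn /= ?mul0r ?mulr0.
Qed.

Lemma tr_y0 (a b : k) : tr_y q0 idfun a b 0 0 = b.
Proof. by rewrite /tr_y mulr0 !add0r. Qed.

(** At the rational point that g moves to the origin, trans g W vanishes and
    the other conjugates do not. *)
Lemma trans_W_inj : injective (fun g => trans g W_fun).
Proof.
move=> g g' /= /eqP; rewrite !trans_W -subr_eq0 => /eqP eW.
pose a := tra g; pose b := trb g.
have k0 : curve_eq q0 q n (tr_x (idfun : {rmorphism k -> k}) a 0)
    (tr_y q0 (idfun : {rmorphism k -> k}) a (a ^+ q0 * a + b) 0 0) 0.
  apply: (curve_eq_tr hk hq0 hq idfun (traP g)); last exact: curve_eq_origin.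
  apply: (q_fixed_add hk hq0 hq); last exact: trbP.
  by apply: q_fixed_mul; [apply: q_fixed_exp|]; exact: traP.
have ePP : evL (conj3 g - conj3 g') = 0 by rewrite ev3B.
have eC := etrans (esym (ev3B idfun _ _ 0 (conj3 g) (conj3 g')))
  (specialization q1 qk hL ePP idfun k0).
have {eC} := etrans (esym (congr2 (fun u v : k => u - v)
  (ev3_conj3 idfun _ _ 0 g) (ev3_conj3 idfun _ _ 0 g'))) eC.
rewrite tr_y0 /tr_x add0r /tr_y /= -/a -/b addrr_pchar2 //.
have -> : a ^+ q0 * a + b + a ^+ q0 * a + b = 0.
  by rewrite -addrA addrr_pchar2.
rewrite {1}/suz_w {1}/suz_u mul0r add0r expr0n /= expr0n eqn0Ngt h_gt0 /= sub0r.
move/eqP; rewrite oppr_eq0 expf_eq0 h_gt0 /= => /eqP w0.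
have [||ea eb] := suz_w_eq0 hq0 hq hk _ _ w0.
- by apply: (q_fixed_add hk hq0 hq); exact: traP.
- apply: (q_fixed_add hk hq0 hq); last exact: trbP.
  apply: (q_fixed_add hk hq0 hq).
    apply: (q_fixed_add hk hq0 hq); last exact: trbP.
    by apply: q_fixed_mul; [apply: q_fixed_exp|]; exact: traP.
  by apply: q_fixed_mul; [apply: q_fixed_exp|]; exact: traP.
have eaa : tra g = tra g'.
  by move/eqP: ea; rewrite addr_eq0 oppr_pchar2 // => /eqP.
apply: trans_group_inj => //; move: eb; rewrite -eaa -/a.
rewrite -!addrA addrCA [a ^+ q0 * a + (_ + _)]addrA addrr_pchar2 // add0r => /eqP.
by rewrite addr_eq0 oppr_pchar2 // => /eqP.
Qed.

Definition orbit_poly : {poly L} := \prod_g ('X - (trans g W_fun)%:P).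

Lemma trans_orbit_poly (F : trans_group -> L) g :
  (forall g', trans g (F g') = F (trans_mul hL g g')) ->
  map_poly (trans g) (\prod_g ('X - (F g)%:P)) = \prod_g ('X - (F g)%:P).
Proof.
move=> hF; rewrite rmorph_prod /= [RHS](reindex_inj (@trans_mul_inj _ _ _ _ _ _ _ _ _ _ _ _ _ hL g)) /=.
by apply: eq_bigr => g' _; rewrite rmorphB /= map_polyX map_polyC /= hF.
Qed.

Definition orbit_poly3 : {poly poly3 k} := \prod_g ('X - (conj3 g)%:P).

Lemma map_orbit_poly3 (S : comNzRingType) (lam' : {rmorphism k -> S}) x' y' z' :
  map_poly (ev3 lam' x' y' z') orbit_poly3 =
  \prod_g ('X - (ev3 lam' x' y' z' (conj3 g))%:P).
Proof.
rewrite rmorph_prod /=; apply: eq_bigr => g _.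
by rewrite rmorphB /= map_polyX map_polyC.
Qed.

Lemma map_orbit_poly3_L : map_poly evL orbit_poly3 = orbit_poly.
Proof. by rewrite map_orbit_poly3; apply: eq_bigr => g _; rewrite trans_W. Qed.

(** The coefficients are invariant under the translations, and polynomials in
    the coordinates of the curve; so they are polynomials in z. *)
Lemma orbit_poly_descends : exists f : {poly {poly k}},
  map_poly (pev lam z) f = orbit_poly.
Proof.
have e3 := map_orbit_poly3_L.
have /choice[c hc] i : exists c, orbit_poly`_i = pev lam z c.
  rewrite -e3 coef_map /=; apply: (@fixed_ev3 k e q0 q n hk hq0 hq L lam x y z hL) => g.
  rewrite -[evL _](coef_map evL) e3 -[LHS](coef_map (trans g)) /=.
  by rewrite /orbit_poly trans_orbit_poly // => g'; exact: trans_mulE.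
exists (\poly_(i < size orbit_poly) c i); apply/polyP => i.
rewrite coef_map coef_poly; case: ltnP => [_|le]; first by rewrite /= -hc.
by rewrite /= rmorph0 nth_default.
Qed.

Definition orbit_eq : {poly {poly k}} := sval (cid orbit_poly_descends).
Lemma map_orbit_eq : map_poly (pev lam z) orbit_eq = orbit_poly.
Proof. exact: (proj2_sig (cid orbit_poly_descends)). Qed.

Let pz_inj : injective (pev lam z).
Proof.
move=> c d /eqP; rewrite -subr_eq0 -rmorphB => /eqP/(pev_z_inj q1 qk hL)/eqP.
by rewrite subr_eq0 => /eqP.
Qed.

Lemma size_orbit_eq : size orbit_eq = (q ^ 2).+1.
Proof.
rewrite -(size_map_inj_poly pz_inj) ?rmorph0 // map_orbit_eq size_prod_index.
by rewrite card_trans_group.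
Qed.

Lemma monic_orbit_eq : orbit_eq \is monic.
Proof.
rewrite monicE; apply/eqP/pz_inj; rewrite -lead_coef_map_inj ?rmorph0 //.
by rewrite map_orbit_eq rmorph1; apply/eqP; rewrite -monicE monic_prod_XsubC.
Qed.

Lemma horner_map_orbit p g :
  (map_poly (pev lam z) p).[trans g W_fun] = trans g (ev2 lam W_fun z p).
Proof.
rewrite -pevE /ev2 (rmorph_pev W_fun p (g' := pev lam z)) //.
exact: trans_pev.
Qed.

Lemma ev2_orbit_eq : ev2 lam W_fun z orbit_eq = 0.
Proof.
rewrite -(trans_oneE hk hq0 hq hL (ev2 _ _ _ _)) -horner_map_orbit map_orbit_eq.
exact: root_prod_index.
Qed.

(** The q^2 conjugates of W are distinct, so the remainder of p modulo the
    orbit polynomial has too many roots. *)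
Lemma ev2_eq0 p : ev2 lam W_fun z p = 0 <-> exists c, p = c * orbit_eq.
Proof.
split=> [p0|[c ->]]; last by rewrite rmorphM /= ev2_orbit_eq mulr0.
exists (Pdiv.Ring.rdivp p orbit_eq).
have ep := Pdiv.RingMonic.rdivp_eq monic_orbit_eq p.
set r := Pdiv.Ring.rmodp p orbit_eq in ep.
suff r0 : r = 0 by rewrite {1}ep r0 addr0.
have si_ring : (size r <= q ^ 2)%N.
  by rewrite -ltnS -size_orbit_eq Pdiv.Ring.ltn_rmodp monic_neq0 // monic_orbit_eq.
have er : ev2 lam W_fun z r = 0.
  by move: p0; rewrite ep rmorphD rmorphM /= ev2_orbit_eq mulr0 add0r.
have : map_poly (pev lam z) r = 0.
  apply: (poly_small_roots trans_W_inj).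
    by rewrite card_trans_group (leq_trans (size_poly _ _)).
  by move=> g; rewrite horner_map_orbit er rmorph0.
move=> m0; apply/polyP => i; apply: pz_inj.
by rewrite -coef_map m0 !coef0 rmorph0.
Qed.

Lemma orbit_eq_origin :
  map_poly (pev idfun 0) orbit_eq = \prod_(g : trans_group) ('X - (suz_w q0 (tra g) (trb g) ^+ h)%:P).
Proof.
have -> : \prod_(g : trans_group) ('X - (suz_w q0 (tra g) (trb g) ^+ h)%:P)
    = map_poly (ev3 (idfun : {rmorphism k -> k}) 0 0 0) orbit_poly3.
  rewrite map_orbit_poly3; apply: eq_bigr => g _.
  by rewrite ev3_conj3 /tr_x tr_y0 add0r.
apply/polyP => i; rewrite !coef_map /=.
have e0 : evL (orbit_poly3`_i - cZ orbit_eq`_i) = 0.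
  rewrite (ev3B lam x y z) ev3_cZ; apply/eqP; rewrite subr_eq0; apply/eqP.
  have e1 : evL orbit_poly3`_i = (map_poly evL orbit_poly3)`_i by rewrite coef_map.
  have e2 : pev lam z orbit_eq`_i = (map_poly (pev lam z) orbit_eq)`_i by rewrite coef_map.
  by rewrite e1 e2 map_orbit_eq map_orbit_poly3_L.
have := etrans (esym (ev3B idfun 0 0 0 orbit_poly3`_i (cZ orbit_eq`_i)))
  (specialization q1 qk hL e0 idfun curve_eq_origin).
by rewrite ev3_cZ => /eqP; rewrite subr_eq0 => /eqP ->.
Qed.

(** The root 0 is simple: suz_w vanishes at no rational point but the origin. *)
Lemma orbit_eq_origin_simple : pev idfun 0 orbit_eq`_0 = 0 /\ pev idfun 0 orbit_eq`_1 != 0.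
Proof.
pose F (g : trans_group) := suz_w q0 (tra g) (trb g) ^+ h.
have F0 g : (F g == 0) = (g == trans_one hk hq0 hq).
  rewrite /F expf_eq0 h_gt0 /=; apply/eqP/eqP => [w0|->].
    have [ea eb] := suz_w_eq0 hq0 hq hk (traP g) (trbP g) w0.
    by apply: trans_group_inj; rewrite ?ea ?eb.
  by rewrite /tra /trb /= /suz_w mul0r add0r expr0n.
pose G : {poly k} := \prod_(g | g != trans_one hk hq0 hq) ('X - (F g)%:P).
have eG : map_poly (pev idfun 0) orbit_eq = 'X * G.
  rewrite orbit_eq_origin (bigD1 (trans_one hk hq0 hq)) //=.
  have /eqP -> : suz_w q0 (tra (trans_one hk hq0 hq)) (trb (trans_one hk hq0 hq)) ^+ h == 0.
    by rewrite F0.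
  by rewrite subr0.
rewrite -!coef_map eG !coefXM /=; split=> //.
rewrite -horner_coef0 horner_prod; apply/prodf_neq0 => g g1.
by rewrite hornerXsubC sub0r oppr_eq0 F0.
Qed.

End Orbit.

(** * The place at infinity and the degrees of the coefficients *)

Section Infinity.
Variables (k : closedFieldType) (e q0 q n h : nat).
Hypotheses (hk : 2%N \in [pchar k]) (hq0 : q0 = (2 ^ e)%N) (hq : q = (2 * q0 ^ 2)%N).
Hypothesis hm : (n * h)%N = (q - 2 * q0 + 1)%N.
Variables (L : fieldType) (lam : {rmorphism k -> L}) (x y z : L).
Hypothesis hL : curve_field q0 q n lam x y z.

Let L2 : 2%N \in [pchar L] := rmorph_char2 hk lam.
Let q1 : (1 < q)%N := suzuki_q_gt1 hq0 hq.
Let qk : q%:R = 0 :> k := suzuki_qk hk hq.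

Lemma z_neq0 : z != 0.
Proof.
apply/eqP => z0; have := @pev_z_inj _ _ _ _ q1 qk _ _ _ _ _ hL 'X.
by rewrite pevX => /(_ z0)/eqP; rewrite polyX_eq0.
Qed.

(** The element 1/z is transcendental, so it specializes to 0. *)
Lemma place_at_infinity : exists2 O, curve_point lam O & z^-1 \in max_ideal O.
Proof.
have inj (p : {poly k}) : pev lam z^-1 p = 0 -> p = 0.
  pose N := size p; pose r := \poly_(i < N) p`_(N - i.+1).
  move=> p0; suff r0 : r = 0.
    apply/polyP => i; rewrite coef0; case: (ltnP i N) => [lt|]; last exact: nth_default.
    have := congr1 (fun s : {poly k} => s`_(N - i.+1)) r0.
    rewrite coef0 coef_poly.
    have -> : (N - i.+1 < N)%N by rewrite ltn_subrL (leq_trans _ lt).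
    by rewrite subnSK // subKn // ltnW.
  apply: (@pev_z_inj _ _ _ _ q1 qk _ _ _ _ _ hL).
  rewrite (pev_coef _ _ (size_poly _ _)).
  have := congr1 (fun v => v * z ^+ N.-1) p0.
  rewrite mul0r (pev_coef _ _ (leqnn _)) mulr_suml => e0.
  rewrite -[RHS]e0 (reindex_inj rev_ord_inj) /=; apply: eq_bigr => i _.
  rewrite coef_poly ltn_subrL (leq_ltn_trans _ (ltn_ord i)) //=.
  rewrite subnSK // subKn; last exact: ltnW.
  rewrite -mulrA exprVn; congr (_ * _).
  have -> : N.-1 = (N - i.+1 + i)%N by have := ltn_ord i; rewrite /N; lia.
  by rewrite exprD mulrCA mulVf ?mulr1 // expf_neq0 // z_neq0.
have [|||| O [hO sO]] := @place_of_specialization k L lam {poly k} polyC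
  (pev lam z^-1) (pev idfun 0).
- by move=> c; rewrite /= pevC.
- by move=> c; rewrite /= pevC.
- by move=> p /inj ->; rewrite rmorph0.
- by exists 'X; rewrite /= !pevX rmorph0 invr_eq0 z_neq0.
exists O => //; have [_] := sO 'X; rewrite /= !pevX.
by rewrite rmorph0 subr0.
Qed.

Section PlaceAtInfinity.
Variables (O : {pred L}) (hO : curve_point lam O).
Hypothesis zinf : z^-1 \in max_ideal O.
Local Notation m := (max_ideal O).
Let t := z ^+ n.

Let t0 : t != 0. Proof. by rewrite expf_neq0 // z_neq0. Qed.
Let tV : t^-1 \in m.
Proof. by rewrite -exprVn (max_ideal_exp hO) // (n_gt0 hm). Qed.
Let tVO : t^-1 \in O. Proof. exact: max_idealW tV. Qed.
Let O1 : 1 \in O. Proof. by rewrite -(rmorph1 lam) (place_const hO). Qed.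
Let tratio i : (i <= q)%N -> t ^+ i / t ^+ q = t^-1 ^+ (q - i).
Proof.
move=> le; rewrite exprVn -{1}(subnK le) exprD invfM mulrCA divff ?mulr1 //.
by rewrite expf_neq0.
Qed.
Let t1q : t / t ^+ q \in m.
Proof.
by rewrite -{1}(expr1 t) tratio ?(max_ideal_exp hO) ?subn_gt0 // ltnW.
Qed.

(** If v were not in the valuation ring, v^q would dominate a v + b. *)
Lemma small_of_frobenius (v a b : L) : v ^+ q = a * v + b -> a \in m -> b \in m ->
  v \in m.
Proof.
move=> ev3 ma mb; have q_gt0 : (0 < q)%N by rewrite ltnW.
have Ov : v \in O.
  apply: contraT => Ov; have mv := notin_place_inv hO Ov.
  have v0 : v != 0.
    by apply: contraNneq Ov => ->; rewrite (max_idealW (max_ideal0 hO)).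
  have := congr1 (fun w => w * v^-1 ^+ q) ev3.
  rewrite {1}exprVn divff ?expf_neq0 // => e1.
  have := max_ideal1 hO; rewrite e1 mulrDl; apply: contraTT => _.
  rewrite negbK (max_ideal_add hO) //.
    have -> : v^-1 ^+ q = v^-1 * v^-1 ^+ q.-1 by rewrite -exprS prednK.
    rewrite mulrA mulfK //.
    by rewrite (max_ideal_mulr hO) // (place_exp hO) // max_idealW.
  by rewrite (max_ideal_mulr hO) // (place_exp hO) // max_idealW.
apply: (max_ideal_root hO q_gt0); rewrite ev3 (max_ideal_add hO) //.
by rewrite (max_ideal_mulr hO).
Qed.

Section Triple.
Variables (x' y' : L) (hxy : curve_eq q0 q n x' y' z).

Let hx : x' ^+ q = x' + t.
Proof. by case: hxy => _ ex; rewrite /t -ex addrCA addrr_pchar2 // addr0. Qed.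
Let hy : y' ^+ q = y' + x' ^+ q0 * t.
Proof. by case: hxy => ey ex; rewrite /t -ex -ey addrCA addrr_pchar2 // addr0. Qed.

Lemma x_small : x' / t \in m.
Proof.
apply: (small_of_frobenius (a := t / t ^+ q) (b := t / t ^+ q)) => //.
rewrite expr_div_n hx mulrDl; congr (_ + _).
by rewrite [RHS]mulrC mulrA divfK.
Qed.

Lemma y_small : y' / t \in m.
Proof.
apply: (small_of_frobenius (a := t / t ^+ q)
  (b := (x' / t) ^+ q0 * (t ^+ q0.+1 / t ^+ q))) => //.
  rewrite expr_div_n hy mulrDl; congr (_ + _).
    by rewrite [RHS]mulrC mulrA divfK.
  rewrite expr_div_n exprS; have tq00 : t ^+ q0 != 0 by rewrite expf_neq0.
  have tq_n0 : t ^+ q != 0 by rewrite expf_neq0.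
  move: (t ^+ q0) (t ^+ q) (x' ^+ q0) tq00 tq_n0 => a b c a0 b0.
  by field; rewrite a0 b0.
apply: (max_ideal_mulr hO).
  by rewrite (max_ideal_exp hO) // ?x_small // (q0_gt0 hq0).
rewrite tratio ?(place_exp hO) //.
by rewrite (leq_trans _ (leq_2q0_q hq0 hq)) // mul2n -addnn -addn1 leq_add2l (q0_gt0 hq0).
Qed.

(** The terms of w^(q^2) other than t^(q + 2 q0 + 1) are small compared with it. *)
Lemma suz_w_leading :
  suz_w q0 x' y' ^+ (q ^ 2) / t ^+ (q + 2 * q0 + 1) - 1 \in m.
Proof.
have X := x_small; have Y := y_small.
have q2 : (0 < 2 * q0)%N by rewrite muln_gt0 (q0_gt0 hq0).
have XT : x' ^+ (2 * q0) / t ^+ (2 * q0) \in m.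
  by rewrite -expr_div_n (max_ideal_exp hO).
have YT : y' ^+ (2 * q0) / t ^+ (2 * q0) \in m.
  by rewrite -expr_div_n (max_ideal_exp hO).
have tqV : (t ^+ q)^-1 \in O by rewrite -exprVn (place_exp hO).
have tTV : (t ^+ (2 * q0))^-1 \in O by rewrite -exprVn (place_exp hO).
rewrite (suz_w_frob2 hq0 hq L2 hx hy).
have -> : t ^+ (q + 2 * q0 + 1) = t * t ^+ (2 * q0) * t ^+ q.
  by rewrite !exprD expr1; ring.
rewrite {1}/suz_w {1}/suz_u.
set T := t ^+ (2 * q0) in XT YT tTV *; have tq1 := t1q.
set tq := t ^+ q in tq1 tqV *.
set p2 := x' ^+ (2 * q0) in XT *; set r2 := y' ^+ (2 * q0) in YT *.
have T0 : T != 0 by rewrite expf_neq0.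
have tq0 : tq != 0 by rewrite expf_neq0.
have -> : (x' * (p2 * x' + r2) + y' ^+ 2 + r2 * (t + tq) + x' * T * tq + t * T * tq)
    / (t * T * tq) - 1
  = (x' / t) * ((p2 / T) * (x' / t) * (t / tq)) + (x' / t) * ((r2 / T) * tq^-1)
    + (y' / t) * ((y' / t) * (t / tq) * T^-1) + (r2 / T) * (tq^-1 + t^-1) + x' / t.
  by field; rewrite t0 T0 tq0.
have OX := max_idealW X; have OY := max_idealW Y.
have OXT := max_idealW XT; have OYT := max_idealW YT; have Otq := max_idealW tq1.
repeat first [ done | apply: (max_ideal_add hO) | apply: (max_ideal_mulr hO) ];
  repeat first [ done | apply: (place_add hO) | apply: (place_mul hO) ].
Qed.

Lemma one_units_mul a b : a - 1 \in m -> b - 1 \in m -> a * b - 1 \in m.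
Proof.
move=> ma mb; have Ob : b \in O.
  by rewrite -(subrK 1 b) (place_add hO) // max_idealW.
have -> : a * b - 1 = (a - 1) * b + (b - 1) by ring.
by rewrite (max_ideal_add hO) // (max_ideal_mulr hO).
Qed.

Lemma one_units_exp a i : a - 1 \in m -> a ^+ i - 1 \in m.
Proof.
move=> ma; elim: i => [|i IH]; first by rewrite expr0 subrr (max_ideal0 hO).
by rewrite exprS one_units_mul.
Qed.

Lemma W_leading :
  (suz_w q0 x' y' ^+ h) ^+ (q ^ 2) / z ^+ (q ^ 2 + 1) - 1 \in m.
Proof.
have -> : z ^+ (q ^ 2 + 1) = (t ^+ (q + 2 * q0 + 1)) ^+ h.
  rewrite -(suzuki_factorization hq0 hq) -hm !exprM -/t.
  by rewrite exprAC.
by rewrite exprAC -expr_div_n one_units_exp // suz_w_leading.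
Qed.
End Triple.

Lemma one_unit_place a : a - 1 \in m -> a \in O.
Proof. by move=> ma; rewrite -(subrK 1 a) (place_add hO) // max_idealW. Qed.

Lemma one_unitV a : a - 1 \in m -> a != 0 /\ a^-1 \in O.
Proof.
move=> ma; apply: (unit_residue hO (c := 1)); first exact: oner_neq0.
by rewrite rmorph1.
Qed.

Let z_exp i j : z ^+ i / z ^+ j \in O -> (i <= j)%N.
Proof.
move=> Oij; rewrite leqNgt; apply/negP => lt.
have := max_ideal_exp hO (n := i - j) _ zinf; rewrite subn_gt0 lt => /(_ isT) h1.
have := max_ideal_mulr hO h1 Oij.
rewrite -{2}(subnK (ltnW lt)) exprD mulfK ?expf_neq0 ?z_neq0 //.
by rewrite exprVn mulVf ?expf_neq0 ?z_neq0 // (negbTE (max_ideal1 hO)).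
Qed.

Lemma pev_leading (c : {poly k}) : c != 0 ->
  pev lam z c / z ^+ (size c).-1 - lam (lead_coef c) \in m.
Proof.
move=> c0; have s0 : (0 < size c)%N by rewrite size_poly_gt0.
rewrite (pev_coef _ _ (leqnn _)) -(prednK s0) big_ord_recr /= mulrDl.
rewrite mulfK ?expf_neq0 ?z_neq0 // -lead_coefE addrK mulr_suml.
apply: (big_ind (fun v => v \in m)).
- exact: max_ideal0 hO.
- exact: max_ideal_add hO.
move=> i _; rewrite -mulrA; apply: (max_ideal_mul hO); first exact: place_const hO _.
rewrite -{2}(subnK (ltnW (ltn_ord i))) exprD invfM mulrCA divff ?expf_neq0 ?z_neq0 //.
by rewrite mulr1 -exprVn (max_ideal_exp hO) // subn_gt0 ltn_ord.
Qed.

Lemma pev_degree_le (c : {poly k}) N j : c != 0 ->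
  pev lam z c ^+ N / z ^+ j \in O -> (N * (size c).-1 <= j)%N.
Proof.
move=> c0 Oc; apply: z_exp.
have lc : lead_coef c != 0 by rewrite lead_coef_eq0.
have [u0 uO] := unit_residue hO lc (pev_leading c0).
set d := (size c).-1 in u0 uO *.
have := place_mul hO Oc (place_exp hO N uO).
have -> // : pev lam z c ^+ N / z ^+ j * (pev lam z c / z ^+ d)^-1 ^+ N
    = z ^+ (N * d) / z ^+ j.
have pc0 : pev lam z c != 0 by apply: contraNneq u0 => ->; rewrite mul0r.
rewrite exprVn expr_div_n mulnC exprM.
have h1 : pev lam z c ^+ N != 0 by rewrite expf_neq0.
have h2 : (z ^+ d) ^+ N != 0 by rewrite !expf_neq0 ?z_neq0.
have h3 : z ^+ j != 0 by rewrite expf_neq0 ?z_neq0.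
move: (pev lam z c ^+ N) ((z ^+ d) ^+ N) (z ^+ j) h1 h2 h3 => a b c' a0 b0 c'0.
by field; rewrite a0 b0 c'0.
Qed.

Lemma pev_degree_eq (c : {poly k}) N j : c != 0 ->
  pev lam z c ^+ N / z ^+ j - 1 \in m -> (N * (size c).-1)%N = j.
Proof.
move=> c0 mc; apply/eqP; rewrite eqn_leq pev_degree_le ?one_unit_place //=.
apply: z_exp; set d := (size c).-1.
have [_ h1] := one_unitV mc.
have := max_idealW (pev_leading c0) => h2.
have Ou : pev lam z c / z ^+ d \in O.
  by rewrite -(subrK (lam (lead_coef c)) (_ / _)) (place_add hO) // (place_const hO).
have := place_mul hO h1 (place_exp hO N Ou).
have pc0 : pev lam z c != 0.
  apply: contraNneq c0 => /(@pev_z_inj _ _ _ _ q1 qk _ _ _ _ _ hL) -> //.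
rewrite expr_div_n mulnC exprM.
have h4 : pev lam z c ^+ N != 0 by rewrite expf_neq0.
have h5 : (z ^+ d) ^+ N != 0 by rewrite !expf_neq0 ?z_neq0.
have h6 : z ^+ j != 0 by rewrite expf_neq0 ?z_neq0.
suff -> : (pev lam z c ^+ N / z ^+ j)^-1 * (pev lam z c ^+ N / (z ^+ d) ^+ N)
  = z ^+ j / (z ^+ d) ^+ N by [].
move: (pev lam z c ^+ N) ((z ^+ d) ^+ N) (z ^+ j) h4 h5 h6 => a b c' a0 b0 c'0.
by field; rewrite a0 b0 c'0.
Qed.

(** A coefficient of a product of N factors T - r is homogeneous in the
    roots, so it inherits their order of growth. *)
Lemma coef_prod_growth (I : Type) (s : seq I) (r : I -> L) (G : L) : G != 0 ->
  (forall i, r i ^+ (q ^ 2) / G \in O) -> forall j,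
  (\prod_(i <- s) ('X - (r i)%:P))`_j ^+ (q ^ 2) * G ^+ j / G ^+ size s \in O.
Proof.
move=> G0 hr; have N0 : (q ^ 2 == 0)%N = false.
  by rewrite expn_eq0 eqn0Ngt ltnW.
elim: s => [|i s IH] j.
  rewrite big_nil coef1 /= expr0 divr1; case: j => [|j].
    by rewrite expr1n mul1r expr0.
  by rewrite expr0n N0 mul0r (max_idealW (max_ideal0 hO)).
rewrite big_cons mulrBl coefB coefXM coefCM /= oppr_pchar2 //.
rewrite (frob_q2 hq0 hq L2) !mulrDl (place_add hO) //; last first.
  rewrite exprMn exprS invfM.
  have -> : forall a b c d : L, a * b * c * (G^-1 * d) = (a / G) * (b * c * d).
    by move=> a b c d; ring.
  exact: (place_mul hO).
case: j => [|j] /=.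
  by rewrite expr0n N0 !mul0r (max_idealW (max_ideal0 hO)).
rewrite !exprS invfM.
have -> : forall a b d : L, a * (G * b) * (G^-1 * d) = (a * b * d) * (G / G).
  by move=> a b d; ring.
by rewrite divff // mulr1.
Qed.

Lemma prod_growth (I : Type) (s : seq I) (r : I -> L) (G : L) :
  (forall i, r i ^+ (q ^ 2) / G - 1 \in m) ->
  (\prod_(i <- s) r i) ^+ (q ^ 2) / G ^+ size s - 1 \in m.
Proof.
move=> hr; elim: s => [|i s IH].
  by rewrite big_nil expr1n expr0 divr1 subrr (max_ideal0 hO).
by rewrite big_cons exprMn exprS -mulf_div one_units_mul.
Qed.
End PlaceAtInfinity.

Local Notation trans_group := (trans_group hk hq0 hq).
Local Notation trans := (@trans k e q0 q n hk hq0 hq L lam x y z hL).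

Lemma trans_W_leading O (hO : curve_point lam O) (zinf : z^-1 \in max_ideal O) g :
  trans g (W_fun q0 h x y) ^+ (q ^ 2) / z ^+ (q ^ 2 + 1) - 1 \in max_ideal O.
Proof.
rewrite trans_W ev3_conj3; apply: W_leading => //.
apply: (curve_eq_tr hk hq0 hq); [exact: traP|exact: trbP|].
by case: hL.
Qed.

Local Notation orbit_eq := (@orbit_eq k e q0 q n h hk hq0 hq L lam x y z hL).

(** The roots grow like z^((q^2 + 1) / q^2), so the coefficient of T^i grows at
    most like z^((q^2 - i) + (q^2 - i) / q^2), and the constant coefficient
    exactly so. *)
Lemma orbit_eq_degrees : size (orbit_eq`_0)%R = (q ^ 2).+2 /\
  forall i, (0 < i <= q ^ 2)%N -> (i + size (orbit_eq`_i)%R <= (q ^ 2).+1)%N.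
Proof.
have [O hO zinf] := place_at_infinity.
have N_gt0 : (0 < q ^ 2)%N by rewrite expn_gt0 ltnW.
have G0 : z ^+ (q ^ 2 + 1) != 0 by rewrite expf_neq0 // z_neq0.
have sE : size (index_enum trans_group) = (q ^ 2)%N.
  by rewrite /index_enum -enumT -cardE card_trans_group.
have cE i : pev lam z orbit_eq`_i = (orbit_poly h hk hq0 hq hL)`_i by rewrite -map_orbit_eq coef_map.
have grow i : (i <= q ^ 2)%N ->
    pev lam z orbit_eq`_i ^+ (q ^ 2) / z ^+ ((q ^ 2 + 1) * (q ^ 2 - i)) \in O.
  move=> le; have := coef_prod_growth hO (index_enum trans_group)
    (r := fun g => trans g (W_fun q0 h x y)) G0 _ i.
  rewrite sE cE /orbit_poly => /(_ _) h1.
  have {h1} := h1 (fun g => one_unit_place hO (trans_W_leading hO zinf g)).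
  have -> : (z ^+ (q ^ 2 + 1)) ^+ (q ^ 2)
      = (z ^+ (q ^ 2 + 1)) ^+ (q ^ 2 - i) * (z ^+ (q ^ 2 + 1)) ^+ i.
    by rewrite -exprD subnK.
  have canc (a b c : L) : c != 0 -> a * c / (b * c) = a / b.
    by move=> c0; rewrite -mulf_div divff ?mulr1.
  by rewrite (canc _ _ _ (expf_neq0 i G0)) -exprM.
have f0 : pev lam z orbit_eq`_0 = \prod_g trans g (W_fun q0 h x y).
  rewrite cE -horner_coef0 horner_prod; apply: eq_bigr => g _.
  by rewrite hornerXsubC sub0r oppr_pchar2.
have lead : pev lam z orbit_eq`_0 ^+ (q ^ 2) / z ^+ ((q ^ 2 + 1) * (q ^ 2)) - 1
    \in max_ideal O.
  have := prod_growth hO (index_enum trans_group) (fun g => trans_W_leading hO zinf g).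
  by rewrite sE -exprM f0.
have c0 : orbit_eq`_0 != 0.
  apply/eqP => c0; have [] := one_unitV hO lead.
  by rewrite c0 rmorph0 expr0n eqn0Ngt N_gt0 /= mul0r eqxx.
split.
  have := pev_degree_eq hO zinf c0 lead; rewrite mulnC => /eqP.
  rewrite eqn_pmul2r // => /eqP dE.
  by rewrite -(prednK (n := size _)) ?size_poly_gt0 // dE addn1.
move=> i /andP[i_gt0 le].
have [->|ci] := eqVneq orbit_eq`_i 0; first by rewrite size_poly0 addn0 leqW.
have := pev_degree_le hO zinf ci (grow i le).
have := size_poly_gt0 orbit_eq`_i; rewrite ci; move: (size _) (q ^ 2)%N le i_gt0 => s N.
case: s => // d; rewrite /= addnS ltnS => le i_gt0 _ dN.
rewrite leqNgt; apply/negP => lt; move: dN; rewrite leqNgt => /negP; apply.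
have : (N * (N - i).+1 <= N * d)%N by rewrite leq_mul2l; lia.
move=> h1; apply: leq_trans h1; nia.
Qed.
End Infinity.

(** * Forms in three variables *)

Definition o0 : 'I_3 := @Ordinal 3 0 isT.
Definition o1 : 'I_3 := @Ordinal 3 1 isT.
Definition o2 : 'I_3 := @Ordinal 3 2 isT.

Lemma ord3_ind (P : 'I_3 -> Prop) : P o0 -> P o1 -> P o2 -> forall i, P i.
Proof.
move=> h0 h1 h2 [[|[|[|//]]] h].
- by rewrite (_ : Ordinal h = o0) //; exact: val_inj.
- by rewrite (_ : Ordinal h = o1) //; exact: val_inj.
- by rewrite (_ : Ordinal h = o2) //; exact: val_inj.
Qed.

Definition vec3 (T : Type) (a b c : T) : 'rV[T]_3 :=
  \row_(i < 3) tnth [tuple a; b; c] i.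

Section Vec3.
Variables (T : Type) (a b c : T).
Lemma vec30 : vec3 a b c 0 o0 = a. Proof. by rewrite mxE. Qed.
Lemma vec31 : vec3 a b c 0 o1 = b. Proof. by rewrite mxE. Qed.
Lemma vec32 : vec3 a b c 0 o2 = c. Proof. by rewrite mxE. Qed.
End Vec3.

Lemma vec3E (T : Type) (v : 'rV[T]_3) : v = vec3 (v 0 o0) (v 0 o1) (v 0 o2).
Proof.
apply/matrixP => i j; rewrite (ord1 i); move: j; apply: ord3_ind.
- by rewrite vec30.
- by rewrite vec31.
- by rewrite vec32.
Qed.

Section MpolyEvaluation.
Variable (k : fieldType).

Lemma rmorph_mmap (n : nat) (S S' : comNzRingType) (lam : k -> S) (lam' : k -> S')
    (v : 'I_n -> S) (v' : 'I_n -> S') (g : {rmorphism S -> S'}) (p : {mpoly k[n]}) :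
  (forall c, g (lam c) = lam' c) -> (forall i, g (v i) = v' i) ->
  g (mmap lam v p) = mmap lam' v' p.
Proof.
move=> gl gv; rewrite /mmap rmorph_sum /=; apply: eq_bigr => m _.
rewrite rmorphM gl /mmap1 rmorph_prod; congr (_ * _); apply: eq_bigr => i _.
by rewrite rmorphXn gv.
Qed.

Lemma eq_mmap (n : nat) (S : comNzRingType) (lam : k -> S) (v v' : 'I_n -> S)
    (p : {mpoly k[n]}) : (forall i, v i = v' i) -> mmap lam v p = mmap lam v' p.
Proof. by move=> ev3; exact: (rmorph_mmap (g := idfun)). Qed.

Lemma mmap_homog (n d : nat) (S : comNzRingType) (lam : k -> S) (v v' : 'I_n -> S)
    (c : S) (p : {mpoly k[n]}) : p \is d.-homog -> (forall i, v' i = c * v i) ->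
  mmap lam v' p = c ^+ d * mmap lam v p.
Proof.
move=> hp ev3; rewrite /mmap mulr_sumr; apply: eq_big_seq => m mp.
rewrite mulrCA; congr (_ * _); rewrite /mmap1.
under eq_bigr do rewrite ev3 exprMn.
by rewrite big_split /= prodrXr -mdegE (dhomog_mf hp mp).
Qed.

Lemma mmap_congr (E : fieldType) (iota : {rmorphism k -> E}) (O : {pred E})
    (n : nat) (v v' : 'I_n -> E) (p : {mpoly k[n]}) : curve_point iota O ->
  (forall i, v i \in O) -> (forall i, v' i \in O) ->
  (forall i, v i - v' i \in max_ideal O) ->
  mmap iota v p - mmap iota v' p \in max_ideal O.
Proof.
move=> hO Ov Ov' vv'.
have O1 : 1 \in O by rewrite -(rmorph1 iota) (place_const hO).
have O0 := max_idealW (max_ideal0 hO).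
have mulc a b a' b' : a \in O -> b' \in O -> a - a' \in max_ideal O ->
    b - b' \in max_ideal O -> a * b - a' * b' \in max_ideal O.
  move=> Oa Ob' ha hb; have -> : a * b - a' * b' = a * (b - b') + (a - a') * b' by ring.
  apply: (max_ideal_add hO); first exact: (max_ideal_mul hO).
  exact: (max_ideal_mulr hO).
have Oprod (F : 'I_n -> E) : (forall i, F i \in O) -> \prod_i F i \in O.
  move=> OF; apply: (big_ind (fun a => a \in O)) => //; exact: place_mul hO.
have powc i j : v i ^+ j - v' i ^+ j \in max_ideal O.
  elim: j => [|j IH]; first by rewrite !expr0 subrr (max_ideal0 hO).
  by rewrite !exprS mulc // (place_exp hO).
rewrite /mmap -sumrB.
apply: (big_ind (fun a => a \in max_ideal O)).
- exact: max_ideal0 hO.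
- exact: max_ideal_add hO.
move=> m _; rewrite -mulrBr (max_ideal_mul hO) ?(place_const hO) // /mmap1.
suff [] : \prod_i v i ^+ m i - \prod_i v' i ^+ m i \in max_ideal O /\
    \prod_i v i ^+ m i \in O /\ \prod_i v' i ^+ m i \in O by [].
apply: (big_ind2 (fun a a' => a - a' \in max_ideal O /\ a \in O /\ a' \in O)).
- by rewrite subrr (max_ideal0 hO).
- move=> a a' b b' [h1 [h2 h3]] [h4 [h5 h6]].
  by rewrite mulc // !(place_mul hO).
- by move=> i _; rewrite powc !(place_exp hO).
Qed.

(** Taylor expansion to first order along a coordinate line. *)
Lemma mderiv_line (n : nat) (v : 'I_n -> k) (i : 'I_n) (p : {mpoly k[n]}) :
  let w j := (v j)%:P + (i == j)%:R *: 'X in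
  (mmap polyC w p)`_0 = p.@[v] /\ (mmap polyC w p)`_1 = (p^`M(i)).@[v].
Proof.
move=> w; pose D (p : {mpoly k[n]}) := (mmap polyC w p)`_0 = p.@[v] /\
  (mmap polyC w p)`_1 = (p^`M(i)).@[v].
have D0 : D 0 by rewrite /D mderiv0 !mmap0 !coef0 meval0.
have DD p1 p2 : D p1 -> D p2 -> D (p1 + p2).
  by move=> [h1 h2] [h3 h4]; rewrite /D mderivD !mmapD !coefD !mevalD h1 h2 h3 h4.
have DM p1 p2 : D p1 -> D p2 -> D (p1 * p2).
  move=> [h1 h2] [h3 h4]; rewrite /D mderivM !rmorphM !coefM /=.
  rewrite !big_ord_recl !big_ord0 /= !addr0 h1 h3 h2 h4; split=> //.
  by rewrite rmorphD !rmorphM addrC.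
have DC c : D c%:MP by rewrite /D mderivC !mmapC !coefC /= mevalC meval0.
have DX j : D 'X_j.
  rewrite /D mmapX mmap1U mderivX mevalZ mevalXU mnm1E [j == i]eq_sym /w.
  rewrite !coefD !coefC !coefZ !coefX /= mulr0 addr0 add0r mulr1; split=> //.
  case: eqP => [->|_]; last by rewrite mul0r.
  have -> : (U_(j) - U_(j) = 0 :> 'X_{1..n})%MM.
    by apply/mnmP => l; rewrite mnmBE subnn mnm0E.
  by rewrite mpolyX0 [X in _ * X]rmorph1 mulr1.
elim/mpolyind: p => [//|c m p _ _ Dp]; apply: (DD) => //.
rewrite -mul_mpolyC; apply: (DM) => //; rewrite mpolyXE_id.
apply: (big_ind D) => [||j _]; [by rewrite -mpolyC1|exact: (DM)|].
by elim: (m j) => [|a IH]; rewrite ?expr0 -?mpolyC1 // exprS; apply: (DM).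
Qed.


Definition homogenize (D : nat) (p : {poly {poly k}}) : {mpoly k[3]} :=
  \sum_(i < size p) \sum_(l < size (p`_i)%R)
    (p`_i`_l)%:MP * ('X_o0 ^+ (D - i - l) * 'X_o1 ^+ i * 'X_o2 ^+ l).

Lemma homogenize_homog D (p : {poly {poly k}}) :
  (forall i l, (i < size p)%N -> (l < size (p`_i)%R)%N -> (i + l <= D)%N) ->
  homogenize D p \is D.-homog.
Proof.
move=> hD; rewrite /homogenize; apply: rpred_sum => i _; apply: rpred_sum => l _.
have le := hD _ _ (ltn_ord i) (ltn_ord l).
rewrite mul_mpolyC; apply: dhomogZ.
have hX j s : ('X_j : {mpoly k[3]}) ^+ s \is s.-homog.
  by rewrite -{2}(mul1n s); apply: dhomogMn; rewrite dhomogX /= mdeg1.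
have := dhomogM (dhomogM (hX o0 (D - i - l)%N) (hX o1 i)) (hX o2 l).
by have -> : (D - i - l + i + l)%N = D by lia.
Qed.

Lemma mmap_homogenize (S : comNzRingType) (lam : {rmorphism k -> S})
    (v : 'I_3 -> S) D (p : {poly {poly k}}) :
  mmap lam v (homogenize D p) = \sum_(i < size p) \sum_(l < size (p`_i)%R)
    lam p`_i`_l * (v o0 ^+ (D - i - l) * v o1 ^+ i * v o2 ^+ l).
Proof.
rewrite /homogenize rmorph_sum; apply: eq_bigr => i _.
rewrite rmorph_sum; apply: eq_bigr => l _.
by rewrite !rmorphM !rmorphXn /= mmapC !mmapX !mmap1U.
Qed.

Lemma mmap_homogenize1 (S : comNzRingType) (lam : {rmorphism k -> S})
    (v : 'I_3 -> S) D (p : {poly {poly k}}) : v o0 = 1 ->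
  mmap lam v (homogenize D p) = ev2 lam (v o1) (v o2) p.
Proof.
move=> v0; rewrite mmap_homogenize /ev2 (pev_coef _ _ (leqnn _)).
apply: eq_bigr => i _; rewrite /= (pev_coef _ _ (leqnn _)) mulr_suml.
apply: eq_bigr => l _; rewrite v0 expr1n mul1r.
by rewrite [v o1 ^+ i * _]mulrC mulrA.
Qed.

Definition cst2 (c : k) : {poly {poly k}} := c%:P%:P.
Fact cst2_zmod : zmod_morphism cst2.
Proof. by move=> a b; rewrite /cst2 !polyCB. Qed.
Fact cst2_monoid : monoid_morphism cst2.
Proof. by split=> [|a b]; rewrite /cst2 ?polyCM. Qed.
HB.instance Definition _ := GRing.isZmodMorphism.Build k {poly {poly k}} cst2 cst2_zmod.
HB.instance Definition _ :=
  GRing.isMonoidMorphism.Build k {poly {poly k}} cst2 cst2_monoid.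

Definition dehomogenize (p : {mpoly k[3]}) : {poly {poly k}} :=
  mmap cst2 (tnth [tuple 1; 'X; 'X%:P]) p.

Lemma dehomogenizeM p p' :
  dehomogenize (p * p') = dehomogenize p * dehomogenize p'.
Proof. by rewrite /dehomogenize rmorphM. Qed.

Lemma ev2_dehomogenize (S : comNzRingType) (lam : {rmorphism k -> S})
    (W Z : S) (p : {mpoly k[3]}) :
  ev2 lam W Z (dehomogenize p) = mmap lam (vec3 1 W Z 0) p.
Proof.
apply: (@rmorph_mmap 3 {poly {poly k}} S cst2 lam _ (vec3 1 W Z 0)
  (ev2 lam W Z) p) => [c|].
  by rewrite /= /ev2 pevC /= pevC.
apply: ord3_ind; rewrite ?vec30 ?vec31 ?vec32 /tnth /=.
- exact: rmorph1.
- by rewrite /ev2 pevX.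
- by rewrite /ev2 pevC /= pevX.
Qed.

Definition swap01 : {mpoly k[3]} -> {mpoly k[3]} := msym (tperm o0 o1).

Lemma swap01_homog d (p : {mpoly k[3]}) : p \is d.-homog -> swap01 p \is d.-homog.
Proof. by rewrite !homog_piE /swap01 -msym_pihomog => /eqP ->. Qed.

Lemma mmap_swap01 (S : comNzRingType) (lam : {rmorphism k -> S}) (a b c : S)
    (p : {mpoly k[3]}) :
  mmap lam (vec3 a b c 0) (swap01 p) = mmap lam (vec3 b a c 0) p.
Proof.
rewrite /swap01 /msym; apply: (rmorph_mmap (g := mmap lam (vec3 a b c 0))) => [x|i].
  by rewrite /= mmapC.
rewrite /= mmapX mmap1U; move: i; apply: ord3_ind.
- by rewrite tpermL vec31 vec30.
- by rewrite tpermR vec31 vec30.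
- by rewrite tpermD // !vec32.
Qed.

End MpolyEvaluation.

Section ScalingMap.
Variable k : fieldType.

Definition cst_scale (c : k) : {poly {mpoly k[3]}} := (c%:MP)%:P.
Fact cst_scale_zmod : zmod_morphism cst_scale.
Proof. by move=> a b; rewrite /cst_scale mpolyCB polyCB. Qed.
Fact cst_scale_monoid : monoid_morphism cst_scale.
Proof. by split=> [|a b]; rewrite /cst_scale ?mpolyC1 // mpolyCM polyCM. Qed.
HB.instance Definition _ :=
  GRing.isZmodMorphism.Build k {poly {mpoly k[3]}} cst_scale cst_scale_zmod.
HB.instance Definition _ :=
  GRing.isMonoidMorphism.Build k {poly {mpoly k[3]}} cst_scale cst_scale_monoid.

(** The homogeneous p are those whose image is a monomial in the new variable;
    as the factors of a monomial are monomials, the factors of a form are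
    forms. *)
Definition scale (p : {mpoly k[3]}) : {poly {mpoly k[3]}} :=
  mmap cst_scale (fun i => 'X * ('X_i)%:P) p.

Lemma scaleM p p' : scale (p * p') = scale p * scale p'.
Proof. by rewrite /scale rmorphM. Qed.

Lemma mmap_id (p : {mpoly k[3]}) :
  mmap (@mpolyC 3 k) (fun i => 'X_i) p = p.
Proof.
rewrite [RHS]mpolyE /mmap; apply: eq_bigr => m _.
by rewrite mmap1_id mul_mpolyC.
Qed.

Lemma scale_homog d p : p \is d.-homog -> scale p = 'X^d * p%:P.
Proof.
move=> hp; rewrite /scale (mmap_homog (v := fun i => ('X_i)%:P) (c := 'X) _ hp) //.
congr (_ * _); rewrite -[in RHS](mmap_id p); apply/esym.
exact: (@rmorph_mmap k 3 {mpoly k[3]} {poly {mpoly k[3]}} (@mpolyC 3 k) cst_scale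
  _ _ (@polyC {mpoly k[3]}) p).
Qed.

Lemma scale_horner (p : {mpoly k[3]}) (s : {mpoly k[3]}) :
  (scale p).[s] = mmap (@mpolyC 3 k) (fun i => s * 'X_i) p.
Proof.
apply: (@rmorph_mmap k 3 {poly {mpoly k[3]}} {mpoly k[3]} cst_scale (@mpolyC 3 k)
  _ _ (horner_eval s) p) => [c|i]; rewrite /= /horner_eval ?hornerC //.
by rewrite hornerM hornerX hornerC.
Qed.

Lemma scale_point (p : {mpoly k[3]}) (v : 'I_3 -> k) (s : k) :
  pev (meval v) s (scale p) = mmap idfun (fun i => s * v i) p.
Proof.
apply: (@rmorph_mmap k 3 {poly {mpoly k[3]}} k cst_scale idfun _ _
  (pev (meval v) s) p) => [c|i] /=.
  by rewrite /cst_scale pevC /= mevalC.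
by rewrite rmorphM /= pevX pevC /= mevalXU.
Qed.
End ScalingMap.

Lemma monomial_factor (A : idomainType) (d : nat) (c : A) (p p' : {poly A}) :
  c != 0 -> p * p' = 'X^d * c%:P -> exists b j, p' = b%:P * 'X^j.
Proof.
move=> c0; elim: d p p' => [|d IH] p p'.
  rewrite expr0 mul1r => e; have pp0 : p * p' != 0 by rewrite e polyC_eq0.
  have p0 : p != 0 by apply: contraNneq pp0 => ->; rewrite mul0r.
  have p'0 : p' != 0 by apply: contraNneq pp0 => ->; rewrite mulr0.
  have := congr1 (fun r : {poly A} => size r) e.
  rewrite size_mul // size_polyC c0 => sz.
  have : (size p' <= 1)%N.
    by move: sz; rewrite -(prednK (n := size p)) ?size_poly_gt0 //; lia.
  by move=> /size1_polyC ->; exists p'`_0, 0%N; rewrite expr0 mulr1.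
move=> e; have shift (r : {poly A}) : r`_0 = 0 -> exists r', r = r' * 'X.
  move=> r0; have /factor_theorem[r' ->] : root r 0 by rewrite /root horner_coef0 r0.
  by exists r'; rewrite subr0.
have : (p * p')`_0 == 0 by rewrite e coef0M coefXn mul0r.
rewrite coef0M mulf_eq0 => /orP[|] /eqP /shift[r er].
  apply: (IH r); apply: (mulIf (negbT (polyX_eq0 A))).
  by rewrite mulrAC -er e exprSr mulrAC.
have [b [j ej]] : exists b j, r = b%:P * 'X^j.
  apply: (IH p); apply: (mulIf (negbT (polyX_eq0 A))).
  by rewrite -mulrA -er e exprSr mulrAC.
by exists b, j.+1; rewrite er ej exprSr mulrA.
Qed.

Definition cst2r (k : fieldType) : {rmorphism k -> {poly {poly k}}} := @cst2 k.

Lemma ev2_id (k : fieldType) (p : {poly {poly k}}) :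
  @ev2 k {poly {poly k}} (cst2r k) 'X 'X%:P p = p.
Proof.
have inner (c : {poly k}) : @pev k {poly {poly k}} (cst2r k) 'X%:P c = c%:P.
  rewrite -[in RHS](comp_polyXr c); apply/esym.
  exact: (@rmorph_pev k {poly k} (@polyC k) 'X {poly {poly k}} (@polyC {poly k})
    (cst2r k) c).
rewrite -[RHS]comp_polyXr /ev2 pevE /comp_poly; congr horner.
exact: eq_map_poly.
Qed.

(** * A plane curve given by a minimal polynomial *)

(** Here f is the minimal polynomial of W over k(Z). The bounds on its
    coefficients say that its total degree is N + 1, reached by Z^(N + 1) only,
    so that the line X_0 = 0 meets the curve at (0 : 1 : 0) only. *)
Section PlaneModel.
Variables (k : closedFieldType) (L : fieldType) (lam : {rmorphism k -> L}).
Variables (W Z : L) (N : nat) (f : {poly {poly k}}).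
Hypotheses (N_gt0 : (0 < N)%N) (f_size : size f = N.+1) (f_monic : f \is monic).
Hypothesis f0_size : size (f`_0)%R = N.+2.
Hypothesis fi_size : forall i, (0 < i <= N)%N -> (i + size (f`_i)%R <= N.+1)%N.
Hypothesis f_ideal : forall p, ev2 lam W Z p = 0 <-> exists c, p = c * f.
Hypotheses (f00 : (f`_0)`_0 = 0) (f10 : (f`_1)`_0 != 0).

Definition plane_form : {mpoly k[3]} := homogenize N.+1 f.
Local Notation F := plane_form.

Lemma plane_form_homog : F \is N.+1.-homog.
Proof.
apply: homogenize_homog => i l; rewrite f_size ltnS => iN.
have [->|i0] := posnP i; first by rewrite f0_size.
have := @fi_size i; rewrite i0 iN => /(_ isT) le lt.
by rewrite (leq_trans _ le) // leq_add2l ltnW.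
Qed.

Lemma plane_form_affine (v : 'I_3 -> k) : v o0 != 0 ->
  F.@[v] = v o0 ^+ N.+1 * ev2 idfun (v o1 / v o0) (v o2 / v o0) f.
Proof.
move=> v0; rewrite /meval (mmap_homog (v := vec3 1 (v o1 / v o0) (v o2 / v o0) 0)
  (c := v o0) _ plane_form_homog).
  by rewrite mmap_homogenize1 ?vec30 // vec31 vec32.
by apply: ord3_ind; rewrite ?vec30 ?vec31 ?vec32 ?mulr1 // mulrC divfK.
Qed.

Lemma plane_form_infinity (v : 'I_3 -> k) : v o0 = 0 ->
  F.@[v] = lead_coef f`_0 * v o2 ^+ N.+1.
Proof.
move=> v0; rewrite /meval mmap_homogenize f_size big_ord_recl /= f0_size.
rewrite big_ord_recr /= subn0 subnn expr0 expr0 !mul1r.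
rewrite lead_coefE f0_size /= v0.
rewrite big1 ?add0r => [|l _]; last first.
  by rewrite expr0n subn_eq0 leqNgt ltn_ord /= !mul0r mulr0.
rewrite big1 ?addr0 // => i _; rewrite big1 // => l _.
have := @fi_size (bump 0 i); rewrite {1 2}/bump /= add1n ltn_ord => /(_ isT) le.
have lt : (bump 0 i + l < N.+1)%N by rewrite (leq_trans _ le) // ltn_add2l.
by rewrite -subnDA expr0n subn_eq0 leqNgt lt !mul0r mulr0.
Qed.

Lemma lead_f0 : lead_coef f`_0 != 0.
Proof. by rewrite lead_coef_eq0 -size_poly_gt0 f0_size. Qed.

Lemma dehomogenize_plane_form : dehomogenize F = f.
Proof.
rewrite -[RHS]ev2_id /dehomogenize (@mmap_homogenize1 k {poly {poly k}} (cst2r k)) //.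
Qed.

(** The factor G2 is homogeneous, and constant on X_0 = 1, so it is a power of
    X_0; as X_0 does not divide the form, it is constant. *)
Lemma plane_form_cofactor (G1 G2 : {mpoly k[3]}) (a : k) : a != 0 ->
  F = G1 * G2 -> dehomogenize G2 = a%:P%:P -> G2 \is a GRing.unit.
Proof.
move=> a0 eF eG2.
have F0 : F != 0.
  apply/eqP => F0; have := @plane_form_infinity (vec3 0 0 1 0) (vec30 _ _ _).
  rewrite F0 meval0 vec32 expr1n mulr1 => /eqP.
  by rewrite eq_sym (negbTE lead_f0).
have [c [j sG2]] : exists c j, scale G2 = c%:P * 'X^j.
  apply: (monomial_factor (d := N.+1) (c := F) (p := scale G1) F0).
  by rewrite -scaleM -eF (scale_homog plane_form_homog).
have ec : c = G2.
  have := scale_horner G2 1; rewrite sG2 hornerM hornerC hornerXn expr1n mulr1 => ->.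
  by rewrite -[RHS]mmap_id; apply: eq_mmap => i; rewrite mul1r.
rewrite ec in sG2.
have homG2 (v : 'I_3 -> k) s : mmap idfun (fun i => s * v i) G2 = G2.@[v] * s ^+ j.
  by rewrite -scale_point sG2 rmorphM rmorphXn /= pevC pevX.
(* G2(X_0, 0, 1) = a X_0^j holds for X_0 <> 0, hence for X_0 = 0 *)
have j0 : j = 0%N.
  pose r : {poly k} := mmap polyC (vec3 'X 0 1 0) G2.
  have rE s : r.[s] = mmap idfun (vec3 s 0 1 0) G2.
    apply: (@rmorph_mmap k 3 {poly k} k polyC idfun _ _ (horner_eval s) G2) => [x|].
      by rewrite /= /horner_eval hornerC.
    by apply: ord3_ind; rewrite ?vec30 ?vec31 ?vec32 /= /horner_eval ?hornerX ?hornerC.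
  have er : 'X * (r - a%:P * 'X^j) = 0.
    apply/eqP; apply: contraT => /closed_nonrootP[s]; case/negP.
    rewrite /root hornerM hornerX; have [->|s0] := eqVneq s 0; first by rewrite mul0r.
    rewrite hornerD hornerN hornerM hornerC hornerXn rE.
    have -> : mmap idfun (vec3 s 0 1 0) G2 = a * s ^+ j.
      have -> : a = G2.@[vec3 1 0 s^-1 0].
        rewrite /meval -(ev2_dehomogenize idfun) eG2 /ev2 pevC /= pevC //.
      rewrite -homG2; apply: eq_mmap; apply: ord3_ind;
        by rewrite ?vec30 ?vec31 ?vec32 ?mulr1 ?mulr0 ?divff.
    by rewrite subrr mulr0.
  have : r.[0] != 0.
    rewrite rE; apply: contraTneq lead_f0 => r0; rewrite negbK.
    have := @plane_form_infinity (vec3 0 0 1 0) (vec30 _ _ _).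
    rewrite eF mevalM [G2.@[_]]r0 mulr0 vec32 expr1n mulr1 => <-.
    exact: eqxx.
  move/eqP: er; rewrite mulf_eq0 polyX_eq0 subr_eq0 => /eqP ->.
  rewrite hornerM hornerC hornerXn expr0n.
  by have [->//|_] := eqVneq j 0%N; rewrite mulr0 eqxx.
have eG : G2 = (G2.@[fun=> 0])%:MP.
  have e0 := scale_horner G2 0; rewrite sG2 j0 expr0 mulr1 hornerC in e0.
  apply: (etrans e0); apply/esym; apply: (@rmorph_mmap k 3 k {mpoly k[3]} idfun (@mpolyC 3 k) _ _
    (@mpolyC 3 k) G2) => // i.
  by rewrite mul0r /= mpolyC0.
have G20 : G2.@[fun=> 0] != 0.
  apply: contraNneq F0 => h; rewrite eF eG h mpolyC0 mulr0 //.
apply/unitrPr; exists ((G2.@[fun=> 0])^-1)%:MP.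
by rewrite {1}eG -mpolyCM divff.
Qed.

(** On X_0 = 1 the form becomes f, and one of the two factors vanishes at
    (W, Z), hence is a multiple of f. *)
Lemma plane_form_irreducible : irreducible_mpoly F.
Proof.
split.
  apply/negP => uF.
  have := congr1 (fun p => p.@[vec3 1 0 0 0]) (divrr uF).
  rewrite mevalM plane_form_affine vec30 ?oner_neq0 // vec31 vec32 !mul0r.
  have -> : ev2 idfun 0 0 f = 0.
    rewrite /ev2 pevE horner_coef0 coef_map /= pevE horner_coef0 coef_map /=.
    exact: f00.
  by rewrite mulr0 mul0r meval1 => /eqP; rewrite eq_sym oner_eq0.
have f0 : f != 0 by rewrite -size_poly_gt0 f_size.
have cof (g1 g2 : {poly {poly k}}) : f = g1 * g2 -> ev2 lam W Z g1 = 0 ->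
    exists2 a : k, a != 0 & g2 = a%:P%:P.
  move=> ef /f_ideal[c eg1].
  have u : c * g2 = 1.
    by apply: (mulIf f0); rewrite mul1r mulrAC -eg1 -ef.
  have : g2 \is a GRing.unit by apply/unitrPr; exists c; rewrite mulrC.
  rewrite poly_unitE => /andP[/eqP s2]; rewrite poly_unitE => /andP[/eqP s20 u20].
  exists (g2`_0)`_0; first by apply: contraTneq u20 => ->; rewrite unitr0.
  have -> : ((g2`_0)`_0)%:P = g2`_0 by apply/esym/size1_polyC; rewrite s20.
  by apply/size1_polyC; rewrite s2.
move=> G1 G2 eF.
have ef : f = dehomogenize G1 * dehomogenize G2.
  by rewrite -dehomogenizeM -eF dehomogenize_plane_form.
have : ev2 lam W Z f = 0 by apply/f_ideal; exists 1; rewrite mul1r.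
rewrite ef rmorphM /= => /eqP; rewrite mulf_eq0 => /orP[|] /eqP e0.
  have [a a0 ea] := cof _ _ ef e0.
  by rewrite (plane_form_cofactor a0 eF ea) orbT.
rewrite mulrC in ef; have [a a0 ea] := cof _ _ ef e0.
by rewrite mulrC in eF; rewrite (plane_form_cofactor a0 eF ea).
Qed.

Hypothesis infinity : exists2 O, curve_point lam O &
  [/\ W != 0, W^-1 \in max_ideal O & Z / W \in max_ideal O].

Local Notation xi := (vec3 1 W Z).
Local Notation C := (morphism_image lam xi).

(** After scaling, the coordinates at the place are congruent to v modulo the
    maximal ideal. *)
Lemma meval_image d (p : {mpoly k[3]}) (v : 'rV[k]_3) : p \is d.-homog ->
  mpoly_eval lam p xi = 0 -> C v -> vanishes_at p v.
Proof.
move=> hp p0 [O [hO [v0 [g [g0 hg]]]]].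
apply: (max_ideal_const hO); rewrite /meval.
have -> : lam (mmap idfun (fun i => v 0 i) p) = mmap lam (fun i => lam (v 0 i)) p.
  exact: (@rmorph_mmap k 3 k L idfun lam _ _ lam p).
have e0 : mmap lam (fun i => g * xi 0 i) p = 0.
  by rewrite (mmap_homog (v := xi 0) (c := g) _ hp) // [mmap _ _ _]p0 mulr0.
have := @mmap_congr k L lam O 3 (fun i => g * xi 0 i) (fun i => lam (v 0 i)) p hO
  (fun i => (hg i).1) (fun i => place_const hO _) (fun i => (hg i).2).
by rewrite e0 sub0r => /(max_ideal_opp hO); rewrite opprK.
Qed.

(** A zero (v0, v1, v2) of the form with v0 <> 0 is a specialization of
    (W, Z), so some place takes this value; the only zero with v0 = 0 is the
    value at the place at infinity. *)
Lemma image_plane_form (v : 'rV[k]_3) : v != 0 -> C v <-> vanishes_at F v.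
Proof.
move=> vn0; split.
  apply: (meval_image plane_form_homog); rewrite /mpoly_eval.
  rewrite mmap_homogenize1 ?vec30 // vec31 vec32.
  by apply/f_ideal; exists 1; rewrite mul1r.
have [O cO [W0 mW mZW]] := infinity.
rewrite /vanishes_at; have [v0|v0] := eqVneq (v 0 o0) 0.
  rewrite plane_form_infinity // => /eqP; rewrite mulf_eq0 (negbTE lead_f0) /=.
  rewrite expf_eq0 /= => /eqP v2.
  have v1 : v 0 o1 != 0.
    apply: contraNneq vn0 => v1; rewrite (vec3E v) v0 v1 v2.
    by apply/eqP/matrixP => i j; rewrite (ord1 i) mxE [RHS]mxE; move: j; apply: ord3_ind.
  exists O; split=> //; split=> //; exists (lam (v 0 o1) / W).
  split; first by rewrite mulf_neq0 ?fmorph_eq0 ?invr_eq0.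
  have O1 : 1 \in O by rewrite -(rmorph1 lam) (place_const cO).
  apply: ord3_ind; rewrite ?vec30 ?vec31 ?vec32.
  - rewrite v0 rmorph0 subr0 mulr1.
    have h : lam (v 0 o1) / W \in max_ideal O.
      by rewrite (max_ideal_mul cO) // (place_const cO).
    by split=> //; exact: max_idealW.
  - by rewrite divfK // subrr (max_ideal0 cO) (place_const cO).
  - rewrite v2 rmorph0 subr0 -mulrA [W^-1 * Z]mulrC.
    have h : lam (v 0 o1) * (Z / W) \in max_ideal O.
      by rewrite (max_ideal_mul cO) // (place_const cO).
    by split=> //; exact: max_idealW.
rewrite plane_form_affine // => /eqP; rewrite mulf_eq0 expf_eq0 (negbTE v0) andbF /=.
set w0 := v 0 o1 / _; set z0 := v 0 o2 / _ => /eqP fwz.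
have WnC c : W != lam c.
  apply: contraNneq W0 => Wc; rewrite Wc.
  by move: mW; rewrite Wc -fmorphV => /(max_ideal_const cO)/eqP; rewrite invr_eq0 => /eqP ->; rewrite rmorph0.
have [|||| O' [cO' sO]] := @place_of_specialization k L lam {poly {poly k}} (@cst2 k)
  (ev2 lam W Z) (ev2 idfun w0 z0).
- by move=> c; rewrite /= /ev2 pevC /= pevC.
- by move=> c; rewrite /= /ev2 pevC /= pevC.
- by move=> p /f_ideal[c ->]; rewrite rmorphM /= fwz mulr0.
- by exists 'X; rewrite /= /ev2 !pevX.
exists O'; split=> //; split=> //; exists (lam (v 0 o0)).
split; first by rewrite fmorph_eq0.
have [hW mW'] := sO 'X; have [hZ mZ'] := sO 'X%:P.
move: hW mW' hZ mZ'; rewrite /= /ev2 !pevX !pevC /= !pevX => hW mW' hZ mZ'.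
have Ov := place_const cO' (v 0 o0).
apply: ord3_ind; rewrite ?vec30 ?vec31 ?vec32.
- by rewrite mulr1 subrr (max_ideal0 cO').
- split; first exact: (place_mul cO').
  have -> : lam (v 0 o0) * W - lam (v 0 o1) = lam (v 0 o0) * (W - lam w0).
    by rewrite mulrBr -rmorphM (_ : v 0 o0 * w0 = v 0 o1) // /w0 mulrC divfK.
  exact: (max_ideal_mul cO').
- split; first exact: (place_mul cO').
  have -> : lam (v 0 o0) * Z - lam (v 0 o2) = lam (v 0 o0) * (Z - lam z0).
    by rewrite mulrBr -rmorphM (_ : v 0 o0 * z0 = v 0 o2) // /z0 mulrC divfK.
  exact: (max_ideal_mul cO').
Qed.

Lemma plane_form_equation : plane_curve_equation C N.+1 F.
Proof.
split; [exact: plane_form_homog|exact: plane_form_irreducible|].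
exact: image_plane_form.
Qed.

Lemma plane_form_line0 (a : 'I_3 -> {poly k}) : a o2 = 0 ->
  mmap polyC a F = \sum_(i < N.+1) ((f`_i)`_0)%:P * (a o0 ^+ (N.+1 - i) * a o1 ^+ i).
Proof.
move=> a2; rewrite mmap_homogenize f_size; apply: eq_bigr => i _.
case s: (size (f`_i)%R) => [|s'].
  rewrite big_ord0 nth_default ?s // mul0r //.
rewrite big_ord_recl /= subn0 expr0 mulr1 big1 ?addr0 // => l _.
by rewrite a2 expr0n /= !mulr0.
Qed.

Lemma line_eq (v : 'rV[k]_3) (i : 'I_3) :
  (v 0 i)%:P + (i == i)%:R *: 'X = (v 0 i)%:P + 'X :> {poly k}.
Proof. by rewrite eqxx scale1r. Qed.
Lemma line_neq (v : 'rV[k]_3) (i j : 'I_3) : i != j ->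
  (v 0 j)%:P + (i == j)%:R *: 'X = (v 0 j)%:P :> {poly k}.
Proof. by move/negbTE ->; rewrite scale0r addr0. Qed.

Definition infinite_point : 'rV[k]_3 := vec3 0 1 0.
Definition origin_point : 'rV[k]_3 := vec3 1 0 0.

(** The derivative along X_0 is the coefficient of X_0 X_1^N, which is 1. *)
Lemma smooth_infinite_point : smooth_point C infinite_point.
Proof.
exists N.+1, F; split; first exact: plane_form_equation.
  by rewrite /vanishes_at plane_form_infinity ?vec30 // vec32 expr0n /= mulr0.
exists o0; rewrite /vanishes_at.
have [_ <-] := mderiv_line (infinite_point 0) o0 F.
rewrite plane_form_line0; last by rewrite line_neq // vec32.
rewrite (line_eq _ o0) (@line_neq _ o0 o1) // vec30 vec31 add0r.
rewrite coef_sum (bigD1 ord_max) //= subSnn expr1 expr1n mulr1 coefCM coefX mulr1.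
rewrite big1 ?addr0 => [|i iN]; last first.
  rewrite polyC1 expr1n mulr1 coefCM coefXn.
  have lt : (i < N)%N.
    by rewrite ltn_neqAle -ltnS ltn_ord andbT; apply: contraNneq iN => e; apply/eqP/val_inj.
  by rewrite [(1 == _)%N](_ : _ = false) ?mulr0 //; apply/eqP; lia.
have fN : f`_N = 1 by move: f_monic; rewrite monicE lead_coefE f_size => /eqP.
by rewrite fN coef1; apply/eqP; exact: oner_neq0.
Qed.

(** The derivative along X_1 is the coefficient of X_0^N X_1. *)
Lemma smooth_origin_point : smooth_point C origin_point.
Proof.
exists N.+1, F; split; first exact: plane_form_equation.
  rewrite /vanishes_at plane_form_affine vec30 ?oner_neq0 // vec31 vec32 !mul0r.
  rewrite /ev2 pevE horner_coef0 coef_map /= pevE horner_coef0 coef_map /=.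
  by rewrite f00 mulr0.
exists o1; rewrite /vanishes_at.
have [_ <-] := mderiv_line (origin_point 0) o1 F.
rewrite plane_form_line0; last by rewrite line_neq // vec32.
rewrite (line_eq _ o1) (@line_neq _ o1 o0) // vec30 vec31 add0r.
rewrite coef_sum (bigD1 (Ordinal (leq_ltn_trans N_gt0 (ltnSn N)))) //=.
rewrite polyC1 expr1n mul1r expr1 coefCM coefX mulr1.
rewrite big1 ?addr0 => [|i i1]; first exact/eqP.
rewrite expr1n mul1r coefCM coefXn.
by rewrite eq_sym (_ : (i == 1 :> nat) = false) ?mulr0 //; apply: negbTE.
Qed.

(** Projection from the point where all coordinates but the one outside
    {2, a} vanish. *)
Definition projection (a : 'I_3) : 'M[k]_(3, 2) :=
  \matrix_(i, j) (i == if j == 0 then o2 else a)%:R.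

Lemma mul_projection (S : comNzRingType) (mu : {rmorphism k -> S}) (v : 'rV[S]_3) a :
  (v *m map_mx mu (projection a)) 0 0 = v 0 o2 /\
  (v *m map_mx mu (projection a)) 0 1 = v 0 a.
Proof.
split; rewrite mxE.
  rewrite (bigD1 o2) //= !mxE eqxx rmorph1 mulr1 big1 ?addr0 // => i /negbTE i2.
  by rewrite !mxE /= i2 rmorph0 mulr0.
rewrite (bigD1 a) //= !mxE eqxx rmorph1 mulr1 big1 ?addr0 // => i /negbTE i2.
by rewrite !mxE /= i2 rmorph0 mulr0.
Qed.

Lemma rank_projection a : a != o2 -> \rank (projection a) = 2%N.
Proof.
move=> a2; apply/eqP; rewrite eqn_leq rank_leq_col /=.
suff e : (projection a)^T *m projection a = 1%:M.
  by rewrite -{1}(mxrank1 k 2) -e mxrankM_maxr.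
apply/matrixP => i j; rewrite mxE.
rewrite (bigD1 (if i == 0 then o2 else a)) //= !mxE eqxx mul1r big1 ?addr0; last first.
  by move=> l /negbTE h; rewrite !mxE h mul0r.
congr (_%:R); have ord2 (l : 'I_2) : l = 0 \/ l = 1.
  by case: l => [[|[|//]] ?]; [left|right]; exact: val_inj.
have a2' : (a == o2) = false by exact: negbTE.
by case: (ord2 i) => ->; case: (ord2 j) => ->; rewrite /= ?eqxx ?[o2 == a]eq_sym ?a2'.
Qed.

Hypothesis symmetry : forall d (p : {mpoly k[3]}), p \is d.-homog ->
  mpoly_eval lam p xi = 0 -> mpoly_eval lam p (vec3 W 1 Z) = 0.
Hypothesis generation : forall a : L, exists P Q : {poly {poly k}},
  ev2 lam W Z Q != 0 /\ a = ev2 lam W Z P / ev2 lam W Z Q.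
Hypothesis density : forall p : {poly {poly k}},
  (forall w0 z0 : k, ev2 idfun w0 z0 f = 0 -> ev2 idfun w0 z0 p = 0) ->
  ev2 lam W Z p = 0.

Lemma plane_function_field_xi : plane_function_field lam C xi.
Proof.
split=> [d p hp|a].
  split=> [p0 v _|van]; first exact: (meval_image hp p0).
  rewrite /mpoly_eval -ev2_dehomogenize; apply: density => w0 z0 f0.
  rewrite ev2_dehomogenize; apply: (van (vec3 1 w0 z0)).
    by apply/eqP => /matrixP/(_ 0 o0)/eqP; rewrite vec30 mxE oner_eq0.
  apply/image_plane_form.
    by apply/eqP => /matrixP/(_ 0 o0)/eqP; rewrite vec30 mxE oner_eq0.
  by rewrite /vanishes_at plane_form_affine vec30 ?oner_neq0 // vec31 vec32 !divr1 f0 mulr0.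
have [P [Q [Q0 ->]]] := generation a.
pose bound (p : {poly {poly k}}) := (size p + \max_(i < size p) size (p`_i)%R)%N.
have boundP (p : {poly {poly k}}) i l : (i < size p)%N -> (l < size (p`_i)%R)%N ->
    (i + l <= bound p)%N.
  move=> ip lp; apply: leq_add; first exact: ltnW.
  apply: leq_trans (ltnW lp) _.
  exact: (leq_bigmax (Ordinal ip) (F := fun i : 'I_(size p) => size (p`_i)%R)).
pose D := maxn (bound P) (bound Q).
exists D, (homogenize D P), (homogenize D Q).
have hE p : mpoly_eval lam (homogenize D p) xi = ev2 lam W Z p.
  by rewrite /mpoly_eval mmap_homogenize1 ?vec30 // vec31 vec32.
rewrite !hE; split=> //; apply: homogenize_homog => i l ip lp.
  by rewrite (leq_trans (boundP _ _ _ ip lp)) // leq_maxl.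
by rewrite (leq_trans (boundP _ _ _ ip lp)) // leq_maxr.
Qed.

Lemma mpoly_eval_swap (p : {mpoly k[3]}) :
  mpoly_eval lam (swap01 p) xi = mpoly_eval lam p (vec3 W 1 Z).
Proof. by rewrite /mpoly_eval mmap_swap01. Qed.

Lemma symmetry_iff d (p : {mpoly k[3]}) : p \is d.-homog ->
  mpoly_eval lam p (vec3 W 1 Z) = 0 <-> mpoly_eval lam p xi = 0.
Proof.
move=> hp; split; last exact: symmetry hp.
rewrite -mpoly_eval_swap => /(symmetry (swap01_homog hp)).
by rewrite /mpoly_eval mmap_swap01.
Qed.

Lemma plane_function_field_swap : plane_function_field lam C (vec3 W 1 Z).
Proof.
have [h1 h2] := plane_function_field_xi; split=> [d p hp|a].
  by rewrite (symmetry_iff hp); exact: h1 hp.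
have [d [p [r [hp hr r0 ->]]]] := h2 a.
exists d, (swap01 p), (swap01 r); split; try exact: swap01_homog.
  by rewrite /mpoly_eval mmap_swap01.
by rewrite /mpoly_eval !mmap_swap01.
Qed.

Lemma xi_neq0 : xi != 0.
Proof. by apply/eqP => /matrixP/(_ 0 o0)/eqP; rewrite vec30 mxE oner_eq0. Qed.

Hypothesis galois_projection : exists phi : {rmorphism {fraction {poly k}} -> L},
  [/\ forall c : k, phi (FracField.tofrac c%:P) = lam c,
      phi (FracField.tofrac 'X) = Z & galois_ext phi].

Lemma projection_kernel (v : 'rV[k]_3) a :
  v 0 o2 = 0 -> v 0 a = 0 -> v *m projection a = 0.
Proof.
move=> v2 va; have [e0 e1] := mul_projection idfun v a.
apply/matrixP => i j; rewrite (ord1 i) [RHS]mxE.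
have -> : projection a = map_mx idfun (projection a).
  by apply/matrixP => i' j'; rewrite [RHS]mxE.
case: j => [[|[|//]] hj].
  by rewrite (_ : Ordinal hj = 0) ?e0 ?v2 //; exact: val_inj.
by rewrite (_ : Ordinal hj = 1) ?e1 ?va //; exact: val_inj.
Qed.

(** Both projections are (X_2 : 1) on C: the one from (0 : 1 : 0) in the
    coordinates (1, W, Z), the one from (1 : 0 : 0) in the coordinates
    (W, 1, Z), which satisfy the same equations by the symmetry. *)
Theorem plane_model_inner_galois_points :
  [/\ birational_embedding lam xi, plane_curve_of_degree N.+1 C &
      exists P1 P2 : 'rV[k]_3,
        [/\ inner_galois_point C P1, inner_galois_point C P2 & ~ same_point P1 P2]].
Proof.
have [phi [phiC phiX gal]] := galois_projection.
split.
- by split; [exact: xi_neq0|exact: plane_function_field_xi].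
- by exists F; exact: plane_form_equation.
exists infinite_point, origin_point; split.
- split; [|exact: smooth_infinite_point|].
    by apply/eqP => /matrixP/(_ 0 o1)/eqP; rewrite vec31 mxE oner_eq0.
  exists L, lam, xi, (projection o0), phi; split=> //.
  + exact: plane_function_field_xi.
  + split; first exact: rank_projection.
    by apply: projection_kernel; rewrite ?vec32 ?vec30.
  + have [-> ->] := mul_projection lam xi o0.
    by rewrite phiX vec32 vec30 divr1.
- split; [|exact: smooth_origin_point|].
    by apply/eqP => /matrixP/(_ 0 o0)/eqP; rewrite vec30 mxE oner_eq0.
  exists L, lam, (vec3 W 1 Z), (projection o1), phi; split=> //.
  + exact: plane_function_field_swap.
  + split; first exact: rank_projection.
    by apply: projection_kernel; rewrite ?vec32 ?vec31.
  + have [-> ->] := mul_projection lam (vec3 W 1 Z) o1.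
    by rewrite phiX vec32 vec31 divr1.
move=> [c _ /matrixP/(_ 0 o0)/eqP].
by rewrite vec30 mxE vec30 mulr0 oner_eq0.
Qed.

End PlaneModel.

(** * The plane model of the curve *)

Section Fractions.
Import fraction.FracField generic_quotient.
Local Open Scope quotient_scope.

Lemma fraction_quotient (R : idomainType) (a : {fraction R}) :
  exists p r, FracField.tofrac r != 0 /\
    a = FracField.tofrac p / FracField.tofrac r.
Proof.
elim/quotW: a => x; exists \n_x, \d_x.
have d0 : FracField.tofrac \d_x != 0 by rewrite tofrac_eq0 denom_ratioP.
split=> //; apply: (mulIf d0); rewrite divfK //.
unlock FracField.tofrac; rewrite -[LHS]pi_mul /FracField.mulf /=.
apply/eqmodP; rewrite /= equivfE.
by rewrite !numden_Ratio ?oner_eq0 ?mulr1 ?mulf_neq0 ?denom_ratioP // mulrC.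
Qed.
End Fractions.

Section CurveModel.
Variables (k : closedFieldType) (e q0 q n h : nat).
Hypotheses (hk : 2%N \in [pchar k]) (hq0 : q0 = (2 ^ e)%N) (hq : q = (2 * q0 ^ 2)%N).
Hypothesis hm : (n * h)%N = (q - 2 * q0 + 1)%N.
Variables (L : fieldType) (lam : {rmorphism k -> L}) (x y z : L).
Hypothesis hL : curve_field q0 q n lam x y z.
Local Notation evL := (ev3 lam x y z).
Local Notation trans_group := (trans_group hk hq0 hq).
Local Notation trans := (@trans k e q0 q n hk hq0 hq L lam x y z hL).
Local Notation orbit_eq := (@orbit_eq k e q0 q n h hk hq0 hq L lam x y z hL).
Local Notation W := (W_fun q0 h x y).
Local Notation one := (trans_one hk hq0 hq).

Let L2 : 2%N \in [pchar L] := rmorph_char2 hk lam.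
Let q1 : (1 < q)%N := suzuki_q_gt1 hq0 hq.
Let qk : q%:R = 0 :> k := suzuki_qk hk hq.

(** W^(q^2) and z^(q^2 + 1) differ by a unit. *)
Lemma place_infinite_point : exists2 O, curve_point lam O &
  [/\ W != 0, W^-1 \in max_ideal O & z / W \in max_ideal O].
Proof.
have [O hO zinf] := place_at_infinity hk hq0 hq hm hL.
have xyz : curve_eq q0 q n x y z by case: hL.
have lead := W_leading hk hq0 hq hm hL hO zinf xyz.
have [l0 lV] := one_unitV hO lead.
have N_gt0 : (0 < q ^ 2)%N by rewrite expn_gt0 ltnW.
have z0 := z_neq0 hk hq0 hq hL.
have W0 : W != 0.
  by apply: contraNneq l0; rewrite /W_fun => ->; rewrite expr0n eqn0Ngt N_gt0 mul0r.
have zVO := max_idealW zinf.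
have WN0 : W ^+ (q ^ 2) != 0 by rewrite expf_neq0.
exists O => //; split=> //.
  apply: (max_ideal_root hO N_gt0).
  have -> : W^-1 ^+ (q ^ 2) = (W ^+ (q ^ 2) / z ^+ (q ^ 2 + 1))^-1 * z^-1 ^+ (q ^ 2 + 1).
    by rewrite invf_div !exprVn mulrAC divff ?mul1r // expf_neq0.
  by apply: (max_ideal_mul hO) => //; apply: (max_ideal_exp hO) => //; rewrite addn1.
apply: (max_ideal_root hO N_gt0).
have -> : (z / W) ^+ (q ^ 2) = (W ^+ (q ^ 2) / z ^+ (q ^ 2 + 1))^-1 * z^-1.
  by rewrite invf_div expr_div_n addn1 exprSr mulrAC mulfK.
exact: (max_ideal_mul hO).
Qed.

Lemma suz_w_neq0 : suz_w q0 x y != 0.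
Proof.
have [O _ [W0 _ _]] := place_infinite_point.
by apply: contraNneq W0; rewrite /W_fun => ->; rewrite expr0n eqn0Ngt (h_gt0 hm).
Qed.

(** The pullback of p under (x, y, z) -> (w^h, z). *)
Definition pull3 (S : comNzRingType) (mu : {rmorphism k -> S}) (x' y' z' : S)
    (p : {poly {poly k}}) : S := ev2 mu (suz_w q0 x' y' ^+ h) z' p.

Lemma ev3_pull3 (S : comNzRingType) (mu : {rmorphism k -> S}) (x' y' z' : S) p :
  ev3 mu x' y' z' (@pull3 (poly3 k) (cst3r k) (vX k) (vY k) (vZ k) p)
    = pull3 mu x' y' z' p.
Proof.
have eC := ev3_cst mu x' y' z'.
have eW : ev3 mu x' y' z' (@suz_w q0 (poly3 k) (vX k) (vY k) ^+ h) = suz_w q0 x' y' ^+ h.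
  apply: etrans (rmorphXn (ev3 mu x' y' z') h (@suz_w q0 (poly3 k) (vX k) (vY k))) _.
  congr (_ ^+ _).
  apply: etrans (@rmorph_suz_w q0 (poly3 k) S (ev3 mu x' y' z') (vX k) (vY k)) _.
  exact: (congr2 (@suz_w q0 S) (ev3X mu x' y' z') (ev3Y mu x' y' z')).
have e1 c : ev3 mu x' y' z' (@pev k (poly3 k) (cst3r k) (vZ k) c) = pev mu z' c.
  apply: etrans (@rmorph_pev k (poly3 k) (cst3r k) (vZ k) S (ev3 mu x' y' z') mu c eC) _.
  exact: (congr1 (fun u => pev mu u c) (ev3Z mu x' y' z')).
have e2 := @rmorph_pev {poly k} (poly3 k) (pev (cst3r k) (vZ k))
  (@suz_w q0 (poly3 k) (vX k) (vY k) ^+ h) S (ev3 mu x' y' z') (pev mu z') p e1.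
exact: (etrans e2 (congr1 (fun u => pev (pev mu z') u p) eW)).
Qed.

Lemma plane_specialization p : ev2 lam W z p = 0 ->
  forall (S : comNzRingType) (mu : {rmorphism k -> S}) (x' y' z' : S),
    curve_eq q0 q n x' y' z' -> pull3 mu x' y' z' p = 0.
Proof.
move=> p0 S mu x' y' z' xyz'; rewrite -ev3_pull3.
apply: (specialization q1 qk hL) xyz'.
exact: etrans (ev3_pull3 lam x y z p) p0.
Qed.

(** The pullback of p vanishes at all points of the curve, because their images
    are zeros of the orbit polynomial. *)
Lemma plane_density p :
  (forall w0 z0 : k, ev2 idfun w0 z0 orbit_eq = 0 -> ev2 idfun w0 z0 p = 0) ->
  ev2 lam W z p = 0.
Proof.
move=> van; have xyz : curve_eq q0 q n x y z by case: hL.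
rewrite -[LHS]/(pull3 lam x y z p) -ev3_pull3.
apply: (curve_vanishing q1 qk) xyz => x0 y0 z0 xyz0.
apply: etrans (ev3_pull3 idfun x0 y0 z0 p) _; apply: van.
exact: (plane_specialization (ev2_orbit_eq h hk hq0 hq hL) idfun xyz0).
Qed.

(** The involution of the curve maps (1, W, Z) to (1, 1/W, Z/W), which is
    proportional to (W, 1, Z). *)
Lemma plane_symmetry d (p : {mpoly k[3]}) : p \is d.-homog ->
  mpoly_eval lam p (vec3 1 W z) = 0 -> mpoly_eval lam p (vec3 W 1 z) = 0.
Proof.
rewrite /mpoly_eval -ev2_dehomogenize => hp p0.
have xyz : curve_eq q0 q n x y z by case: hL.
have w0 := suz_w_neq0.
have [xyz' ew] := curve_eq_involution hq0 hq L2 hm xyz w0.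
have := plane_specialization p0 lam xyz'; rewrite /pull3 ew ev2_dehomogenize => p0'.
rewrite (mmap_homog (v := vec3 1 ((suz_w q0 x y)^-1 ^+ h) (z / suz_w q0 x y ^+ h) 0)
  (c := W) _ hp) ?p0' ?mulr0 //.
apply: ord3_ind; rewrite ?vec30 ?vec31 ?vec32 ?mulr1 // /W_fun.
  by rewrite exprVn divff // expf_neq0.
by rewrite mulrC divfK // expf_neq0.
Qed.

Lemma trans_pev_ratio g c d :
  trans g (pev lam z c / pev lam z d) = pev lam z c / pev lam z d.
Proof.
rewrite [LHS](rmorphM (trans g)) fmorphV.
by rewrite (trans_pev hL g c) (trans_pev hL g d).
Qed.

(** Lagrange interpolation of trans g W -> trans g a: both the interpolation
    polynomial and the derivative of the orbit polynomial of W have invariant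
    coefficients, and a is the quotient of their values at W. *)
Definition interpolation (a : L) : {poly L} :=
  \sum_g (trans g a)%:P * \prod_(g' | g' != g) ('X - (trans g' W)%:P).

Lemma interpolation_invariant a g :
  map_poly (trans g) (interpolation a) = interpolation a.
Proof.
have mi := @trans_mul_inj _ _ _ _ _ _ _ _ _ _ _ _ _ hL g.
rewrite [LHS](rmorph_sum (map_poly (trans g))) /= [RHS](reindex_inj mi) /=.
apply: eq_bigr => g1 _.
rewrite [LHS](rmorphM (map_poly (trans g))) /= map_polyC /= (trans_mulE hL g g1 a).
congr (_ * _).
rewrite [LHS](rmorph_prod (map_poly (trans g))) /= [RHS](reindex_inj mi) /=.
rewrite [RHS](eq_bigl (fun g' => g' != g1)) => [|g']; last by rewrite /= (inj_eq mi).
apply: eq_bigr => g' _.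
by rewrite rmorphB /= map_polyX map_polyC /= (trans_mulE hL g g' W).
Qed.

Lemma horner_interpolation a :
  (interpolation a).[W] = a * \prod_(g | g != one) (W - trans g W).
Proof.
rewrite horner_sum (bigD1 one) //= [X in _ + X]big1 ?addr0 => [|g g1].
  rewrite hornerM hornerC (trans_oneE hk hq0 hq hL a) horner_prod; congr (_ * _).
  by apply: eq_bigr => g _; rewrite hornerXsubC.
rewrite hornerM horner_prod [X in _ * X](_ : _ = 0) ?mulr0 //.
apply/eqP; rewrite prodf_seq_eq0; apply/hasP; exists one; first by rewrite mem_index_enum.
by rewrite eq_sym g1 hornerXsubC (trans_oneE hk hq0 hq hL W) subrr eqxx.
Qed.

Definition in_kWz : L -> Prop := @is_quotient {poly {poly k}} L (ev2 lam W z).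

Lemma in_kWz_pev c : in_kWz (pev lam z c).
Proof.
have := @is_quotient_value {poly {poly k}} L (ev2 lam W z) c%:P.
by rewrite /= {2}/ev2 pevC.
Qed.

Lemma in_kWz_W : in_kWz W.
Proof.
have := @is_quotient_value {poly {poly k}} L (ev2 lam W z) 'X.
by rewrite /= {2}/ev2 pevX.
Qed.

Lemma fixed_coef_in_kWz (A : {poly L}) :
  (forall g, map_poly (trans g) A = A) -> in_kWz A.[W].
Proof.
move=> fA; rewrite horner_coef; apply: is_quotient_sum => i.
apply: is_quotientM; last exact: is_quotientX in_kWz_W.
have [|c [d [d0 ->]]] := @fixed_in_kz k e q0 q n hk hq0 hq L lam x y z hL A`_i.
  by move=> g; have := congr1 (fun B : {poly L} => B`_i) (fA g); rewrite coef_map.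
by apply: is_quotientM; [|apply: is_quotientV]; exact: in_kWz_pev.
Qed.

Lemma plane_generation a : in_kWz a.
Proof.
have iA := fixed_coef_in_kWz (interpolation_invariant a).
have iB := fixed_coef_in_kWz (interpolation_invariant 1).
have := is_quotientM iA (is_quotientV iB); rewrite !horner_interpolation mul1r mulfK //.
apply/prodf_neq0 => g g1; rewrite subr_eq0; apply: contraNneq g1 => eW.
apply/eqP/(trans_W_inj hm (hL := hL)); rewrite -eW.
by rewrite (trans_oneE hk hq0 hq hL W).
Qed.

Lemma projection_morphism : exists phi : {rmorphism {fraction {poly k}} -> L},
  forall c, phi (FracField.tofrac c) = pev lam z c.
Proof.
apply: (@fraction_extension {poly k} {fraction {poly k}} L (@FracField.tofrac {poly k})
  (pev lam z)) => [a|p]; first exact: fraction_quotient.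
split=> [/eqP|/(pev_z_inj q1 qk hL) ->]; last exact: tofrac0.
by rewrite tofrac_eq0 => /eqP ->; rewrite rmorph0.
Qed.

Section Galois.
Variable phi : {rmorphism {fraction {poly k}} -> L}.
Hypothesis phiE : forall c, phi (FracField.tofrac c) = pev lam z c.

Lemma trans_phi g u : trans g (phi u) = phi u.
Proof.
have [p [r [r0 ->]]] := fraction_quotient u.
by rewrite rmorphM fmorphV !phiE trans_pev_ratio.
Qed.

Lemma fixed_in_phi v : (forall g, trans g v = v) -> exists u, phi u = v.
Proof.
move=> /(@fixed_in_kz k e q0 q n hk hq0 hq L lam x y z hL)[c [d [_ ->]]].
exists (FracField.tofrac c / FracField.tofrac d).
by rewrite rmorphM fmorphV !phiE.
Qed.

Lemma fixed_poly_descends (P : {poly L}) : (forall g, map_poly (trans g) P = P) ->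
  exists p, map_poly phi p = P.
Proof.
move=> fP; have /choice[c hc] i : exists u, phi u = P`_i.
  apply: fixed_in_phi => g.
  by have := congr1 (fun B : {poly L} => B`_i) (fP g); rewrite coef_map.
exists (\poly_(i < size P) c i); apply/polyP => i.
rewrite coef_map coef_poly; case: ltnP => [_|le] /=; first exact: hc.
by rewrite rmorph0 nth_default.
Qed.

(** An irreducible polynomial with a root a is divisible by the product of the
    T - b for b in the orbit of a, which descends to k(Z). *)
Lemma projection_galois : galois_ext phi.
Proof.
pose orb a := undup [seq trans g a | g : trans_group].
have orbU a : uniq (orb a) by exact: undup_uniq.
have mem_orb a g : trans g a \in orb a.
  by rewrite mem_undup; apply/mapP; exists g; rewrite ?mem_enum.
have self a : a \in orb a by rewrite -{1}(trans_oneE hk hq0 hq hL a) mem_orb.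
pose P a := \prod_(b <- orb a) ('X - b%:P).
have fP a g : map_poly (trans g) (P a) = P a.
  rewrite /P rmorph_prod /=.
  under eq_bigr do rewrite rmorphB /= map_polyX map_polyC /=.
  rewrite -(big_map (trans g) xpredT (fun b => 'X - b%:P)); apply: perm_big.
  have um : uniq (map (trans g) (orb a)) by rewrite map_inj_uniq //; exact: fmorph_inj.
  have sub : {subset map (trans g) (orb a) <= orb a}.
    move=> _ /mapP[b + ->]; rewrite mem_undup => /mapP[g' _ ->].
    by rewrite (trans_mulE hL g g' a) mem_orb.
  have [|_ e1] := uniq_min_size um sub; first by rewrite size_map.
  exact: uniq_perm.
have desc a : exists p, map_poly phi p = P a by exact: fixed_poly_descends.
have P0 a : P a != 0 by rewrite monic_neq0 // monic_prod_XsubC.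
split=> [a|p irr [a pa]].
  have [p ep] := desc a; exists p; first by rewrite -(map_poly_eq0 phi) ep.
  by rewrite ep root_prod_XsubC self.
have [p1 ep1] := desc a.
have dv : P a %| map_poly phi p.
  apply: uniq_roots_dvdp; last by rewrite uniq_rootsE.
  apply/allP => b; rewrite mem_undup => /mapP[g _ ->].
  have -> : map_poly phi p = map_poly (trans g) (map_poly phi p).
    by rewrite -map_poly_comp; apply: eq_map_poly => u; rewrite /= trans_phi.
  by rewrite fmorph_root.
have eqp1 : p1 %= p.
  case: irr => _; apply; last by rewrite -(dvdp_map phi) ep1.
  rewrite -(size_map_poly phi) ep1 size_prod_XsubC eqSS.
  by move: (self a); case: (orb a).
have eqP : map_poly phi p %= P a by rewrite -ep1 eqp_map eqp_sym.
split; last by exists (orb a).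
rewrite -(separable_map phi) (eqp_separable eqP) separable_prod_XsubC.
exact: orbU.
Qed.
End Galois.

Theorem curve_field_plane_model : let f := vec3 1 W z in
  [/\ birational_embedding lam f,
      plane_curve_of_degree (q ^ 2 + 1)%N (morphism_image lam f) &
      exists P1 P2 : 'rV[k]_3,
        [/\ inner_galois_point (morphism_image lam f) P1,
            inner_galois_point (morphism_image lam f) P2 & ~ same_point P1 P2]].
Proof.
have [d0 di] := orbit_eq_degrees hk hq0 hq hm hL.
have [f0 f1] := orbit_eq_origin_simple hk hq0 hq hm hL.
have at0 (c : {poly k}) : pev idfun 0 c = c`_0.
  by rewrite pevE horner_coef0 coef_map.
rewrite !at0 in f0 f1; rewrite addn1.
apply: (plane_model_inner_galois_points (f := orbit_eq)) => //.
- by rewrite expn_gt0 ltnW.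
- exact: size_orbit_eq.
- exact: monic_orbit_eq.
- by move=> p; exact: (ev2_eq0 hk hq0 hq hm hL p).
- exact: place_infinite_point.
- exact: plane_symmetry.
- exact: plane_generation.
- exact: plane_density.
have [phi phiE] := projection_morphism; exists phi; split.
- by move=> c; rewrite phiE pevC.
- by rewrite phiE pevX.
exact: projection_galois.
Qed.

End CurveModel.

(** * The quotient by H *)

Section Quotient.
Variables (k : closedFieldType) (e q0 q : nat).
Hypotheses (hk : 2%N \in [pchar k]) (hq0 : q0 = (2 ^ e)%N) (hq : q = (2 * q0 ^ 2)%N).
Local Notation m := (q - 2 * q0 + 1)%N.
Variables (K : fieldType) (iota : {rmorphism k -> K}).
Let q1 : (1 < q)%N := suzuki_q_gt1 hq0 hq.
Let qk : q%:R = 0 :> k := suzuki_qk hk hq.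

Lemma skabelund_vec3 (v : 'rV[k]_3) :
  skabelund_curve q0 q v <-> curve_eq q0 q m (v 0 o0) (v 0 o1) (v 0 o2).
Proof.
have e1 : (1 : 'I_3) = o1 by exact: val_inj.
have e2 : (2 : 'I_3) = o2 by exact: val_inj.
have e0 : (0 : 'I_3) = o0 by exact: val_inj.
by rewrite /skabelund_curve e2 e1 e0.
Qed.

Lemma skabelund_curve_field (xi : 'rV[K]_3) :
  affine_function_field iota (@skabelund_curve k q0 q) xi ->
  curve_field q0 q m iota (xi 0 o0) (xi 0 o1) (xi 0 o2).
Proof.
move=> [ideal gen].
have evalP (p1 p2 : {mpoly k[3]}) :
    (forall v, skabelund_curve q0 q v -> p1.@[v 0] = p2.@[v 0]) ->
    mpoly_eval iota p1 xi = mpoly_eval iota p2 xi.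
  move=> h; apply/eqP; rewrite -subr_eq0 -[_ - _](rmorphB (mmap iota (xi 0))).
  apply/eqP/ideal => v /h hv; rewrite /vanishes_at mevalB.
  by rewrite [p1.@[_]]hv subrr.
split.
- have h1 := evalP ('X_o1 ^+ q + 'X_o1) ('X_o0 ^+ q0 * ('X_o0 ^+ q + 'X_o0)).
  have h2 := evalP ('X_o0 ^+ q + 'X_o0) ('X_o2 ^+ m).
  move: h1 h2; rewrite /mpoly_eval /meval.
  rewrite !(rmorphD, rmorphM, rmorphXn) /= !mmapX !mmap1U => h1 h2.
  by split; [apply: h1|apply: h2] => v /skabelund_vec3[h3 h4];
    rewrite !(rmorphD, rmorphM, rmorphXn) /= !mmapX !mmap1U.
- move=> P P0 x0 y0 z0 xyz0.
  pose M : {mpoly k[3]} := ev3 (@mpolyC 3 k) 'X_o0 'X_o1 'X_o2 P.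
  have ev3M (S : comNzRingType) (mu : {rmorphism k -> S}) (v : 'I_3 -> S) :
      mmap mu v M = ev3 mu (v o0) (v o1) (v o2) P.
    have -> := @rmorph_ev3 k {mpoly k[3]} (@mpolyC 3 k) 'X_o0 'X_o1 'X_o2 S
      (mmap mu v) mu P (mmapC v mu).
    by rewrite /= !mmapX !mmap1U.
  have /ideal h : mpoly_eval iota M xi = 0 by rewrite /mpoly_eval ev3M.
  have := h (vec3 x0 y0 z0); rewrite /vanishes_at /meval ev3M vec30 vec31 vec32.
  by apply; apply/skabelund_vec3; rewrite vec30 vec31 vec32.
move=> a; have [p [r [r0 ->]]] := gen a.
have conv p' : exists P, ev3 iota (xi 0 o0) (xi 0 o1) (xi 0 o2) P = mpoly_eval iota p' xi.
  exists (@mmap 3 k (poly3 k) (cst3r k) (vec3 (vX k) (vY k) (vZ k) 0) p').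
  apply: (@rmorph_mmap k 3 (poly3 k) K (cst3r k) iota _ (xi 0)
    (ev3 iota (xi 0 o0) (xi 0 o1) (xi 0 o2)) p') => [c|]; first exact: ev3_cst.
  by apply: ord3_ind; rewrite ?vec30 ?vec31 ?vec32; [exact: ev3X|exact: ev3Y|exact: ev3Z].
by have [P eP] := conv p; have [R eR] := conv r; exists P, R; rewrite eP eR.
Qed.

Section FixedField.
Variables (x y z : K).
Hypothesis hK : curve_field q0 q m iota x y z.
Variable H : {pred curve_aut iota}.
Hypothesis hH : forall s : curve_aut iota, s \in H ->
  exists zeta : k, [/\ zeta ^+ m = 1, s x = x, s y = y & s z = iota zeta * z].
Local Notation L := (fixed_field H).
Local Notation lam := (fixed_const H).

Let z0 : z != 0 := z_neq0 hk hq0 hq hK.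

(** For H cyclic of order h these are the multiples of h. *)
Definition fixed_power (l : nat) : Prop :=
  forall s : curve_aut iota, s \in H -> s (z ^+ l) = z ^+ l.

Lemma fixed_power_m : fixed_power m.
Proof.
move=> s /hH[zeta [zm _ _ sz]].
by rewrite rmorphXn sz exprMn -rmorphXn zm rmorph1 mul1r.
Qed.

Lemma fixed_power_generator : exists2 h, (0 < h)%N &
  fixed_power h /\ forall l, fixed_power l -> (h %| l)%N.
Proof.
have ex : exists h, (0 < h)%N && `[< fixed_power h >].
  by exists m; rewrite addn1; apply/asboolP; rewrite -addn1; exact: fixed_power_m.
have [h /andP[h0 /asboolP hh] hmin] := ex_minnP ex; exists h => //; split=> // l hl.
have : fixed_power (l %% h).
  have eD : z ^+ l = z ^+ (l %/ h * h) * z ^+ (l %% h) by rewrite -exprD -divn_eq.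
  move=> s sH; have sD : s (z ^+ (l %/ h * h)) = z ^+ (l %/ h * h).
    by rewrite mulnC exprM rmorphXn (hh _ sH).
  apply: (mulfI (expf_neq0 (l %/ h * h) z0)).
  by rewrite -{1}sD -rmorphM -eD (hl _ sH).
move=> hr; rewrite /dvdn; apply: contraT; rewrite -lt0n => r0.
have := hmin (l %% h)%N; rewrite r0 => /(_ (asboolT hr)).
by rewrite leqNgt ltn_pmod.
Qed.

Let xF : x \in fixed_pred H.
Proof. by apply/asboolP => s /hH[zeta []]. Qed.
Let yF : y \in fixed_pred H.
Proof. by apply/asboolP => s /hH[zeta []]. Qed.

Section Generator.
Variables (h n : nat) (h_gt0 : (0 < h)%N) (hm : (n * h)%N = m).
Hypothesis hh : fixed_power h.
Hypothesis hdvd : forall l, fixed_power l -> (h %| l)%N.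

Let zF : z ^+ h \in fixed_pred H.
Proof. by apply/asboolP => s; exact: hh. Qed.

Definition quo_x : L := FixedField xF.
Definition quo_y : L := FixedField yF.
Definition quo_z : L := FixedField zF.

Fact fixed_val_zmod : zmod_morphism (@fixed_val k K iota H).
Proof. by []. Qed.
Fact fixed_val_monoid : monoid_morphism (@fixed_val k K iota H).
Proof. by []. Qed.
Definition fixed_inclusion : {rmorphism L -> K} :=
  HB.pack (@fixed_val k K iota H)
    (GRing.isZmodMorphism.Build L K (@fixed_val k K iota H) fixed_val_zmod)
    (GRing.isMonoidMorphism.Build L K (@fixed_val k K iota H) fixed_val_monoid).

Lemma val_ev3 P : fixed_val (ev3 lam quo_x quo_y quo_z P) = ev3 iota x y (z ^+ h) P.
Proof.
exact: (@rmorph_ev3 k L lam quo_x quo_y quo_z K fixed_inclusion iota P (fun=> erefl)).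
Qed.

(** Z - a divides Z^m - a^m. *)
Lemma divides_pow_m (c : {poly k}) : c != 0 ->
  exists c' D, pev iota z (c' * c) = pev iota (z ^+ m) D /\
    pev iota (z ^+ m) D != 0.
Proof.
move=> c0; have [rs ec] := closed_field_poly_normal c.
have lc : lead_coef c != 0 by rewrite lead_coef_eq0.
pose fac (a : k) : {poly k} := \sum_(i < m) 'X ^+ (m.-1 - i) * (a%:P) ^+ i.
have facE a : ('X - a%:P) * fac a = 'X^m - (a ^+ m)%:P.
  by rewrite /fac -subrXX rmorphXn.
exists ((lead_coef c)^-1 *: \prod_(a <- rs) fac a), (\prod_(a <- rs) ('X - (a ^+ m)%:P)).
split; last first.
  rewrite rmorph_prod prodf_seq_neq0; apply/allP => a _ /=.
  rewrite rmorphB /= pevX pevC.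
  have <- : pev iota z ('X^m - (a ^+ m)%:P) = z ^+ m - iota (a ^+ m).
    by rewrite rmorphB /= [pev _ _ 'X^m]rmorphXn /= pevX pevC.
  apply/eqP => /(pev_z_inj q1 qk hK)/eqP.
  by rewrite -size_poly_eq0 size_XnsubC // addn1.
have -> : (lead_coef c)^-1 *: \prod_(a <- rs) fac a * c
    = \prod_(a <- rs) ('X^m - (a ^+ m)%:P).
  rewrite [in X in _ * X = _]ec -scalerAr -scalerAl scalerA divff // scale1r.
  by rewrite mulrC -big_split /=; apply: eq_bigr => a _; exact: facE.
rewrite [LHS]rmorph_prod [RHS]rmorph_prod /=; apply: eq_bigr => a _.
by rewrite !rmorphB /= rmorphXn /= !pevX !pevC.
Qed.

Definition twist (zeta : k) (c : {poly k}) : {poly k} :=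
  \poly_(l < size c) (zeta ^+ l * c`_l).

Lemma pev_twist zeta c : pev iota z (twist zeta c) = pev iota (iota zeta * z) c.
Proof.
rewrite (pev_coef _ _ (size_poly _ _)) (pev_coef _ _ (leqnn _)).
apply: eq_bigr => l _; rewrite coef_poly ltn_ord rmorphM rmorphXn exprMn.
by rewrite mulrCA mulrA.
Qed.

Lemma twist0 zeta : twist zeta 0 = 0.
Proof. by apply/polyP => l; rewrite coef_poly size_poly0 coef0. Qed.

Definition twist3 zeta (P : poly3 k) : poly3 k := map_poly (map_poly (twist zeta)) P.

Lemma ev_twist3 zeta P :
  ev3 iota x y z (twist3 zeta P) = ev3 iota x y (iota zeta * z) P.
Proof.
have mt0 : map_poly (twist zeta) 0 = 0 by rewrite map_poly0.
rewrite /ev3 /twist3 (pev_coef _ _ (size_poly _ _)) (pev_coef _ _ (leqnn _)).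
apply: eq_bigr => j _; rewrite coef_map_id0 //; congr (_ * _) => /=.
rewrite (pev_coef _ _ (size_poly _ _)) (pev_coef _ _ (leqnn _)).
apply: eq_bigr => i _; rewrite coef_map_id0 ?twist0 //; congr (_ * _).
exact: pev_twist.
Qed.

(** In reduced form the automorphism z -> zeta z multiplies each monomial by
    a power of zeta, so only powers of z^h occur in an invariant polynomial. *)
Lemma fixed_reduced_coef (P : poly3 k) : reduced q P ->
  (forall s : curve_aut iota, s \in H -> s (ev3 iota x y z P) = ev3 iota x y z P) ->
  forall j i l, P`_j`_i`_l != 0 -> (h %| l)%N.
Proof.
move=> [sP sPj] fP j i l c0; apply: hdvd => s sH.
have [zeta [zm sx sy sz]] := hH sH.
have mt0 : map_poly (twist zeta) 0 = 0 by rewrite map_poly0.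
have e0 : ev3 iota x y z (twist3 zeta P - P) = 0.
  rewrite (ev3B iota x y z) ev_twist3 -(fP s sH).
  have -> := @rmorph_ev3 k K iota x y z K s iota P (aut_const s).
  by rewrite sx sy sz subrr.
have red : reduced q (twist3 zeta P - P).
  split.
    rewrite (leq_trans (size_polyD _ _)) // geq_max size_polyN sP andbT.
    exact: leq_trans (size_poly _ _) sP.
  move=> j'; rewrite coefB (leq_trans (size_polyD _ _)) // geq_max size_polyN sPj andbT.
  by rewrite coef_map_id0 // (leq_trans (size_poly _ _)).
have eP := curve_field_reduced q1 qk hK red e0.
have : (twist3 zeta P)`_j`_i`_l = P`_j`_i`_l.
  by apply/eqP; rewrite -subr_eq0 -!coefB eP !coef0.
rewrite coef_map_id0 // coef_map_id0 ?twist0 // coef_poly.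
case: ltnP => [_|le]; last by move: c0; rewrite nth_default ?eqxx.
rewrite -[X in _ = X]mul1r => /(mulIf c0) zl.
by rewrite rmorphXn sz exprMn -rmorphXn zl rmorph1 mul1r.
Qed.

Local Notation quo := (@is_quotient (poly3 k) K (ev3 iota x y (z ^+ h))).

Let quo_value P : quo (ev3 iota x y (z ^+ h) P).
Proof. exact: (@is_quotient_value (poly3 k) K (ev3 iota x y (z ^+ h)) P). Qed.

(** Once the denominator is a polynomial in z^m, which is invariant, so is the
    numerator. *)
Lemma fixed_is_quotient a : (forall s : curve_aut iota, s \in H -> s a = a) -> quo a.
Proof.
move=> fa; have [P [c [c0 ea]]] := denominator_in_z hk hq0 hq hK a.
have [c' [D [eD D0']]] := divides_pow_m c0.
have pc0 : pev iota z c != 0.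
  by apply: contraNneq c0 => /(pev_z_inj q1 qk hK) ->.
have tE : z ^+ m = (z ^+ h) ^+ n by rewrite -exprM [(h * n)%N]mulnC hm.
have orbit_eq s : s \in H -> s (z ^+ m) = z ^+ m by move=> sH; exact: fixed_power_m.
have [P1 rP1 eP1] := reduce_curve_eq q0 m q1 (P * cZ c').
have xyz : curve_eq q0 q m x y z by case: hK.
have A1 : ev3 iota x y z P1 = a * pev iota (z ^+ m) D.
  rewrite -(eP1 K iota x y z xyz) (ev3M iota x y z) ev3_cZ -eD rmorphM /= ea.
  by rewrite [X in _ = _ * X]mulrC mulrA divfK.
have qx : quo x by have := quo_value (vX k); rewrite (ev3X iota x y (z ^+ h)).
have qy : quo y by have := quo_value (vY k); rewrite (ev3Y iota x y (z ^+ h)).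
have qz : quo (z ^+ h) by have := quo_value (vZ k); rewrite (ev3Z iota x y (z ^+ h)).
have qc c1 : quo (iota c1).
  by have := quo_value (cst3 c1); rewrite (ev3_cst iota x y (z ^+ h)).
have quoA : quo (ev3 iota x y z P1).
  have fP1 s : s \in H -> s (ev3 iota x y z P1) = ev3 iota x y z P1.
    move=> sH; rewrite A1 rmorphM (fa _ sH); congr (_ * _).
    have -> := @rmorph_pev k K iota (z ^+ m) K s iota D (aut_const s).
    by rewrite (orbit_eq _ sH).
  have hl := fixed_reduced_coef rP1 fP1.
  rewrite /ev3 (pev_coef _ _ (leqnn _)); apply: is_quotient_sum => j.
  apply: is_quotientM; last exact: is_quotientX qy.
  rewrite /= (pev_coef _ _ (leqnn _)); apply: is_quotient_sum => i.
  apply: is_quotientM; last exact: is_quotientX qx.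
  rewrite /= (pev_coef _ _ (leqnn _)); apply: is_quotient_sum => l.
  have [->|cl] := eqVneq P1`_j`_i`_l 0.
    by rewrite rmorph0 mul0r -(rmorph0 iota); exact: qc.
  rewrite -(divnK (hl _ _ _ cl)) mulnC exprM.
  by apply: is_quotientM; [exact: qc|exact: is_quotientX qz].
have quoD : quo (pev iota (z ^+ m) D).
  rewrite (pev_coef _ _ (leqnn _)); apply: is_quotient_sum => l.
  apply: is_quotientM; first exact: qc.
  by apply: is_quotientX; rewrite tE; exact: is_quotientX qz.
rewrite -[a](mulfK D0') -A1; apply: is_quotientM => //; exact: is_quotientV.
Qed.

(** The quotient curve has the equations of the curve with z^m replaced by
    z^n, for n h = m; every point of it lies below a point of the curve, since
    h-th roots exist in k. *)
Lemma quotient_curve_field : curve_field q0 q n lam quo_x quo_y quo_z.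
Proof.
have [[Ey Ex] spec _] := hK; split.
- split; apply: (fmorph_inj fixed_inclusion);
    rewrite !(rmorphD, rmorphM, rmorphXn) //=.
  by rewrite -exprM [(h * n)%N]mulnC hm.
- move=> P P0 x0 y0 Z0 [Ey0 Ex0].
  pose P' : poly3 k := @ev3 k (poly3 k) (cst3r k) (vX k) (vY k) (vZ k ^+ h) P.
  have eP' (S : comNzRingType) (mu : {rmorphism k -> S}) (a b c : S) :
      ev3 mu a b c P' = ev3 mu a b (c ^+ h) P.
    apply: etrans (@rmorph_ev3 k (poly3 k) (cst3r k) (vX k) (vY k) (vZ k ^+ h) S
      (ev3 mu a b c) mu P (ev3_cst mu a b c)) _.
    have eZ : ev3 mu a b c (vZ k ^+ h) = c ^+ h.
      apply: etrans (rmorphXn (ev3 mu a b c) h (vZ k)) _.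
      by rewrite /= ev3Z.
    by rewrite /= eZ ev3X ev3Y.
  have e0 : ev3 iota x y z P' = 0 by rewrite eP' -val_ev3 P0.
  have [c0 zc0] : exists c0, c0 ^+ h = Z0.
    have /closed_rootP[c0] : size ('X^h - Z0%:P) != 1%N.
      by rewrite size_XnsubC // eqSS -lt0n.
    by rewrite /root hornerD hornerN hornerC hornerXn subr_eq0 => /eqP; exists c0.
  have := spec P' e0 x0 y0 c0; rewrite eP' zc0; apply; split=> //.
  by rewrite Ex0 -zc0 -exprM [(h * n)%N]mulnC hm.
move=> a.
have [|P [r [/= r0 /= ea]]] := @fixed_is_quotient (fixed_val a).
  by move=> s sH; move/asboolP: (fixed_valP a) => /(_ s sH).
exists P, r; rewrite -val_ev3 in r0; split.
  by apply: contraNneq r0 => ->.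
apply: (fmorph_inj fixed_inclusion).
by rewrite [RHS](rmorphM fixed_inclusion) fmorphV /= ea !val_ev3.
Qed.

End Generator.
End FixedField.
End Quotient.

Theorem theorem4 (k : closedFieldType) (hk : 2%N \in [pchar k])
    (e q0 q : nat) (hq0 : q0 = (2 ^ e)%N) (hq : q = (2 * q0 ^ 2)%N)
    (K : fieldType) (iota : {rmorphism k -> K}) (xi : 'rV[K]_3)
    (hK : affine_function_field iota (@skabelund_curve k q0 q) xi)
    (H : {pred curve_aut iota}) (hH : group_closed H)
    (hHC : {subset H <= root_of_unity_auts xi (q - 2 * q0 + 1)%N}) :
  exists f : 'rV[fixed_field H]_3,
    let psi_image := morphism_image (fixed_const H) f in
    [/\ birational_embedding (fixed_const H) f,
        plane_curve_of_degree (q ^ 2 + 1)%N psi_image &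
        exists P1 P2 : 'rV[k]_3,
          [/\ inner_galois_point psi_image P1,
              inner_galois_point psi_image P2 &
              ~ same_point P1 P2]].
Proof.
have cK := skabelund_curve_field hK.
have hHz (s : curve_aut iota) : s \in H -> exists zeta : k,
    [/\ zeta ^+ (q - 2 * q0 + 1) = 1, s (xi 0 o0) = xi 0 o0,
        s (xi 0 o1) = xi 0 o1 & s (xi 0 o2) = iota zeta * xi 0 o2].
  have e1 : (1 : 'I_3) = o1 by exact: val_inj.
  have e2 : (2 : 'I_3) = o2 by exact: val_inj.
  have e0 : (0 : 'I_3) = o0 by exact: val_inj.
  move=> /hHC/asboolP[zeta [zm]]; rewrite e2 e1 e0 => -[sx sy sz].
  by exists zeta.
have [h h_gt0 [hh hdvd]] := fixed_power_generator hk hq0 hq cK hHz.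
have /dvdnP[n hm] := hdvd _ (fixed_power_m hHz).
have cL := quotient_curve_field hk hq0 hq cK hHz h_gt0 (esym hm) hh hdvd.
exists (vec3 1 (W_fun q0 h (quo_x hHz) (quo_y hHz)) (quo_z hh)).
exact: (curve_field_plane_model hk hq0 hq (esym hm) cL).
Qed.
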